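(* Let $K\in\{K_0,K_1\}$ be one of the two standard maximal compact open subgroups of $G=U(2,1)(E/F)$ and let $\sigma$ be an irreducible smooth representation of $K$ over $\overline{\mathbf{F}}_p$. Then the compactly induced representation $\mathrm{ind}^G_K\sigma$, viewed as a left module over the spherical Hecke algebra $\mathcal{H}(K,\sigma)=\mathrm{End}_G(\mathrm{ind}^G_K\sigma)$, is a free $\mathcal{H}(K,\sigma)$-module of infinite rank.
   Context: Let $F$ be a non-archimedean local field of odd residue characteristic $p$, with residue field of cardinality $q$. Let $E/F$ be the unramified quadratic extension, with ring of integers $\mathfrak{o}_E$ and maximal ideal $\mathfrak{p}_E$, and let $x\mapsto\bar x$ be the nontrivial element of $\mathrm{Gal}(E/F)$. Let $\beta$ be the $3\times 3$ antidiagonal matrix with entries $1$ on the antidiagonal, and let $G=\{g\in GL_3(E): g^{T}\beta\bar g=\beta\}$ be the unitary group of the Hermitian form $h(v_1,v_2)=v_1^T\beta\bar v_2$ on $E^3$. Let $K_0=M_3(\mathfrak{o}_E)\cap G$ and let $K_1$ be the set of elements of $G$ whose entries $(a_{ij})$ satisfy $a_{11},a_{12},a_{22},a_{23},a_{33}\in\mathfrak{o}_E$, $a_{13}\in\mathfrak{p}_E^{-1}$, $a_{21},a_{31},a_{32}\in\mathfrak{p}_E$. The group $\mathrm{ind}^G_K\sigma$ is the space of locally constant functions $f:G\to W$ ($W$ the space of $\sigma$) with compact support such that $f(kg)=\sigma(k)f(g)$ for $k\in K$, $g\in G$, with $G$ acting by right translation. All representations are smooth over $\overline{\mathbf{F}}_p$.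 *)

(* Defs.v *)
From HB Require Import structures.
From mathcomp Require Import all_boot all_order all_algebra all_field.
Set Implicit Arguments. Unset Strict Implicit. Unset Printing Implicit Defensive.
Import Order.TTheory GRing.Theory Num.Theory.
Local Open Scope ring_scope.

Inductive maxcpt := K0 | K1.

Section UnitaryGroup.
(* E : the (local) field E; conj : the nontrivial element of Gal(E/F);
   v : the normalized discrete valuation of E (v 0 is irrelevant). *)
Variables (E : fieldType) (conj : E -> E) (v : E -> int).

Definition inP (n : int) (x : E) : bool := (x == 0) || (n <= v x).

(* E is a non-archimedean local field (complete discretely valued, finite
   residue field of characteristic p, p odd), conj is an automorphism of E
   of order 2 whose fixed field F contains a uniformizer of E, i.e.
   E/F is the unramified quadratic extension of the local field F. *)
Record unram_quad_local (p : nat) : Prop := {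
  conj_rmorph : forall x y, conj (x * y) = conj x * conj y /\
                            conj (x + y) = conj x + conj y;
  conj1 : conj 1 = 1;
  conj_invol : forall x, conj (conj x) = x;
  conj_nontriv : exists x, conj x != x;
  v_mul : forall x y, x != 0 -> y != 0 -> v (x * y) = v x + v y;
  v_add : forall x y, x != 0 -> y != 0 -> x + y != 0 ->
            Num.min (v x) (v y) <= v (x + y);
  v_conj : forall x, x != 0 -> v (conj x) = v x;
  unif_in_F : exists w, [/\ conj w = w, w != 0 & v w = 1];
  v_complete : forall u : nat -> E,
    (forall N : nat, exists n0, forall m n, (n0 <= m)%N -> (n0 <= n)%N ->
        inP N%:Z (u m - u n)) ->
    exists l, forall N : nat, exists n0, forall n, (n0 <= n)%N ->
        inP N%:Z (u n - l);
  residue_finite : exists r : seq E,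
    forall x, inP 0 x -> exists2 y, y \in r & inP 1 (x - y);
  p_prime : prime p;
  p_odd : odd p;
  residue_char : inP 1 p%:R }.

Definition beta : 'M[E]_3 := \matrix_(i, j) (((i : nat) + j == 2)%N)%:R.

Definition inG (g : 'M[E]_3) : bool :=
  g^T *m beta *m map_mx conj g == beta.

Definition Kbound (c : maxcpt) (i j : 'I_3) : int :=
  match c with
  | K0 => 0
  | K1 => if ((i : nat) == 0%N) && ((j : nat) == 2%N) then -1
          else if (j < i)%N then 1 else 0
  end.

Definition inK (c : maxcpt) (g : 'M[E]_3) : bool :=
  inG g && [forall i, forall j, inP (Kbound c i j) (g i j)].

Definition cong1 (N : nat) (g : 'M[E]_3) : Prop :=
  forall i j, inP N%:Z ((g - 1%:M) i j).

Section Reps.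
Variables (C : fieldType) (W : lmodType C) (c : maxcpt)
          (sigma : 'M[E]_3 -> W -> W).

Definition smooth_irrep : Prop :=
  [/\ forall k, inK c k -> forall (a : C) (x y : W),
         sigma k (a *: x + y) = a *: sigma k x + sigma k y,
      forall w, sigma 1%:M w = w,
      forall k k', inK c k -> inK c k' -> forall w,
         sigma (k *m k') w = sigma k (sigma k' w),
      forall w, exists N : nat, forall k, inG k -> cong1 N.+1 k ->
         sigma k w = w
    & (exists w : W, w != 0) /\
      forall S : W -> Prop,
        S 0 -> (forall (a : C) x y, S x -> S y -> S (a *: x + y)) ->
        (forall k w, inK c k -> S w -> S (sigma k w)) ->
        (forall w, S w) \/ (forall w, S w -> w = 0)].

Definition in_ind (f : 'M[E]_3 -> W) : Prop :=
  [/\ forall x, ~~ inG x -> f x = 0,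
      forall k g, inK c k -> inG g -> f (k *m g) = sigma k (f g),
      forall g, inG g -> exists N : nat, forall h, inG h ->
         (forall i j, inP N%:Z (h i j - g i j)) -> f h = f g
    & (* compact support: the support is bounded in G *)
      exists N : nat, forall x, inG x -> f x != 0 ->
         forall i j, inP (- N%:Z) (x i j)].

Definition rtrans (g : 'M[E]_3) (f : 'M[E]_3 -> W) : 'M[E]_3 -> W :=
  fun x => f (x *m g).

Definition endo := ('M[E]_3 -> W) -> ('M[E]_3 -> W).

Definition in_hecke (phi : endo) : Prop :=
  [/\ forall f, in_ind f -> in_ind (phi f),
      forall (a : C) f f', in_ind f -> in_ind f' -> forall x,
         phi (fun y => a *: f y + f' y) x = a *: phi f x + phi f' x
    & forall g f, inG g -> in_ind f -> forall x,
         phi (rtrans g f) x = rtrans g (phi f) x].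

Definition free_infinite_rank : Prop :=
  exists (I : eqType) (b : I -> 'M[E]_3 -> W),
  [/\ ~ (exists s : seq I, forall i, i \in s),
      forall i, in_ind (b i),
      forall f, in_ind f -> exists (s : seq I) (phi : I -> endo),
         (forall i, in_hecke (phi i)) /\
         forall x, f x = \sum_(i <- s) phi i (b i) x
    & forall (s : seq I) (phi : I -> endo), uniq s ->
         (forall i, in_hecke (phi i)) ->
         (forall x, \sum_(i <- s) phi i (b i) x = 0) ->
         forall i, i \in s -> forall f, in_ind f -> forall x, phi i f x = 0].

End Reps.
End UnitaryGroup.

Definition is_Fpbar (p : nat) (C : closedFieldType) : Prop :=
  p \in [pchar C] /\ forall x : C, exists n : nat, (0 < n)%N /\ x ^+ (p ^ n) = x.

(* Main.v *)
Require Import Defs.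
From HB Require Import structures.
From mathcomp Require Import all_boot all_order all_algebra all_field.
From mathcomp Require Import fingroup perm action cyclic pgroup sylow.
From mathcomp Require Import zify ring.
From mathcomp Require Import boolp functions.
Set Implicit Arguments. Unset Strict Implicit. Unset Printing Implicit Defensive.
Import Order.TTheory GRing.Theory Num.Theory.
Local Open Scope ring_scope.

(** For the base vertex of the tree of G and a function f in the induced representation, let
    the radius of f be the largest distance of a vertex in its support. The group K acts
    through a finite group with a split BN-pair of rank one, so, the characteristic being p,
    the invariants of sigma under a pro-p Iwahori subgroup form a line, mapping isomorphically
    onto the coinvariants of the opposite subgroup. Mackey's formula then gives exactly one
    Hecke operator for each double coset of K, and the Hecke algebra is the algebra of
    polynomials in the operator T attached to the first nontrivial one. Since a vertex of
    the tree has a single parent, T increases the radius by one and is injective on the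
    associated graded space; bases of the cokernels of T on the graded pieces lift to a
    basis over the Hecke algebra. It is infinite because T f takes the same values, up to
    identification, at two children of a vertex lying on a common edge. *)

(** * Linear algebra over a field *)

Section Subspaces.
Variables (C : fieldType) (V : lmodType C).
Implicit Types (S : V -> Prop) (a : C) (x y z : V) (l : seq V).

(** [W] is not known to be finite-dimensional, nor the action of K to factor through a finite group,
    until both have been proved: smoothness only fixes each vector at some depth of the congruence
    filtration, and finite lists of coset representatives stand for the quotient groups. Subspaces
    are predicates, and quotients are replaced by statements modulo a subspace [S'], because
    coinvariants call for vectors fixed in a subquotient of [W], not only in [W]. The comparison of
    invariants with coinvariants rests on one criterion: if an Iwahori eigenvector lies in the span
    of its own big cell, that span is [W], and the coinvariants are then at most a line. The
    operator [tau] on invariants produces such a vector, whether it kills the given one or not.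
    [heckeT] keeps only the scalar [pr] of a value, yet loses nothing on the outer sphere:
    translations contract the integral unipotent group into K, so [pr] is seen at all unipotent
    translates of the value, and these separate the vectors of [W]. *)

Definition subsp S := S 0 /\ forall a x y, S x -> S y -> S (a *: x + y).

Lemma subspD S x y : subsp S -> S x -> S y -> S (x + y).
Proof. by move=> [_ h] hx hy; rewrite -[x]scale1r; apply: h. Qed.

Lemma subspZ S a x : subsp S -> S x -> S (a *: x).
Proof. by move=> [h0 h] hx; rewrite -[_ *: _]addr0; apply: h. Qed.

Lemma subspN S x : subsp S -> S x -> S (- x).
Proof. by move=> hS hx; rewrite -scaleN1r; apply: subspZ. Qed.

Lemma subspB S x y : subsp S -> S x -> S y -> S (x - y).
Proof. by move=> hS hx hy; apply: subspD => //; apply: subspN. Qed.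

Lemma subsp_addr S x y : subsp S -> S x -> (S (x + y) <-> S y).
Proof.
move=> hS hx; split=> h; last exact: subspD.
by rewrite -[y](addKr x) addrC; apply: subspB.
Qed.

Lemma subspZ_inv S a x : subsp S -> a != 0 -> S (a *: x) -> S x.
Proof. by move=> hS a0 h; rewrite -[x](scalerK a0); apply: subspZ. Qed.

Lemma subsp_sum S (I : Type) (r : seq I) (P : pred I) (F : I -> V) :
  subsp S -> (forall i, P i -> S (F i)) -> S (\sum_(i <- r | P i) F i).
Proof.
by move=> hS h; apply: big_ind => //; [case: hS | move=> *; apply: subspD].
Qed.

Lemma subsp_sum_in S (I : eqType) (r : seq I) (F : I -> V) :
  subsp S -> (forall i, i \in r -> S (F i)) -> S (\sum_(i <- r) F i).
Proof. by move=> hS h; rewrite big_seq; apply: subsp_sum. Qed.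

Definition spanP (P : V -> Prop) y :=
  forall S, subsp S -> (forall z, P z -> S z) -> S y.

Lemma spanP_subsp P : subsp (spanP P).
Proof.
split=> [S [] //|a x y hx hy S hS h].
by apply: (proj2 hS); [apply: hx | apply: hy].
Qed.

Lemma spanP_gen (P : V -> Prop) y : P y -> spanP P y.
Proof. by move=> h S _; apply. Qed.

Lemma spanP_sub (P Q : V -> Prop) y :
  (forall z, P z -> spanP Q z) -> spanP P y -> spanP Q y.
Proof. by move=> h hy; apply: hy => //; apply: spanP_subsp. Qed.

Definition addsp S1 S2 y := exists x1 x2, [/\ S1 x1, S2 x2 & y = x1 + x2].

Lemma addsp_subsp S1 S2 : subsp S1 -> subsp S2 -> subsp (addsp S1 S2).
Proof.
move=> h1 h2; split; first by exists 0, 0; rewrite addr0; case: h1; case: h2.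
move=> a _ _ [x1] [x2] [hx1 hx2 ->] [y1] [y2] [hy1 hy2 ->].
exists (a *: x1 + y1), (a *: x2 + y2); split.
- exact: (proj2 h1).
- exact: (proj2 h2).
- by rewrite scalerDr addrACA.
Qed.

Definition line x y := exists a, y = a *: x.

Lemma line_subsp x : subsp (line x).
Proof.
split=> [|a _ _ [b ->] [c ->]]; first by exists 0; rewrite scale0r.
by exists (a * b + c); rewrite scalerDl scalerA.
Qed.

Definition linop (A : V -> V) := forall a x y, A (a *: x + y) = a *: A x + A y.

Lemma linop0 A : linop A -> A 0 = 0.
Proof.
move=> h; have := h (-1) 0 0.
by rewrite scaler0 addr0 scaleN1r addNr.
Qed.
Lemma linopD A x y : linop A -> A (x + y) = A x + A y.
Proof. by move=> h; rewrite -[x in LHS]scale1r h scale1r. Qed.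
Lemma linopZ A a x : linop A -> A (a *: x) = a *: A x.
Proof. by move=> h; rewrite -[_ *: x]addr0 h linop0 ?addr0. Qed.
Lemma linopN A x : linop A -> A (- x) = - A x.
Proof. by move=> h; rewrite -scaleN1r linopZ // scaleN1r. Qed.
Lemma linopB A x y : linop A -> A (x - y) = A x - A y.
Proof. by move=> h; rewrite linopD // linopN. Qed.
Lemma linop_sum A (I : Type) (r : seq I) (F : I -> V) :
  linop A -> A (\sum_(i <- r) F i) = \sum_(i <- r) A (F i).
Proof.
move=> h; elim: r => [|i r IH]; first by rewrite !big_nil linop0.
by rewrite !big_cons linopD // IH.
Qed.

Lemma subsp_preim A S : linop A -> subsp S -> subsp (fun y => S (A y)).
Proof.
move=> hA hS; split; first by rewrite linop0 //; case: hS.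
by move=> a x y hx hy; rewrite hA; apply: (proj2 hS).
Qed.

Lemma subsp_and S1 S2 : subsp S1 -> subsp S2 -> subsp (fun y => S1 y /\ S2 y).
Proof.
move=> [h1 k1] [h2 k2]; split=> // a x y [hx1 hx2] [hy1 hy2].
by split; [apply: k1 | apply: k2].
Qed.

Lemma subsp_eigen A S a : linop A -> subsp S -> subsp (fun y => S (A y - a *: y)).
Proof.
move=> hA hS; apply: (@subsp_preim (fun y => A y - a *: y)) => // b x y.
by rewrite hA scalerBr scalerDr opprD addrACA !scalerA mulrC.
Qed.

Definition spanm S l := spanP (fun z => S z \/ z \in l).

Lemma spanm_subsp S l : subsp (spanm S l).
Proof. exact: spanP_subsp. Qed.

Lemma spanm_nil S y : subsp S -> spanm S [::] y -> S y.
Proof. by move=> hS; apply => // z []. Qed.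

Lemma spanm_base S l y : S y -> spanm S l y.
Proof. by move=> h; apply: spanP_gen; left. Qed.

Lemma spanm_mem S l y : y \in l -> spanm S l y.
Proof. by move=> h; apply: spanP_gen; right. Qed.

Lemma spanm_sub S S' l l' y :
  (forall z, S z -> spanm S' l' z) -> (forall z, z \in l -> spanm S' l' z) ->
  spanm S l y -> spanm S' l' y.
Proof. by move=> h1 h2; apply: spanP_sub => z []; [apply: h1 | apply: h2]. Qed.

Lemma spanm_cons S z l y :
  spanm S (z :: l) y -> exists a, spanm S l (y - a *: z).
Proof.
move=> h; apply: (h (fun y => exists a, spanm S l (y - a *: z))); first split.
- by exists 0; rewrite scale0r subr0; case: (spanm_subsp S l).
- move=> a x x' [b hb] [c hc]; exists (a * b + c).
  rewrite scalerDl -scalerA opprD addrACA -scalerBr.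
  exact: (proj2 (spanm_subsp _ _)).
- move=> x [hx|]; first by exists 0; rewrite scale0r subr0; apply: spanm_base.
  rewrite inE => /orP [/eqP ->|hx].
    by exists 1; rewrite scale1r subrr; case: (spanm_subsp S l).
  by exists 0; rewrite scale0r subr0; apply: spanm_mem.
Qed.

Lemma spanm_sumE S l y : subsp S -> spanm S l y ->
  exists a : nat -> C, S (y - \sum_(i < size l) a i *: l`_i).
Proof.
move=> hS; elim: l y => [|z l IH] y hy.
  by exists (fun=> 0); rewrite big_ord0 subr0; apply: spanm_nil.
have [a /IH [b hb]] := spanm_cons hy.
exists (fun i => if i is j.+1 then b j else a).
by rewrite big_ord_recl /= opprD addrA.
Qed.

(** Steinitz exchange relative to [S]: a generator that occurs in [x] with nonzero coefficient can
    be traded for [x]. *)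
Lemma spanm_exchange S l x : subsp S -> spanm S l x -> ~ S x ->
  exists2 z, z \in l & spanm (addsp S (line x)) (rem z l) z.
Proof.
move=> hS; elim: l => [|z l IH] hx hnx; first by case: hnx; apply: spanm_nil.
have hsub l' y : spanm S l' y -> spanm (addsp S (line x)) l' y.
  apply: spanm_sub => // [u hu|u hu]; last exact: spanm_mem.
  apply: spanm_base; exists u, 0; rewrite addr0; split=> //.
  by exists 0; rewrite scale0r.
have [a ha] := spanm_cons hx.
have [a0|a0] := eqVneq a 0.
  move: ha; rewrite a0 scale0r subr0 => /IH - /(_ hnx) [z' hz' hz].
  exists z'; first by rewrite inE hz' orbT.
  apply: spanm_sub hz => [u|u hu]; first exact: spanm_base.
  apply: spanm_mem => /=; case: eqP => [e|_]; first exact: mem_rem hu.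
  by rewrite inE hu orbT.
exists z; rewrite ?mem_head //= eqxx.
apply: (subspZ_inv (spanm_subsp _ _) a0).
have -> : a *: z = x - (x - a *: z) by rewrite opprB addrC subrK.
apply: (subspB (spanm_subsp _ _)); last exact: hsub.
apply: spanm_base; exists 0, x; rewrite add0r; split=> //; first by case: hS.
by exists 1; rewrite scale1r.
Qed.

Lemma basis_mod S l : subsp S -> exists s : seq V,
  [/\ {subset s <= l}, forall y, spanm S l y -> spanm S s y
    & forall a : nat -> C, S (\sum_(i < size s) a i *: s`_i) ->
        forall i, (i < size s)%N -> a i = 0].
Proof.
move=> hS; elim: l => [|z l [s [h1 h2 h3]]].
  by exists [::]; split=> //.
have [hz|hz] := pselect (spanm S s z).
  exists s; split=> // [u hu|y]; first by rewrite inE h1 // orbT.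
  apply: spanm_sub => u; first exact: spanm_base.
  by rewrite inE => /orP [/eqP -> //|hu]; apply: h2; apply: spanm_mem.
exists (z :: s); split.
- move=> u; rewrite !inE => /orP [-> //|hu]; apply/orP; right; exact: h1.
- move=> y; apply: spanm_sub => u; first exact: spanm_base.
  rewrite inE => /orP [/eqP ->|hu]; first by apply: spanm_mem; rewrite mem_head.
  have /h2 : spanm S l u by apply: spanm_mem.
  apply: spanm_sub => t; first exact: spanm_base.
  by move=> ht; apply: spanm_mem; rewrite inE ht orbT.
- move=> a; rewrite big_ord_recl /= => ha.
  have hs : spanm S s (\sum_(i < size s) a i.+1 *: s`_i).
    apply: (subsp_sum _ (spanm_subsp _ _)) => i _.
    by apply: (subspZ _ (spanm_subsp _ _)); apply: spanm_mem; apply: mem_nth.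
  have a0 : a 0%N = 0.
    apply/eqP; apply: contrapT => /negP a0; apply: hz.
    apply: (subspZ_inv (spanm_subsp _ _) a0).
    by apply/(subsp_addr _ (spanm_subsp _ _) hs); rewrite addrC; apply: spanm_base.
  move: ha; rewrite a0 scale0r add0r => /(h3 (fun i => a i.+1)) h.
  by case=> [|i] //; apply: h.
Qed.

End Subspaces.

(** * Polynomials in an operator that is linear on a subspace *)

Section PolynomialAction.
Variables (C : fieldType) (V : lmodType C) (A : V -> Prop) (T : V -> V).
Hypothesis hA : subsp A.
Hypothesis AT : forall x, A x -> A (T x).
Hypothesis Tlin : forall a x y, A x -> A y -> T (a *: x + y) = a *: T x + T y.

Definition pact (q : {poly C}) x := \sum_(i < size q) q`_i *: iter i T x.

Lemma iterA n x : A x -> A (iter n T x).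
Proof. by move=> hx; elim: n => //= n; apply: AT. Qed.

Lemma pactA q x : A x -> A (pact q x).
Proof. by move=> hx; apply: subsp_sum => // i _; apply: subspZ => //; apply: iterA. Qed.

Lemma pact_widen N (q : {poly C}) x : (size q <= N)%N ->
  pact q x = \sum_(i < N) q`_i *: iter i T x.
Proof.
move=> hN; rewrite /pact (big_ord_widen N (fun i => q`_i *: iter i T x) hN).
rewrite big_mkcond /=; apply: eq_bigr => i _; case: ltnP => // h.
by rewrite nth_default // scale0r.
Qed.

Lemma pactD q r x : pact (q + r) x = pact q x + pact r x.
Proof.
pose N := maxn (size q) (size r).
rewrite (@pact_widen N (q + r)) ?size_polyD // (@pact_widen N q) ?leq_maxl //.
rewrite (@pact_widen N r) ?leq_maxr // -big_split /=.
by apply: eq_bigr => i _; rewrite coefD scalerDl.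
Qed.

Lemma pactZ a q x : pact (a *: q) x = a *: pact q x.
Proof.
rewrite (@pact_widen (size q)) ?size_scale_leq // scaler_sumr.
by apply: eq_bigr => i _; rewrite coefZ scalerA.
Qed.

Lemma pact0 x : pact 0 x = 0.
Proof. by rewrite /pact size_poly0 big_ord0. Qed.

Lemma pactC a x : pact a%:P x = a *: x.
Proof. by rewrite (@pact_widen 1) ?size_polyC_leq1 // big_ord1 coefC. Qed.

Lemma pactXn n x : pact 'X^n x = iter n T x.
Proof.
rewrite /pact size_polyXn big_ord_recr /= coefXn eqxx scale1r big1 ?add0r // => i _.
by rewrite coefXn ltn_eqF // scale0r.
Qed.

Lemma pactMX q x : pact (q * 'X) x = pact q (T x).
Proof.
rewrite (@pact_widen (size q).+1) ?size_polyMleq //; last first.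
  by rewrite (leq_trans (size_polyMleq _ _)) // size_polyX addn2.
rewrite big_ord_recl coefMX eqxx scale0r add0r.
by apply: eq_bigr => i _; rewrite coefMX -iterSr.
Qed.

Lemma T0 : T 0 = 0.
Proof.
have h0 : A 0 by case: hA.
by have := Tlin (-1) h0 h0; rewrite scaler0 addr0 scaleN1r addNr.
Qed.

Lemma T_sum (I : Type) (r : seq I) (F : I -> V) : (forall i, A (F i)) ->
  T (\sum_(i <- r) F i) = \sum_(i <- r) T (F i).
Proof.
move=> h; elim: r => [|i r IH]; first by rewrite !big_nil T0.
rewrite !big_cons -[F i]scale1r Tlin ?scale1r ?IH //.
by apply: subsp_sum.
Qed.

Lemma TZ a x : A x -> T (a *: x) = a *: T x.
Proof. by move=> hx; rewrite -[_ *: x]addr0 Tlin ?T0 ?addr0 //; case: hA. Qed.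

Lemma pactTC q x : A x -> pact q (T x) = T (pact q x).
Proof.
move=> hx; rewrite /pact T_sum => [|i]; last by apply: subspZ => //; apply: iterA.
by apply: eq_bigr => i _; rewrite TZ -?iterS ?iterSr //; apply: iterA.
Qed.

Lemma iter_lin n a x y : A x -> A y ->
  iter n T (a *: x + y) = a *: iter n T x + iter n T y.
Proof. by move=> hx hy; elim: n => //= n ->; rewrite Tlin //; apply: iterA. Qed.

Lemma pact_lin q a x y : A x -> A y -> pact q (a *: x + y) = a *: pact q x + pact q y.
Proof.
move=> hx hy; rewrite /pact scaler_sumr -big_split /=; apply: eq_bigr => i _.
by rewrite iter_lin // scalerDr !scalerA mulrC.
Qed.

End PolynomialAction.

(** * Eigenvectors and coinvariants modulo a subspace *)

Section Eigenvectors.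
Variables (C : closedFieldType) (V : lmodType C).
Implicit Types S : V -> Prop.

(** [X^d - 1] splits into linear factors over the closed field and maps [S] into [S']. The factors
    are applied to [x] one after the other; the last vector still outside [S'] is an eigenvector
    modulo [S']. *)
Lemma eigenvector_mod (A : V -> V) S S' d :
  linop A -> subsp S -> subsp S' ->
  (forall y, S y -> S (A y)) -> (0 < d)%N ->
  (forall y, S y -> S' (iter d A y - y)) -> (exists2 x, S x & ~ S' x) ->
  exists x a, [/\ S x, ~ S' x & S' (A x - a *: x)].
Proof.
move=> linA hS hS' AS d0 hd [x Sx S'x].
have [r hr] := closed_field_poly_normal ('X^d - 1 : {poly C}).
have hl : lead_coef ('X^d - 1 : {poly C}) = 1 by apply/eqP/monicXnsubC.
have e : S' (pact A (\prod_(z <- r) ('X - z%:P)) x).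
  rewrite -[\prod_(z <- r) _]scale1r -hl -hr pactD pactXn.
  by rewrite -polyC1 -polyCN pactC scaleN1r; apply: hd.
elim: r {hr hl} x Sx S'x e => [|z r IH] x Sx S'x.
  by rewrite big_nil -polyC1 pactC scale1r.
rewrite big_cons mulrC mulrBr pactD pactMX -mulrN -polyCN.
rewrite [_ * _%:P]mulrC mul_polyC pactZ scaleNr.
have lin : forall a x y, True -> True -> A (a *: x + y) = a *: A x + A y by [].
have triv : subsp (fun _ : V => True) by [].
move=> e; have [hz|hz] := pselect (S' (A x - z *: x)); first by exists x, z.
apply: (IH _ _ hz); first by apply: subspB => //; [apply: AS | apply: subspZ].
rewrite [_ - _]addrC -scaleNr (pact_lin (A := fun _ => True)) //.
by rewrite scaleNr addrC.
Qed.

(** [S] shrinks to the eigenspace modulo [S'] of one element after another; it stays stable under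
    all of [H] because the operators commute modulo [S']. The list [gs] is meant to represent the
    cosets of a subgroup acting trivially on [S] modulo [S']. *)
Lemma common_eigenvector_mod (J : eqType) (H : J -> Prop) (A : J -> V -> V) S'
    (gs : seq J) S :
  (forall g, H g -> linop (A g)) -> subsp S' ->
  (forall g y, H g -> S' y -> S' (A g y)) -> (forall g, g \in gs -> H g) ->
  subsp S -> (forall g y, H g -> S y -> S (A g y)) ->
  (forall g h y, H g -> H h -> S y -> S' (A g (A h y) - A h (A g y))) ->
  (forall g, H g -> exists2 d, (0 < d)%N & forall y, S y -> S' (iter d (A g) y - y)) ->
  (exists2 x, S x & ~ S' x) ->
  exists x, [/\ S x, ~ S' x & forall g, g \in gs -> exists a, S' (A g x - a *: x)].
Proof.
move=> linA hS' AS' hgs.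
elim: gs hgs S => [|g gs IH] hgs S hS AS comm ford [x Sx S'x]; first by exists x.
have Hg : H g by apply: hgs; rewrite mem_head.
have [d d0 hd] := ford g Hg.
have [y [a [Sy S'y hy]]] := eigenvector_mod (linA g Hg) hS hS' (fun y => AS g y Hg)
  d0 hd (ex_intro2 _ _ x Sx S'x).
case: (IH _ (fun z => S z /\ S' (A g z - a *: z))).
- by move=> h hh; apply: hgs; rewrite inE hh orbT.
- by apply: subsp_and => //; apply: subsp_eigen => //; apply: linA.
- move=> h z Hh [Sz hz]; split; first exact: AS.
  have -> : A g (A h z) - a *: A h z =
      (A g (A h z) - A h (A g z)) + A h (A g z - a *: z).
    by rewrite (linopB _ _ (linA _ Hh)) (linopZ _ _ (linA _ Hh)) addrA subrK.
  by apply: subspD => //; [apply: comm | apply: AS'].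
- by move=> h k z Hh Hk [Sz _]; apply: comm.
- by move=> h Hh; have [e e0 he] := ford h Hh; exists e => // z [Sz _]; apply: he.
- by exists y.
move=> z [[Sz hz] S'z hgz]; exists z; split=> // h; rewrite inE => /orP [/eqP ->|].
  by exists a.
exact: hgz.
Qed.

(* Adjoin to a proper stable subspace, one at a time, vectors that are fixed modulo it; the
   last proper subspace obtained is the required one. *)
Lemma coinvariants_neq0 (J : Type) (H : J -> Prop) (A : J -> V -> V) S (l : seq V) :
  (forall g, H g -> linop (A g)) -> subsp S ->
  (forall g y, H g -> S y -> S (A g y)) ->
  (forall y, S y -> spanP (fun z => z \in l) y) ->
  (forall S', subsp S' -> (forall g y, H g -> S' y -> S' (A g y)) ->
     (forall y, S' y -> S y) -> (exists2 x, S x & ~ S' x) ->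
     exists x, [/\ S x, ~ S' x & forall g, H g -> S' (A g x - x)]) ->
  (exists2 x, S x & x <> 0) ->
  exists S'', [/\ subsp S'', forall y, S'' y -> S y, exists2 x, S x & ~ S'' x
    & forall g y, H g -> S y -> S'' (A g y - y)].
Proof.
move=> linA hS AS hl fixS [x0 Sx0 x00].
pose Z (y : V) := y = 0.
have hZ : subsp Z by split=> // a x y -> ->; rewrite scaler0 addr0.
have AZ g y : H g -> Z y -> Z (A g y) by move=> Hg ->; apply: linop0; apply: linA.
have {hl} : forall y, S y -> spanm Z l y.
  by move=> y /hl; apply: spanP_sub => z hz; apply: spanm_mem.
have ZS y : Z y -> S y by move=> ->; case: hS.
have : exists2 x, S x & ~ Z x by exists x0.
move: Z hZ AZ ZS {x0 Sx0 x00}.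
have [n] := ubnP (size l); elim: n l => // n IH l hn S' hS' AS' S'S S'n hl.
have [x [Sx S'x hx]] := fixS _ hS' AS' S'S S'n.
pose S1 := addsp S' (line x).
have hS1 : subsp S1 by apply: addsp_subsp => //; apply: line_subsp.
have S1S y : S1 y -> S y.
  by move=> [y1] [_] [h1 [a ->] ->]; apply: subspD; [|apply: S'S|apply: subspZ].
have S'S1 y : S' y -> S1 y.
  by move=> hy; exists y, 0; rewrite addr0; split=> //; exists 0; rewrite scale0r.
have hAS1 g y : H g -> S1 y -> S' (A g y - y).
  move=> Hg [y1] [_] [h1 [a ->] ->].
  rewrite (linopD _ _ (linA _ Hg)) (linopZ _ _ (linA _ Hg)).
  rewrite opprD addrACA -scalerBr; apply: subspD => //.
    by apply: subspB => //; apply: AS'.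
  by apply: subspZ => //; apply: hx.
have [hp|hp] := pselect (exists2 y, S y & ~ S1 y); last first.
  exists S'; split=> // g y Hg Sy; apply: hAS1 => //.
  by apply: contrapT => h; apply: hp; exists y.
have [z hz hzs] := spanm_exchange hS' (hl _ Sx) S'x.
apply: (IH (rem z l) _ S1) => //.
- by rewrite size_rem //; case: (l) hz hn.
- move=> g y Hg hy; rewrite -[A g y](subrK y); apply: subspD => //.
  by apply: S'S1; apply: hAS1.
- move=> y /hl; apply: spanm_sub => u hu; first by apply: spanm_base; apply: S'S1.
  have [-> //|ne] := eqVneq u z.
  by apply: spanm_mem; move: hu; rewrite (perm_mem (perm_to_rem hz)) inE (negPf ne).
Qed.

End Eigenvectors.

(** * Finite systems of representatives and their permutations *)

Section Representatives.
Variables (T : choiceType) (S : T -> Prop) (e : T -> T -> Prop).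
Hypothesis e_refl : forall x, S x -> e x x.
Hypothesis e_sym : forall x y, S x -> S y -> e x y -> e y x.
Hypothesis e_trans : forall x y z, S x -> S y -> S z -> e x y -> e y z -> e x z.

Record reps (R : seq T) : Prop := Reps {
  reps_uniq : uniq R;
  reps_in : forall r, r \in R -> S r;
  reps_cover : forall x, S x -> exists2 r, r \in R & e x r;
  reps_inj : forall r r', r \in R -> r' \in R -> e r r' -> r = r' }.

(** The elements of [Q] are mere labels for the pieces of a finite covering, not points of [S]: this
    is the form in which compactness supplies them. A point is chosen in each piece that contains a
    new class. *)
Lemma reps_exist (U : eqType) (Q : seq U) (P : T -> U -> Prop) :
  (forall x, S x -> exists2 q, q \in Q & P x q) ->
  (forall x y q, S x -> S y -> P x q -> P y q -> e x y) -> exists R, reps R.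
Proof.
move=> hQ hP.
suff [R [h1 h2 h3 h4]] : exists R, [/\ uniq R, forall r, r \in R -> S r,
   forall x q, S x -> q \in Q -> P x q -> exists2 r, r \in R & e x r
   & forall r r', r \in R -> r' \in R -> e r r' -> r = r'].
  by exists R; split=> // x Sx; have [q hq hx] := hQ x Sx; apply: h3 hq hx.
elim: Q {hQ} => [|q Q [R [h1 h2 h3 h4]]]; first by exists [::].
have [[x [Sx Px hx]]|h] :=
    pselect (exists x, [/\ S x, P x q & forall r, r \in R -> ~ e x r]).
  exists (x :: R); split.
  - rewrite /= h1 andbT; apply/negP => /[dup] xR /hx; apply; exact: e_refl.
  - by move=> r; rewrite inE => /orP [/eqP -> //|]; apply: h2.
  - move=> y q' Sy; rewrite inE => /orP [/eqP -> Py|hq' Py].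
      by exists x; rewrite ?mem_head //; apply: hP Py Px.
    by have [r rR er] := h3 y q' Sy hq' Py; exists r => //; rewrite inE rR orbT.
  - move=> r r'; rewrite !inE => /orP [/eqP ->|hr] /orP [/eqP ->|hr'] // he.
    + by case: (hx _ hr').
    + by case: (hx _ hr); apply: e_sym => //; apply: h2.
    + exact: h4.
exists R; split=> // x q' Sx; rewrite inE => /orP [/eqP -> Px|]; last exact: h3.
by apply: contrapT => hn; apply: h; exists x; split=> // r rR er; apply: hn; exists r.
Qed.

Variable R : seq T.
Hypothesis hR : reps R.

Lemma reps_sum1 (V : nmodType) (F : T -> V) x :
  S x -> (forall r y, S r -> S y -> e r y -> F r = F y) ->
  (forall r, r \in R -> F r <> 0 -> e r x) ->
  \sum_(r <- R) F r = F x.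
Proof.
move=> Sx hF h; have [r0 r0R er0] := reps_cover hR Sx.
have Sr0 := reps_in hR r0R.
rewrite (bigD1_seq r0) ?(reps_uniq hR) //= big_seq_cond big1 ?addr0.
  by apply: hF => //; apply: e_sym.
move=> r /andP [rR ne]; apply: contrapT => /(h _ rR) er.
have Sr := reps_in hR rR.
case/eqP: ne; apply: (reps_inj hR) => //; exact: e_trans er er0.
Qed.

Variable f : T -> T.
Hypothesis fS : forall x, S x -> S (f x).
Hypothesis fe : forall x y, S x -> S y -> (e (f x) (f y) <-> e x y).

Lemma reps_perm : exists g : T -> T,
  [/\ forall r, r \in R -> g r \in R, forall r, r \in R -> e (f r) (g r),
      {in R &, injective g} & perm_eq (map g R) R].
Proof.
have [g hg] : exists g : T -> T, forall x, x \in R -> g x \in R /\ e (f x) (g x).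
  suff /(@boolp.choice _ _ _) [g hg] : forall x, exists y,
    x \in R -> y \in R /\ e (f x) y by exists g.
  move=> x; have [xR|nx] := boolP (x \in R); last by exists x.
  by have [y yR ey] := reps_cover hR (fS (reps_in hR xR)); exists y.
have g_inj : {in R &, injective g}.
  move=> x y xR yR eg; apply: (reps_inj hR) => //.
  have [Sx Sy] := (reps_in hR xR, reps_in hR yR).
  have [gx ex] := hg _ xR; have [gy ey] := hg _ yR.
  apply/(fe Sx Sy); apply: (e_trans _ (reps_in hR gx)) => //; try exact: fS.
  by rewrite eg; apply: e_sym => //; [apply: fS | apply: (reps_in hR)].
exists g; split=> //; try by move=> r /hg [].
have u : uniq (map g R) by rewrite map_inj_in_uniq ?(reps_uniq hR).
apply: uniq_perm; rewrite ?(reps_uniq hR) //.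
have sub : {subset map g R <= R} by move=> _ /mapP [x /hg [h _] ->].
by have [] := uniq_min_size u sub; rewrite ?size_map.
Qed.

Lemma reps_reindex (V : nmodType) (F : T -> V) :
  (forall r y, S r -> S y -> e r y -> F r = F y) ->
  \sum_(r <- R) F (f r) = \sum_(r <- R) F r.
Proof.
move=> hF; have [g [h1 h2 h3 h4]] := reps_perm.
rewrite -[RHS](perm_big _ h4) big_map big_seq [RHS]big_seq.
apply: eq_bigr => r rR; apply: hF (h2 _ rR); last exact: (reps_in hR (h1 _ rR)).
exact: (fS (reps_in hR rR)).
Qed.

(** The permutation of [R] induced by [f] generates a cyclic p-group without fixed points, so the
    number of points is 0 modulo p. *)
Lemma reps_size_dvd p : prime p -> (forall x, S x -> ~ e (f x) x) ->
  (forall x, S x -> e (iter p f x) x) -> (p %| size R)%N.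
Proof.
move=> pp nofix hp; have [g [h1 h2 h3 h4]] := reps_perm.
pose h (x : seq_sub R) : seq_sub R := SeqSub (h1 _ (ssvalP x)).
have hval x : val (h x) = g (val x) by [].
have h_inj : injective h.
  move=> x y /(congr1 val); rewrite !hval => /h3 e0.
  by apply: val_inj; apply: e0; apply: ssvalP.
pose s := perm h_inj.
have ss k x : val ((s ^+ k)%g x) = iter k g (val x).
  elim: k => [|k IH] /=; first by rewrite expg0 perm1.
  by rewrite expgSr permM permE hval IH.
have iterS k x : S x -> S (iter k f x) by move=> Sx; elim: k => //= k; apply: fS.
have iterR k x : x \in R -> iter k g x \in R by move=> xR; elim: k => //= k; apply: h1.
have iter_e k x : x \in R -> e (iter k f x) (iter k g x).
  move=> xR; have Sx := reps_in hR xR; elim: k => [|k IH] /=; first exact: e_refl.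
  have Sk := iterS k _ Sx; have gk := iterR k _ xR; have Sgk := reps_in hR gk.
  apply: (e_trans (y := f (iter k g x))); try exact: fS.
  - exact: (reps_in hR (h1 _ gk)).
  - exact/fe.
  - exact: h2.
have sp : (s ^+ p = 1)%g.
  apply/permP => x; rewrite perm1; apply: val_inj; rewrite ss.
  have xR := ssvalP x; have Sx := reps_in hR xR.
  apply: (reps_inj hR) => //; first exact: iterR.
  have Sg := reps_in hR (iterR p _ xR).
  apply: (e_trans (y := iter p f (val x))) => //; [exact: iterS| |exact: hp].
  by apply: e_sym => //; [apply: iterS | apply: iter_e].
have pg : (p.-group <[s]>)%g.
  by apply: (@pnat_dvd _ p); rewrite ?pnat_id // -orderE order_dvdn sp.
have := pgroup_fix_mod (to := 'P) (S := [set: seq_sub R]) pg.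
have -> : ([acts <[s]>, on [set: seq_sub R] | 'P])%g.
  by apply/actsP => a _ x; rewrite !inE.
move=> /(_ isT); rewrite cardsT card_seq_sub ?(reps_uniq hR) //.
have -> : ('Fix_([set: seq_sub R] | 'P)(<[s]>) = set0)%g.
  apply/setP => x; rewrite in_setI !in_setT in_set0; apply/negP => /afixP fx.
  have /(congr1 val) := fx s (cycle_id s); rewrite /= apermE permE hval => gx.
  have xR := ssvalP x; have Sx := reps_in hR xR.
  by apply: (nofix _ Sx); move: (h2 _ xR); rewrite gx.
by rewrite cards0 => hm; apply/eqP; rewrite hm mod0n.
Qed.

End Representatives.

(** * Freeness from a filtration that an injective operator shifts by one *)

Section GradedFree.
Variables (C : fieldType) (V : lmodType C) (A : V -> Prop) (T : V -> V).
Variable B : nat -> V -> Prop.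
Hypothesis hA : subsp A.
Hypothesis hB : forall n, subsp (B n).
Hypothesis B0 : forall x, B 0%N x -> x = 0.
Hypothesis BS : forall n x, B n x -> B n.+1 x.
Hypothesis BA : forall n x, B n x -> A x.
Hypothesis AB : forall x, A x -> exists n, B n x.
Hypothesis Bfin : forall n, exists l : seq V,
  (forall z, z \in l -> B n z) /\ forall x, B n x -> spanP (fun z => z \in l) x.
Hypothesis Tlin : forall a x y, A x -> A y -> T (a *: x + y) = a *: T x + T y.
Hypothesis TB : forall n x, B n x -> B n.+1 (T x).
Hypothesis Tinj : forall n x, A x -> B n.+1 (T x) -> B n x.
Hypothesis Tnsurj : forall n, (0 < n)%N -> exists2 x, B n.+1 x &
  forall y z, B n y -> B n z -> x <> y + T z.

Local Lemma AT x : A x -> A (T x).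
Proof. by move=> /AB [n /TB]; apply: BA. Qed.

Local Lemma Ble m n x : (m <= n)%N -> B m x -> B n x.
Proof. by move=> /subnK <- hx; elim: (n - m)%N => //= k; apply: BS. Qed.

Let S n := addsp (B n) (fun y => exists2 z, B n z & y = T z).

Local Lemma S_subsp n : subsp (S n).
Proof.
apply: addsp_subsp => //; split.
  by exists 0; [case: (hB n) | rewrite (T0 hA Tlin)].
move=> a _ _ [x hx ->] [y hy ->]; exists (a *: x + y); first exact: (proj2 (hB n)).
by rewrite Tlin //; apply: BA; [apply: hx | apply: hy].
Qed.

Lemma graded_basis_exists : exists s : nat -> seq V, forall n,
  [/\ forall z, z \in s n -> B n.+1 z,
      forall x, B n.+1 x -> spanm (S n) (s n) x,
      forall a : nat -> C, S n (\sum_(i < size (s n)) a i *: (s n)`_i) ->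
        forall i, (i < size (s n))%N -> a i = 0
    & (0 < n)%N -> s n <> [::]].
Proof.
suff /(@boolp.choice _ _ _) [s hs] : forall n, exists s : seq V,
   [/\ forall z, z \in s -> B n.+1 z, forall x, B n.+1 x -> spanm (S n) s x,
      forall a : nat -> C, S n (\sum_(i < size s) a i *: s`_i) ->
        forall i, (i < size s)%N -> a i = 0 & (0 < n)%N -> s <> [::]] by exists s.
move=> n; have [l [hl1 hl2]] := Bfin n.+1.
have [s [h1 h2 h3]] := basis_mod l (S_subsp n).
have h4 x : B n.+1 x -> spanm (S n) s x.
  by move=> /hl2 hx; apply: h2; apply: spanP_sub hx => z hz; apply: spanm_mem.
exists s; split=> //; first by move=> z /h1; apply: hl1.
move=> n0 s0; have [x hx nx] := Tnsurj n0.
have := h4 x hx; rewrite s0 => /(spanm_nil (S_subsp n)) [y] [_] [hy [z hz ->] e].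
exact: nx hy hz e.
Qed.

Variable s : nat -> seq V.
Hypothesis sB : forall n z, z \in s n -> B n.+1 z.
Hypothesis s_span : forall n x, B n.+1 x -> spanm (S n) (s n) x.
Hypothesis s_free : forall n (a : nat -> C),
  S n (\sum_(i < size (s n)) a i *: (s n)`_i) ->
  forall i, (i < size (s n))%N -> a i = 0.

Definition gidx := {n : nat & 'I_(size (s n))}.
Definition gpos (i : gidx) : nat := (tagged i : 'I_(size (s (tag i)))).
Definition gbasis (i : gidx) : V := (s (tag i))`_(gpos i).

Lemma gbasisB i : B (tag i).+1 (gbasis i).
Proof. by apply: sB; apply: mem_nth; apply: ltn_ord. Qed.

Let bA i : A (gbasis i) := BA (gbasisB i).

Definition glevel n : seq gidx :=
  [seq Tagged (fun n => 'I_(size (s n))) i | i <- enum 'I_(size (s n))].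

Fixpoint gbelow n : seq gidx := if n is m.+1 then glevel m ++ gbelow m else [::].

Lemma glevel_tag n i : i \in glevel n -> tag i = n.
Proof. by move=> /mapP [j _ ->]. Qed.

Lemma gbelow_tag n i : i \in gbelow n -> (tag i < n)%N.
Proof.
elim: n => // n IH; rewrite mem_cat => /orP [/glevel_tag -> //|/IH h].
exact: ltnW.
Qed.

(** Induction on the filtration: modulo the new generators, an element of [B n.+1] is [y + T z] with
    [y] and [z] in [B n], and [T] multiplies the coefficients of [z] by the variable. *)
Lemma gbasis_span n x : B n x ->
  exists q : gidx -> {poly C}, x = \sum_(i <- gbelow n) pact T (q i) (gbasis i).
Proof.
elim: n x => [|n IH] x hx; first by exists (fun=> 0); rewrite big_nil; apply: B0.
have [a [y [_ [hy [z hz ->] e]]]] := spanm_sumE (S_subsp n) (s_span hx).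
have [q hq] := IH y hy; have [r hr] := IH z hz.
exists (fun i => if tag i == n then (a (gpos i))%:P else q i + r i * 'X).
rewrite big_cat /= big_map big_enum /=.
under eq_bigr do rewrite eqxx pactC.
rewrite -[x](subrK (\sum_(i < size (s n)) a i *: (s n)`_i)) e addrC; congr (_ + _).
rewrite hq hr (T_sum hA Tlin); last by move=> i; apply: (pactA hA AT).
rewrite -big_split /= !big_seq; apply: eq_bigr => i /gbelow_tag.
by case: eqP => [-> |_ _]; rewrite ?ltnn // pactD pactMX (pactTC hA AT Tlin).
Qed.

Lemma glevel_uniq n : uniq (glevel n).
Proof.
rewrite map_inj_uniq ?enum_uniq // => i j.
exact: eq_from_Tagged.
Qed.

Lemma mem_glevel i : i \in glevel (tag i).
Proof. by case: i => n i; apply/map_f/mem_enum. Qed.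

(* The terms of top level among the constant coefficients vanish modulo [B n + T B n]. *)
Lemma gbasis_constant_free (l : seq gidx) (a : gidx -> C) g :
  uniq l -> A g -> \sum_(i <- l) a i *: gbasis i + T g = 0 ->
  forall i, i \in l -> a i = 0.
Proof.
move=> ul Ag e.
(* Descending induction on the level from which on the coefficients are known to vanish; it starts
   above all tags of [l]. *)
suff h m : (forall i, i \in l -> (m <= tag i)%N -> a i = 0) ->
    forall i, i \in l -> a i = 0.
  apply: (h (\max_(i <- l) (tag i).+1)%N) => i il /(leq_trans _).
  by move=> /(_ _ (@leq_bigmax_seq _ l xpredT (fun i => (tag i).+1) i il isT)); rewrite ltnn.
elim: m => [|m IH] hm; first by move=> i il; apply: hm.
apply: IH => i0 i0l; rewrite leq_eqVlt => /orP [/eqP e0|]; last exact: hm.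
have hBm : B m.+1 (\sum_(i <- l) a i *: gbasis i).
  apply: subsp_sum_in => // i il.
  have [h|h] := leqP (tag i) m; last by rewrite (hm i il h) scale0r; case: (hB m.+1).
  by apply: subspZ => //; apply: Ble (gbasisB i).
have Bg : B m g.
  apply: Tinj => //; rewrite -[T g](addKr (\sum_(i <- l) a i *: gbasis i)) e addr0.
  exact: subspN.
(* The coefficients of level [m] as a function on [nat], the format of [s_free]; basis vectors
   absent from [l] receive 0. *)
pose a' j := if insub j is Some k then
  let i := Tagged (fun n => 'I_(size (s n))) (k : 'I_(size (s m))) in
  if i \in l then a i else 0 else 0.
have hS : S m (\sum_(j < size (s m)) a' j *: (s m)`_j).
  have -> : \sum_(j < size (s m)) a' j *: (s m)`_j =
      \sum_(i <- l | tag i == m) a i *: gbasis i.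
    transitivity (\sum_(i <- glevel m | i \in l) a i *: gbasis i).
      rewrite big_map big_enum_cond /= [RHS]big_mkcond; apply: eq_bigr => j _.
      by rewrite /a' valK; case: ifP => // _; rewrite scale0r.
    rewrite -[LHS]big_filter -[RHS]big_filter; apply: perm_big.
    apply: uniq_perm; rewrite ?filter_uniq ?glevel_uniq // => i.
    rewrite !mem_filter andbC; case il: (i \in l); rewrite ?andbF // !andbT.
    by apply/idP/eqP => [/glevel_tag|<-] //; apply: mem_glevel.
  exists (- \sum_(i <- l | tag i != m) a i *: gbasis i), (T (- g)).
  split; last 1 first.
  - rewrite -[- g]scaleN1r (TZ hA Tlin) // scaleN1r.
    have <- : \sum_(i <- l) a i *: gbasis i = - T g by apply/eqP; rewrite -addr_eq0 e.
    by rewrite [\sum_(i <- l) _](bigID (fun i => tag i == m)) /= addrCA addNr addr0.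
  - apply: subspN => //; rewrite big_seq_cond; apply: subsp_sum => // i /andP [il ne].
    have [h|h] := ltnP (tag i) m; first by apply: subspZ => //; apply: Ble (gbasisB i).
    by rewrite hm ?scale0r //; [case: (hB m) | rewrite ltn_neqAle eq_sym ne].
  - by exists (- g) => //; apply: subspN.
case: i0 e0 i0l => /= n k e0; rewrite -e0 in k *  => kl.
have := s_free hS (ltn_ord k); by rewrite /a' valK /= kl.
Qed.

(** Induction on a bound for the degrees. Once the constant coefficients vanish, the relation is [T]
    applied to the relation with every polynomial divided by the variable, and [T] is injective by
    [Tinj] at level 0, where [B 0] is zero. *)
Lemma gbasis_free (l : seq gidx) (q : gidx -> {poly C}) :
  uniq l -> \sum_(i <- l) pact T (q i) (gbasis i) = 0 ->
  forall i, i \in l -> q i = 0.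
Proof.
move=> ul.
suff h N : (forall i, i \in l -> (size (q i) <= N)%N) ->
    \sum_(i <- l) pact T (q i) (gbasis i) = 0 -> forall i, i \in l -> q i = 0.
  by apply: (h (\max_(i <- l) size (q i))%N) => i il; apply: leq_bigmax_seq.
elim: N q => [|N IH] q hN e.
  by move=> i /hN; rewrite leqn0 size_poly_eq0 => /eqP.
pose r i := drop_poly 1 (q i).
have qE i : q i = ((q i)`_0)%:P + r i * 'X.
  rewrite -[LHS](poly_take_drop 1) expr1; congr (_ + _); apply/polyP => j.
  by rewrite coef_take_poly coefC; case: j.
pose g := \sum_(i <- l) pact T (r i) (gbasis i).
have Ag : A g by apply: subsp_sum => // i _; apply: (pactA hA AT).
have e' : \sum_(i <- l) (q i)`_0 *: gbasis i + T g = 0.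
  rewrite (T_sum hA Tlin); last by move=> i; apply: (pactA hA AT).
  rewrite -big_split /= -[RHS]e; apply: eq_bigr => i _.
  by rewrite [in RHS]qE pactD pactC pactMX (pactTC hA AT Tlin).
have q0 := gbasis_constant_free ul Ag e'.
have Tg : T g = 0.
  by rewrite -[RHS]e' big_seq big1 ?add0r // => i il; rewrite q0 ?scale0r.
have g0 : g = 0 by apply: B0; apply: Tinj => //; rewrite Tg; case: (hB 1).
have r0 := IH r _ g0.
move=> i il; rewrite qE q0 // r0 ?mul0r ?addr0 // => j jl.
by rewrite size_drop_poly leq_subLR add1n; apply: hN.
Qed.

End GradedFree.

Theorem graded_free (C : fieldType) (V : lmodType C) (A : V -> Prop) (T : V -> V)
    (B : nat -> V -> Prop) :
  subsp A -> (forall n, subsp (B n)) ->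
  (forall x, B 0%N x -> x = 0) -> (forall n x, B n x -> B n.+1 x) ->
  (forall n x, B n x -> A x) -> (forall x, A x -> exists n, B n x) ->
  (forall n, exists l : seq V,
    (forall z, z \in l -> B n z) /\ forall x, B n x -> spanP (fun z => z \in l) x) ->
  (forall a x y, A x -> A y -> T (a *: x + y) = a *: T x + T y) ->
  (forall n x, B n x -> B n.+1 (T x)) ->
  (forall n x, A x -> B n.+1 (T x) -> B n x) ->
  (forall n, (0 < n)%N -> exists2 x, B n.+1 x &
    forall y z, B n y -> B n z -> x <> y + T z) ->
  exists (I : eqType) (b : I -> V),
  [/\ ~ (exists s : seq I, forall i, i \in s), forall i, A (b i),
      forall x, A x -> exists (l : seq I) (q : I -> {poly C}),
        x = \sum_(i <- l) pact T (q i) (b i)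
    & forall (l : seq I) (q : I -> {poly C}), uniq l ->
        \sum_(i <- l) pact T (q i) (b i) = 0 -> forall i, i \in l -> q i = 0].
Proof.
move=> hA hB B0 BS BA AB Bfin Tlin TB Tinj Tnsurj.
have [s hs] := graded_basis_exists hA hB BA Bfin Tlin Tnsurj.
have h1 n : forall z, z \in s n -> B n.+1 z by case: (hs n).
have h2 n x : B n.+1 x -> _ := let: And4 _ h _ _ := hs n in h x.
have h3 n a : _ -> _ := let: And4 _ _ h _ := hs n in h a.
exists (gidx s), (@gbasis _ _ s); split.
- case=> l hl.
  (* The outer successor keeps [n] positive even for empty [l], so that [s n] is nonempty; no
     element of [l] has tag [n]. *)
  pose n := (\max_(i <- l) (tag i).+1)%N.+1.
  have : (0 < size (s n))%N by rewrite lt0n size_eq0; case: (hs n) => _ _ _ /(_ isT) /eqP.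
  move=> hn; pose i : gidx s := Tagged (fun n => 'I_(size (s n))) (Ordinal hn).
  have := @leq_bigmax_seq _ l xpredT (fun i : gidx s => (tag i).+1) i (hl i) isT.
  by rewrite /= -/n /n ltnNge leqnSn.
- by move=> i; apply: BA; apply: (gbasisB h1).
- move=> x /AB [n hx].
  by have [q hq] := gbasis_span hA hB B0 BA AB Tlin TB h1 h2 hx; exists (gbelow s n), q.
- by move=> l q; apply: (gbasis_free hA hB B0 BS BA AB Tlin TB Tinj h1 h3).
Qed.

(** * Unitary matrices and parahoric subgroups *)

Definition o0 : 'I_3 := @Ordinal 3 0 isT.
Definition o1 : 'I_3 := @Ordinal 3 1 isT.
Definition o2 : 'I_3 := @Ordinal 3 2 isT.

Lemma ord3P (P : 'I_3 -> Prop) : P o0 -> P o1 -> P o2 -> forall i, P i.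
Proof.
move=> h0 h1 h2 [[|[|[|//]]] hi].
- by rewrite (_ : Ordinal hi = o0) //; apply: val_inj.
- by rewrite (_ : Ordinal hi = o1) //; apply: val_inj.
- by rewrite (_ : Ordinal hi = o2) //; apply: val_inj.
Qed.

Lemma sum3 (V : nmodType) (F : 'I_3 -> V) : \sum_k F k = F o0 + F o1 + F o2.
Proof.
rewrite !big_ord_recl big_ord0 addr0 addrA.
by congr (_ + _ + _); congr F; apply: val_inj.
Qed.

Lemma mul3 (R : pzRingType) (A B : 'M[R]_3) i j :
  (A *m B) i j = A i o0 * B o0 j + A i o1 * B o1 j + A i o2 * B o2 j.
Proof. by rewrite mxE sum3. Qed.

Lemma rev0 : rev_ord o0 = o2. Proof. exact: val_inj. Qed.
Lemma rev1 : rev_ord o1 = o1. Proof. exact: val_inj. Qed.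
Lemma rev2 : rev_ord o2 = o0. Proof. exact: val_inj. Qed.
Definition revE := (rev0, rev1, rev2).

Definition mx3 (R : Type) (x0 : R) (rows : seq (seq R)) : 'M[R]_3 :=
  \matrix_(i, j) nth x0 (nth [::] rows i) j.

Section LocalField.
Variables (E : fieldType) (conj : E -> E) (v : E -> int) (p : nat).
Hypothesis HE : unram_quad_local conj v p.

Lemma conjM x y : conj (x * y) = conj x * conj y.
Proof. by case: (conj_rmorph HE x y). Qed.
Lemma conjD x y : conj (x + y) = conj x + conj y.
Proof. by case: (conj_rmorph HE x y). Qed.
Lemma conj0 : conj 0 = 0.
Proof. by apply: (addIr (conj 0)); rewrite -conjD !add0r. Qed.
Lemma conjN x : conj (- x) = - conj x.
Proof. by apply: (addIr (conj x)); rewrite -conjD !addNr conj0. Qed.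
Lemma conjB x y : conj (x - y) = conj x - conj y.
Proof. by rewrite conjD conjN. Qed.
Lemma conj_eq0 x : (conj x == 0) = (x == 0).
Proof.
apply/eqP/eqP => [h|->]; last exact: conj0.
by rewrite -(conj_invol HE x) h conj0.
Qed.
Lemma conjV x : conj x^-1 = (conj x)^-1.
Proof.
have [->|x0] := eqVneq x 0; first by rewrite invr0 conj0 invr0.
have cx0 : conj x != 0 by rewrite conj_eq0.
by apply: (mulIf cx0); rewrite -conjM !mulVf // (conj1 HE).
Qed.

Lemma val1 : v 1 = 0.
Proof.
have := v_mul HE (oner_neq0 E) (oner_neq0 E); rewrite mulr1.
by move: (v 1) => a; lia.
Qed.
Lemma valN x : v (- x) = v x.
Proof.
have [->|x0] := eqVneq x 0; first by rewrite oppr0.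
have n0 : (-1 : E) != 0 by rewrite oppr_eq0 oner_eq0.
have := v_mul HE n0 n0; rewrite mulrNN mulr1 val1 -[- x]mulN1r (v_mul HE n0 x0).
by move: (v (- 1)) (v x) => a b; lia.
Qed.
Lemma valV x : x != 0 -> v x^-1 = - v x.
Proof.
move=> x0; have := v_mul HE x0 (invr_neq0 x0); rewrite mulfV // val1.
by move: (v x) (v x^-1) => a b; lia.
Qed.

Definition ge4 (m : int) (x : E) := (x == 0) || (m <= 4 * v x).

Lemma ge4_0 m : ge4 m 0. Proof. by rewrite /ge4 eqxx. Qed.
Lemma ge4_imp m m' x : ge4 m x -> (m <= 4 * v x -> m' <= 4 * v x) -> ge4 m' x.
Proof. by rewrite /ge4; case: eqP => //= _ h; apply. Qed.
Lemma ge4_le m m' x : m' <= m -> ge4 m x -> ge4 m' x.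
Proof. by move=> h /ge4_imp; apply; lia. Qed.
Lemma ge4D m x y : ge4 m x -> ge4 m y -> ge4 m (x + y).
Proof.
rewrite /ge4; have [->|x0] := eqVneq x 0; first by rewrite add0r.
have [->|y0] := eqVneq y 0; first by rewrite addr0 (negPf x0).
have [//|xy0] /= := eqVneq (x + y) 0.
have := v_add HE x0 y0 xy0; rewrite ge_min.
by move: (v x) (v y) (v (x + y)) => a b d /orP []; lia.
Qed.
Lemma ge4N m x : ge4 m (- x) = ge4 m x.
Proof. by rewrite /ge4 oppr_eq0 valN. Qed.
Lemma ge4B m x y : ge4 m x -> ge4 m y -> ge4 m (x - y).
Proof. by move=> hx hy; apply: ge4D; rewrite ?ge4N. Qed.
Lemma ge4M m m' x y : ge4 m x -> ge4 m' y -> ge4 (m + m') (x * y).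
Proof.
rewrite /ge4 mulf_eq0; have [//|x0] := eqVneq x 0; have [//|y0] /= := eqVneq y 0.
rewrite (v_mul HE) //; move: (v x) (v y) => a b; lia.
Qed.
Lemma ge4J m x : ge4 m (conj x) = ge4 m x.
Proof. by rewrite /ge4 conj_eq0; case: eqVneq => //= h; rewrite (v_conj HE). Qed.
Lemma ge4_1 m : m <= 0 -> ge4 m 1.
Proof. by move=> h; rewrite /ge4 val1 mulr0 h orbT. Qed.
Lemma ge4_norm m x : ge4 (m + m) (x * conj x) -> ge4 m x.
Proof.
rewrite /ge4 mulf_eq0 conj_eq0 orbb; case: eqVneq => //= x0.
rewrite (v_mul HE) ?conj_eq0 // (v_conj HE) //; move: (v x) => a; lia.
Qed.
Lemma ge4_eq m x : x != 0 -> ge4 m x = (m <= 4 * v x).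
Proof. by rewrite /ge4 => /negPf ->. Qed.
Lemma inP_ge4 n x : inP v n x = ge4 (4 * n) x.
Proof. by rewrite /inP /ge4; congr orb; apply/idP/idP; lia. Qed.

Definition dg (i j : 'I_3) : int := (j : nat)%:Z - (i : nat)%:Z.
(* Points of the standard apartment are real numbers, scaled so that the vertices of the two
   types are the integers 0 and 2 modulo 4; the parahoric subgroup of the point s consists of
   the unitary matrices in [Fl 0 s], and [Pn m s] is its congruence filtration. Scaling by 4
   keeps all bounds integral, also for interior points of the alcoves. *)
Definition Fl (m s : int) (X : 'M[E]_3) := forall i j, ge4 (m - s * dg i j) (X i j).

Lemma Fl_le m m' s X : m' <= m -> Fl m s X -> Fl m' s X.
Proof. by move=> h hX i j; apply: ge4_le (hX i j); lia. Qed.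
Lemma FlD m s X Y : Fl m s X -> Fl m s Y -> Fl m s (X + Y).
Proof. by move=> hX hY i j; rewrite mxE; apply: ge4D. Qed.
Lemma FlN m s X : Fl m s X -> Fl m s (- X).
Proof. by move=> hX i j; rewrite mxE ge4N. Qed.
Lemma FlB m s X Y : Fl m s X -> Fl m s Y -> Fl m s (X - Y).
Proof. by move=> hX hY; apply: FlD => //; apply: FlN. Qed.
Lemma Fl0 m s : Fl m s 0.
Proof. by move=> i j; rewrite mxE ge4_0. Qed.
Lemma FlM m m' s X Y : Fl m s X -> Fl m' s Y -> Fl (m + m') s (X *m Y).
Proof.
move=> hX hY i j; rewrite mul3.
have h k : ge4 (m + m' - s * dg i j) (X i k * Y k j).
  by apply: ge4_le (ge4M (hX i k) (hY k j)); rewrite /dg; lia.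
by do 2?apply: ge4D; apply: h.
Qed.
Lemma FlM0 m s X Y : Fl m s X -> Fl 0 s Y -> Fl m s (X *m Y).
Proof. by move=> hX hY; have := FlM hX hY; rewrite addr0. Qed.
Lemma Fl0M m s X Y : Fl 0 s X -> Fl m s Y -> Fl m s (X *m Y).
Proof. by move=> hX hY; have := FlM hX hY; rewrite add0r. Qed.
Lemma Fl1 s : Fl 0 s 1%:M.
Proof.
move=> i j; rewrite mxE; case: eqP => [->|_]; last exact: ge4_0.
by apply: ge4_1; rewrite /dg; lia.
Qed.

(** The adjoint for the Hermitian form, which is the inverse on [G]. Being defined on all matrices
    by permuting and conjugating entries, it respects the filtrations [Fl] without any
    determinant. *)
Definition ginv (g : 'M[E]_3) : 'M[E]_3 :=
  \matrix_(i, j) conj (g (rev_ord j) (rev_ord i)).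

Lemma ginvE g i j : ginv g i j = conj (g (rev_ord j) (rev_ord i)).
Proof. by rewrite mxE. Qed.

Lemma betaE i j : beta E i j = (i == rev_ord j)%:R.
Proof. by rewrite mxE; congr (_%:R); move: i j; do 2?apply: ord3P; rewrite ?revE. Qed.

Lemma mul_betaE (X : 'M[E]_3) i j : (beta E *m X) i j = X (rev_ord i) j.
Proof.
rewrite mul3 !betaE; move: i; apply: ord3P;
  by rewrite !revE /= !(mul0r, mul1r, add0r, addr0).
Qed.

Lemma ginv_mx g : ginv g = beta E *m (map_mx conj g)^T *m beta E.
Proof.
apply/matrixP => i j; rewrite mul3 !mul_betaE !betaE !mxE.
by move: j; apply: ord3P; rewrite !revE /= !(mulr0, mulr1, add0r, addr0).
Qed.

Lemma beta2 : beta E *m beta E = 1%:M.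
Proof.
apply/matrixP => i j; rewrite mul_betaE betaE mxE.
by rewrite (inj_eq rev_ord_inj).
Qed.

Lemma map_conjM (X Y : 'M[E]_3) : map_mx conj (X *m Y) = map_mx conj X *m map_mx conj Y.
Proof. by apply/matrixP => i j; rewrite mxE !mul3 !mxE !conjD !conjM. Qed.

Lemma ginvM g h : ginv (g *m h) = ginv h *m ginv g.
Proof.
rewrite !ginv_mx map_conjM trmx_mul.
by rewrite !mulmxA -[in RHS](mulmxA _ (beta E) (beta E)) beta2 mulmx1.
Qed.

Lemma ginvK g : ginv (ginv g) = g.
Proof. by apply/matrixP => i j; rewrite !ginvE !rev_ordK (conj_invol HE). Qed.

Lemma ginv1 : ginv 1%:M = 1%:M.
Proof.
apply/matrixP => i j; rewrite ginvE !mxE (inj_eq rev_ord_inj) eq_sym.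
by case: eqP => _; rewrite ?(conj1 HE) ?conj0.
Qed.

Lemma inGP (g : 'M[E]_3) : inG conj g <-> ginv g *m g = 1%:M.
Proof.
have bT : (beta E)^T = beta E.
  by apply/matrixP => i j; rewrite !mxE addnC.
have bc : map_mx conj (beta E) = beta E.
  apply/matrixP => i j; rewrite !mxE.
  by case: eqP => _; rewrite ?(conj1 HE) ?conj0.
have cc (X : 'M[E]_3) : map_mx conj (map_mx conj X) = X.
  by apply/matrixP => i j; rewrite !mxE (conj_invol HE).
have ct (X : 'M[E]_3) : map_mx conj X^T = (map_mx conj X)^T.
  by apply/matrixP => i j; rewrite !mxE.
rewrite ginv_mx /inG; split=> [/eqP h|h].
  have := congr1 (fun X => beta E *m map_mx conj X) h.
  by rewrite !map_conjM cc ct bc beta2 !mulmxA.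
apply/eqP; have := congr1 (fun X => map_mx conj (beta E *m X)) h.
by rewrite !mulmxA beta2 mul1mx mulmx1 !map_conjM ct cc bc.
Qed.

Lemma ginvV g : inG conj g -> g *m ginv g = 1%:M.
Proof. by move=> /inGP /mulmx1C. Qed.
Lemma ginvVl g : inG conj g -> ginv g *m g = 1%:M.
Proof. by move=> /inGP. Qed.
Lemma inG1 : inG conj 1%:M.
Proof. by apply/inGP; rewrite ginv1 mulmx1. Qed.
Lemma inGV g : inG conj g -> inG conj (ginv g).
Proof. by move=> h; apply/inGP; rewrite ginvK ginvV. Qed.
Lemma inGM g h : inG conj g -> inG conj h -> inG conj (g *m h).
Proof.
move=> hg hh; apply/inGP; rewrite ginvM mulmxA -(mulmxA (ginv h)) ginvVl // mulmx1.
exact: ginvVl.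
Qed.
Lemma inG_tr g : inG conj g -> inG conj g^T.
Proof.
move=> /ginvV h; apply/inGP.
have -> : ginv g^T = (ginv g)^T by apply/matrixP => i j; rewrite !mxE.
by rewrite -trmx_mul h trmx1.
Qed.
Lemma mulgK (g h : 'M[E]_3) : inG conj g -> h *m g *m ginv g = h.
Proof. by move=> hg; rewrite -mulmxA ginvV // mulmx1. Qed.
Lemma mulgVK (g h : 'M[E]_3) : inG conj g -> h *m ginv g *m g = h.
Proof. by move=> hg; rewrite -mulmxA ginvVl // mulmx1. Qed.
Lemma mulKg (g h : 'M[E]_3) : inG conj g -> ginv g *m (g *m h) = h.
Proof. by move=> hg; rewrite mulmxA ginvVl // mul1mx. Qed.
Lemma mulVKg (g h : 'M[E]_3) : inG conj g -> g *m (ginv g *m h) = h.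
Proof. by move=> hg; rewrite mulmxA ginvV // mul1mx. Qed.
Lemma inG_mulr (g h : 'M[E]_3) : inG conj h -> inG conj (g *m h) = inG conj g.
Proof.
move=> hh; apply/idP/idP => hg; last exact: inGM.
by rewrite -(mulgK g hh); apply: inGM => //; apply: inGV.
Qed.
Lemma inG_mull (g h : 'M[E]_3) : inG conj g -> inG conj (g *m h) = inG conj h.
Proof.
move=> hg; apply/idP/idP => hh; last exact: inGM.
by rewrite -(mulKg h hg); apply: inGM => //; apply: inGV.
Qed.

Lemma col_rel g i j : inG conj g ->
  conj (g o2 i) * g o0 j + conj (g o1 i) * g o1 j + conj (g o0 i) * g o2 j
  = (rev_ord i == j)%:R.
Proof.
move=> /ginvVl /matrixP /(_ (rev_ord i) j); rewrite mul3 !ginvE !revE rev_ordK => ->.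
by rewrite mxE.
Qed.
Lemma row_rel g i j : inG conj g ->
  g i o0 * conj (g j o2) + g i o1 * conj (g j o1) + g i o2 * conj (g j o0)
  = (i == rev_ord j)%:R.
Proof.
move=> /ginvV /matrixP /(_ i (rev_ord j)); rewrite mul3 !ginvE !revE rev_ordK => ->.
by rewrite mxE.
Qed.

Lemma Fl_ginv m s X : Fl m s X -> Fl m s (ginv X).
Proof.
move=> h i j; rewrite ginvE ge4J; apply: ge4_le (h _ _).
suff -> : dg (rev_ord j) (rev_ord i) = dg i j by [].
by rewrite /dg /=; move: (ltn_ord i) (ltn_ord j); lia.
Qed.

(** * Congruence filtrations: commutators and p-th powers *)

Definition Pn (m s : int) (g : 'M[E]_3) := inG conj g /\ Fl m s (g - 1%:M).

Section Parahoric.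
Variables (s : int).
Implicit Types (m : int) (g h : 'M[E]_3).

Lemma Pn_inG m g : Pn m s g -> inG conj g. Proof. by case. Qed.

Lemma Pn0 g : Pn 0 s g <-> inG conj g /\ Fl 0 s g.
Proof.
split=> -[h1 h2]; split=> //; last by apply: FlB => //; apply: Fl1.
by rewrite -[g](subrK 1%:M); apply: FlD => //; apply: Fl1.
Qed.

Lemma Pn_le m m' g : m' <= m -> Pn m s g -> Pn m' s g.
Proof. by move=> h [h1 h2]; split=> //; apply: Fl_le h2. Qed.

Lemma Pn_Fl m g : 0 <= m -> Pn m s g -> Fl 0 s g.
Proof. by move=> h /(Pn_le h) /Pn0 []. Qed.

Lemma Pn1 m : Pn m s 1%:M.
Proof. by split; [apply: inG1 | rewrite subrr; apply: Fl0]. Qed.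

Lemma PnM m g h : 0 <= m -> Pn m s g -> Pn m s h -> Pn m s (g *m h).
Proof.
move=> m0 hg hh; split; first by apply: inGM; [case: hg | case: hh].
have -> : g *m h - 1%:M = (g - 1%:M) *m h + (h - 1%:M).
  by rewrite mulmxBl mul1mx addrA subrK.
by apply: FlD; [apply: FlM0; [case: hg | apply: (Pn_Fl m0)] | case: hh].
Qed.

Lemma PnV m g : 0 <= m -> Pn m s g -> Pn m s (ginv g).
Proof.
move=> m0 hg; split; first by apply: inGV; case: hg.
have -> : ginv g - 1%:M = - (ginv g *m (g - 1%:M)).
  by rewrite mulmxBr mulmx1 ginvVl ?opprB //; case: hg.
apply: FlN; apply: Fl0M; last by case: hg.
by apply: Fl_ginv; apply: (Pn_Fl m0).
Qed.

Lemma PnJ m g h : 0 <= m -> Pn 0 s g -> Pn m s h -> Pn m s (g *m h *m ginv g).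
Proof.
move=> m0 hg hh; split.
  have [[Gg _] [Gh _]] := (hg, hh).
  by apply: inGM; [apply: inGM | apply: inGV].
have -> : g *m h *m ginv g - 1%:M = g *m (h - 1%:M) *m ginv g.
  by rewrite mulmxBr mulmx1 mulmxBl ginvV //; case: hg.
apply: FlM0; last by apply: Fl_ginv; apply: (Pn_Fl _ hg).
by apply: Fl0M; [apply: (Pn_Fl _ hg) | case: hh].
Qed.

Lemma PnJV m g h : 0 <= m -> Pn 0 s g -> Pn m s h -> Pn m s (ginv g *m h *m g).
Proof. by move=> m0 hg hh; rewrite -{2}[g]ginvK; apply: PnJ => //; apply: PnV. Qed.

Lemma Pn_diff m g h : Pn 0 s g -> inG conj h -> Fl m s (h - g) -> Pn m s (ginv g *m h).
Proof.
move=> hg hh hd; have Gg := Pn_inG hg.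
split; first by apply: inGM => //; apply: inGV.
rewrite -(ginvVl Gg) -mulmxBr; apply: Fl0M => //.
by apply: Fl_ginv; apply: (Pn_Fl _ hg).
Qed.

(** With [X = g - 1] and [Y = h - 1] one has [gh - hg = XY - YX], so depths add. *)
Lemma Pn_commutator m g h : 0 <= m -> Pn m s g -> Pn m s h ->
  Pn (m + m) s (ginv (h *m g) *m (g *m h)).
Proof.
move=> m0 hg hh; apply: Pn_diff.
- exact: (Pn_le m0 (PnM m0 hh hg)).
- by apply: inGM; [case: hg | case: hh].
- have -> : g *m h - h *m g =
      (g - 1%:M) *m (h - 1%:M) - (h - 1%:M) *m (g - 1%:M).
    rewrite !mulmxBr !mulmxBl !mulmx1 !mul1mx.
    move: (g *m h) (h *m g) => a b; apply/matrixP => i j; rewrite !mxE; ring.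
  by case: hg => _ hg; case: hh => _ hh; apply: FlB; apply: FlM.
Qed.

Definition gpow g n : 'M[E]_3 := iter n (fun h : 'M[E]_3 => g *m h) 1%:M.

Lemma gpowS g n : gpow g n.+1 = g *m gpow g n. Proof. by []. Qed.

Lemma gpowD g (n k : nat) : gpow g (n + k) = gpow g n *m gpow g k.
Proof. by elim: n => [|n IH]; rewrite ?mul1mx // addSn !gpowS IH mulmxA. Qed.

Lemma Pn_pow m g n : 0 <= m -> Pn m s g -> Pn m s (gpow g n).
Proof. by move=> m0 hg; elim: n => [|n IH]; [apply: Pn1 | apply: PnM]. Qed.

Lemma Fl_muln m X n : Fl m s X -> Fl m s (X *+ n).
Proof. by move=> hX; elim: n => [|n IH]; [apply: Fl0 | rewrite mulrS; apply: FlD]. Qed.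

(** The binomial expansion to first order: all further terms contain two factors [g - 1]. *)
Lemma gpow_expand m g n : 0 <= m -> Pn m s g ->
  Fl (m + m) s (gpow g n - 1%:M - (g - 1%:M) *+ n).
Proof.
move=> m0 [Gg hg]; elim: n => [|n IH]; first by rewrite !subrr; apply: Fl0.
have gE : g = (g - 1%:M) + 1%:M by rewrite subrK.
move: (g - 1%:M) hg gE IH => X hg gE; set Z := (X in Fl _ _ X) => IH.
have -> : gpow g n.+1 - 1%:M - X *+ n.+1 = X *m (X *+ n) + g *m Z.
  have e : g *m X = X *m X + X by rewrite {1}gE mulmxDl mul1mx.
  have -> : X *m (X *+ n) = X *m X *+ n.
    by elim: n {IH Z} => [|n IHn]; rewrite ?mulmx0 // !mulrS mulmxDr IHn.
  have -> : g *m Z = g *m gpow g n - g - (X *m X *+ n + X *+ n).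
    rewrite /Z !mulmxBr mulmx1 -mulrnDl. rewrite -e; congr (_ - _).
    by elim: n {IH Z} => [|n IHn]; rewrite ?mulmx0 // !mulrS mulmxDr IHn.
  rewrite gpowS mulrS; move: (g *m gpow g n) (X *m X *+ n) (X *+ n) => a b c; rewrite gE.
  by apply/matrixP => i j; rewrite !mxE; ring.
apply: FlD; first by apply: FlM => //; apply: Fl_muln.
by apply: Fl0M => //; rewrite gE; apply: FlD; [apply: Fl_le hg | apply: Fl1].
Qed.

Lemma Pn_pow_p m g : 1 <= m -> Pn m s g -> Pn (m + 1) s (gpow g p).
Proof.
move=> m1 hg; have m0 : 0 <= m by lia.
split; first by case: (Pn_pow p m0 hg).
rewrite -[_ - _](subrK ((g - 1%:M) *+ p)); apply: FlD.
  by apply: Fl_le (gpow_expand p m0 hg); lia.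
have -> : (g - 1%:M) *+ p = p%:R *: (g - 1%:M) by rewrite scaler_nat.
move=> i j; rewrite mxE; apply: ge4_le (ge4M (m := 4) _ (proj2 hg i j)); first by lia.
by have := residue_char HE; rewrite inP_ge4.
Qed.

End Parahoric.

(** * Upper unipotent elements and elimination in a row *)

Definition un (a b : E) : 'M[E]_3 :=
  mx3 0 [:: [:: 1; a; b]; [:: 0; 1; - conj a]; [:: 0; 0; 1]].

Lemma un_inG a b : b + conj b + a * conj a = 0 -> inG conj (un a b).
Proof.
move=> hab; apply/inGP/mulmx1C/matrixP.
have c1 := conj1 HE; have c0 := conj0; have cc := conj_invol HE.
do 2?apply: ord3P; rewrite mul3 !ginvE !revE !mxE /= ?conjN ?cc ?c1 ?c0 ?mulr0n ?mulr1n.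
all: first [ring | rewrite -[RHS]hab; ring].
Qed.

(** Isotropy of the first row is exactly the condition for [u] to be unitary. After the elimination,
    orthogonality of the second row to the first kills the last entry above the diagonal. *)
Lemma row_factor g : inG conj g -> g o0 o0 != 0 ->
  let u := un (g o0 o1 / g o0 o0) (g o0 o2 / g o0 o0) in
  [/\ inG conj u, inG conj (g *m ginv u), (g *m ginv u) o0 o0 = g o0 o0
    & [/\ (g *m ginv u) o0 o1 = 0, (g *m ginv u) o0 o2 = 0 & (g *m ginv u) o1 o2 = 0]].
Proof.
move=> hg g0 u.
have cg0 : conj (g o0 o0) != 0 by rewrite conj_eq0.
have hu : inG conj u.
  apply: un_inG; rewrite !conjM !conjV.
  have := row_rel o0 o0 hg; rewrite (_ : (o0 == rev_ord o0) = false) // => h.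
  apply: (mulIf cg0); apply: (mulIf g0); rewrite mul0r mul0r -[RHS]h.
  by field; rewrite g0 cg0.
have hd : inG conj (g *m ginv u) by apply: inGM => //; apply: inGV.
have c1 := conj1 HE; have c0 := conj0; have cc := conj_invol HE.
have e0 : (g *m ginv u) o0 o0 = g o0 o0.
  by rewrite mul3 !ginvE !revE !mxE /= ?c0 ?c1; ring.
have e1 : (g *m ginv u) o0 o1 = 0.
  by rewrite mul3 !ginvE !revE !mxE /= ?c0 ?c1 conjN cc; field.
have e2 : (g *m ginv u) o0 o2 = 0.
  apply: (mulIf cg0); rewrite mul0r.
  have h := row_rel o0 o0 hg; rewrite (_ : (o0 == rev_ord o0) = false) // in h.
  rewrite -[RHS]h.
  by rewrite mul3 !ginvE !revE !mxE /= ?c0 ?c1 !conjM !conjV; field.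
split=> //; split=> //.
have := row_rel o1 o0 hd; rewrite e0 e1 e2 (_ : (o1 == rev_ord o0) = false) //.
by rewrite c0 !mulr0 !add0r => /eqP; rewrite mulf_eq0 (negPf cg0) orbF => /eqP.
Qed.

Lemma un_Fl m s a b : m <= 0 -> ge4 (m - s) a -> ge4 (m - 2 * s) b -> Fl m s (un a b).
Proof.
move=> m0 ha hb; do 2?apply: ord3P; rewrite mxE /= ?ge4_0 ?ge4N ?ge4J // /dg /=.
all: try by apply: ge4_1; lia.
all: by first [apply: ge4_le ha; lia | apply: ge4_le hb; lia].
Qed.

Lemma un1_Fl m s a b : ge4 (m - s) a -> ge4 (m - 2 * s) b -> Fl m s (un a b - 1%:M).
Proof.
move=> ha hb; do 2?apply: ord3P; rewrite !mxE /= ?subr0 ?subrr ?ge4_0 ?ge4N ?ge4J // /dg /=.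
all: by first [apply: ge4_le ha; lia | apply: ge4_le hb; lia].
Qed.

Lemma Fl_imp m s m' s' X :
  (forall i j (z : int), m - s * dg i j <= 4 * z -> m' - s' * dg i j <= 4 * z) ->
  Fl m s X -> Fl m' s' X.
Proof. by move=> h hX i j; apply: ge4_imp (hX i j) _; apply: h. Qed.

Section Uniformizer.
Variable w : E.
Hypothesis wJ : conj w = w.
Hypothesis w0 : w != 0.
Hypothesis w1 : v w = 1.

Lemma wz_neq0 (n : int) : w ^ n != 0. Proof. by rewrite expfz_eq0 (negPf w0) andbF. Qed.

Lemma wzJ (n : int) : conj (w ^ n) = w ^ n.
Proof.
have h k : conj (w ^+ k) = w ^+ k.
  by elim: k => [|k IH]; rewrite ?expr0 ?(conj1 HE) // exprS conjM IH wJ.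
by case: n => n; rewrite ?NegzE -?invr_expz ?conjV -?exprnP h.
Qed.

Lemma val_wz (n : int) : v (w ^ n) = n.
Proof.
have h k : v (w ^+ k) = k%:Z.
  elim: k => [|k IH]; rewrite ?expr0 ?val1 // exprS (v_mul HE) ?expf_neq0 // IH w1.
  by rewrite intS.
case: n => n; rewrite ?NegzE -?invr_expz -?exprnP ?valV ?h //.
by rewrite expf_neq0.
Qed.

Lemma ge4_wz m n x : ge4 m (w ^ n * x) = ge4 (m - 4 * n) x.
Proof.
rewrite /ge4 mulf_eq0 (negPf (wz_neq0 n)) /=; case: eqVneq => //= x0.
rewrite (v_mul HE) ?wz_neq0 // val_wz; move: (v x) => a; lia.
Qed.

(** * Translations of the standard apartment *)

Definition ts (n : int) : 'M[E]_3 := diag_mx (\row_i w ^ (n * ((i : nat)%:Z - 1))).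

Lemma tslE n (X : 'M[E]_3) i j : (ts n *m X) i j = w ^ (n * ((i : nat)%:Z - 1)) * X i j.
Proof. by rewrite mul_diag_mx !mxE. Qed.

Lemma tsrE n (X : 'M[E]_3) i j : (X *m ts n) i j = X i j * w ^ (n * ((j : nat)%:Z - 1)).
Proof. by rewrite mul_mx_diag !mxE. Qed.

Lemma ge4_ts m a b (X : 'M[E]_3) i j : ge4 m ((ts a *m X *m ts b) i j) =
  ge4 (m - 4 * (a * ((i : nat)%:Z - 1) + b * ((j : nat)%:Z - 1))) (X i j).
Proof. rewrite tsrE tslE mulrC !ge4_wz; congr ge4; lia. Qed.

Lemma ts0 : ts 0 = 1%:M.
Proof. by apply/matrixP => i j; rewrite !mxE mul0r expr0z. Qed.

Lemma tsD a b : ts (a + b) = ts a *m ts b.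
Proof.
apply/matrixP => i j; rewrite tslE !mxE mulrnAr -expfzDr //.
by case: eqP => [->|//]; rewrite mulrDl.
Qed.

Lemma tsNr a : ts a *m ts (- a) = 1%:M. Proof. by rewrite -tsD subrr ts0. Qed.
Lemma tsNl a : ts (- a) *m ts a = 1%:M. Proof. by rewrite -tsD addNr ts0. Qed.

Lemma revz (j : 'I_3) : ((rev_ord j : nat)%:Z - 1) = - ((j : nat)%:Z - 1).
Proof. by move: j; apply: ord3P. Qed.

Lemma ginv_ts a : ginv (ts a) = ts (- a).
Proof.
apply/matrixP => i j; rewrite ginvE !mxE (inj_eq rev_ord_inj) eq_sym.
case: eqP => [->|_]; last exact: conj0.
by rewrite wzJ revz mulrN mulNr.
Qed.

Lemma ts_inG a : inG conj (ts a).
Proof. by apply/inGP; rewrite ginv_ts tsNl. Qed.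

Lemma Fl_ts m s a X : Fl m s X -> Fl m (s + 4 * a) (ts a *m X *m ts (- a)).
Proof. by move=> h i j; rewrite ge4_ts; apply: ge4_le (h i j); rewrite /dg; lia. Qed.

Lemma Pn_ts m s a g : Pn m s g -> Pn m (s + 4 * a) (ts a *m g *m ts (- a)).
Proof.
move=> [Gg hg]; split.
  by apply: inGM; [apply: inGM|]; rewrite ?ts_inG.
have -> : ts a *m g *m ts (- a) - 1%:M = ts a *m (g - 1%:M) *m ts (- a).
  by rewrite mulmxBr mulmx1 mulmxBl tsNr.
exact: Fl_ts.
Qed.

Variable c : maxcpt.
Definition cz : int := if c is K1 then 1 else 0.
(* [Pn 0 sK] is K, [Pn 0 sI] and [Pn 0 sJ] are two opposite Iwahori subgroups of K, and
   [Pn 1 _] are the pro-p radicals, written [K^1], [I_1] and [J_1] in comments. *)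
Notation sK := (2 * cz).
Notation sI := (2 * cz + 1).
Notation sJ := (2 * cz - 1).

Lemma beta_inG : inG conj (beta E).
Proof.
apply/inGP; suff -> : ginv (beta E) = beta E by apply: beta2.
apply/matrixP => i j; rewrite ginvE !betaE rev_ordK eq_sym.
by case: eqP => _; rewrite ?(conj1 HE) ?conj0.
Qed.

Lemma betaXbeta (X : 'M[E]_3) i j :
  (beta E *m X *m beta E) i j = X (rev_ord i) (rev_ord j).
Proof.
rewrite mul3 !mul_betaE !betaE; move: j; apply: ord3P; rewrite !revE /=; ring.
Qed.

Lemma beta_ts a : beta E *m ts a = ts (- a) *m beta E.
Proof.
have -> : ts (- a) = beta E *m ts a *m beta E.
  apply/matrixP => i j; rewrite betaXbeta !mxE (inj_eq rev_ord_inj).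
  by case: eqP => [->|//]; rewrite revz mulrN mulNr.
by rewrite -mulmxA beta2 mulmx1.
Qed.

(* The affine Weyl reflection fixing the vertex of K, locked to keep [mulmxA] from looking
   inside. *)
Fact wl_key : unit. Proof. by []. Qed.
Definition wl : 'M[E]_3 := locked_with wl_key (ts cz *m beta E).

Lemma wlE : wl = ts cz *m beta E. Proof. exact: unlock. Qed.

Lemma wl_inG : inG conj wl.
Proof. by rewrite wlE; apply: inGM; [apply: ts_inG | apply: beta_inG]. Qed.

Lemma wl2 : wl *m wl = 1%:M.
Proof. by rewrite wlE mulmxA -(mulmxA _ (beta E)) beta_ts !mulmxA tsNr mul1mx beta2. Qed.

Lemma wl_ts a : wl *m ts a *m wl = ts (- a).
Proof.
by rewrite wlE -(mulmxA (ts cz)) beta_ts -!mulmxA (mulmxA (beta E)) beta_ts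
  -!mulmxA beta2 mulmx1 -!tsD; congr ts; lia.
Qed.

Lemma wlK (X : 'M[E]_3) : wl *m (wl *m X) = X.
Proof. by rewrite mulmxA wl2 mul1mx. Qed.
Lemma wlKr (X : 'M[E]_3) : X *m wl *m wl = X.
Proof. by rewrite -mulmxA wl2 mulmx1. Qed.

Lemma Fl_wl m s X : Fl m s X -> Fl m (4 * cz - s) (wl *m X *m wl).
Proof.
move=> h.
have -> : wl *m X *m wl = ts cz *m (beta E *m X *m beta E) *m ts (- cz).
  have e : wl = beta E *m ts (- cz) by rewrite beta_ts opprK wlE.
  by rewrite {2}e wlE !mulmxA.
rewrite addrC; apply: Fl_ts => i j; rewrite betaXbeta; apply: ge4_le (h _ _).
suff -> : dg (rev_ord i) (rev_ord j) = - dg i j by rewrite mulNr mulrN.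
by rewrite /dg /=; move: (ltn_ord i) (ltn_ord j); lia.
Qed.

Lemma Pn_wl m s s' g : s' = 4 * cz - s -> Pn m s g -> Pn m s' (wl *m g *m wl).
Proof.
move=> -> [Gg hg]; split; first by apply: inGM; [apply: inGM|]; rewrite ?wl_inG.
have -> : wl *m g *m wl - 1%:M = wl *m (g - 1%:M) *m wl.
  by rewrite mulmxBr mulmx1 mulmxBl wl2.
exact: Fl_wl.
Qed.

Lemma wl_K : Pn 0 sK wl.
Proof.
apply/Pn0; split; first exact: wl_inG.
move=> i j; rewrite wlE tslE betaE ge4_wz.
move: i j; do 2?apply: ord3P; rewrite !revE /= ?mulr0n ?ge4_0 //; apply: ge4_1; rewrite /dg /=; lia.
Qed.

(** * Iwahori subgroups of K and the Bruhat decomposition *)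

Lemma sI_sK m g : 0 <= m <= 1 -> Pn m sI g -> Pn 0 sK g.
Proof.
move=> m01 [Gg hg]; split=> //; apply: Fl_imp hg.
by do 2?apply: ord3P; rewrite /dg /=; lia.
Qed.
Lemma sJ_sK m g : 0 <= m <= 1 -> Pn m sJ g -> Pn 0 sK g.
Proof.
move=> m01 [Gg hg]; split=> //; apply: Fl_imp hg.
by do 2?apply: ord3P; rewrite /dg /=; lia.
Qed.
Lemma sK_sI g : Pn 1 sK g -> Pn 1 sI g.
Proof.
move=> [Gg hg]; split=> //; apply: Fl_imp hg.
by do 2?apply: ord3P; rewrite /dg /=; lia.
Qed.
Lemma sIJ_K1 g : Pn 1 sI g -> Pn 0 sJ g -> Pn 1 sK g.
Proof.
move=> [Gg hg] [_ hg']; split=> // i j.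
have h : forall z : int, (1 - sI * dg i j <= 4 * z) && (0 - sJ * dg i j <= 4 * z) ->
    1 - sK * dg i j <= 4 * z.
  by move: i j; do 2?apply: ord3P; rewrite /dg /=; lia.
by move: (hg i j) (hg' i j); rewrite /ge4; case: eqP => //= _ h1 h2; apply: h; rewrite h1.
Qed.

Lemma PnI_wl m g : Pn m sI g -> Pn m sJ (wl *m g *m wl).
Proof. by apply: Pn_wl; lia. Qed.
Lemma PnJ_wl m g : Pn m sJ g -> Pn m sI (wl *m g *m wl).
Proof. by apply: Pn_wl; lia. Qed.
Lemma PnK_wl m g : Pn m sK g -> Pn m sK (wl *m g *m wl).
Proof. by apply: Pn_wl; lia. Qed.

Lemma K_entry g i j : Pn 0 sK g -> ge4 (- (sK * dg i j)) (g i j).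
Proof. by move=> /Pn0 [_ h]; have := h i j; rewrite sub0r. Qed.

(* The other entries below the diagonal are controlled by the isotropy of the first column and
   of the last row. *)
Lemma K_corner_Iwahori g : Pn 0 sK g -> ge4 (1 + 2 * sK) (g o2 o0) -> Pn 0 sI g.
Proof.
move=> hK h20; have Gg := Pn_inG hK; have hE := fun i j => K_entry i j hK.
have h20' : ge4 (4 + 2 * sK) (g o2 o0) by apply: ge4_imp h20 _; lia.
have h10 : ge4 (1 + sK) (g o1 o0).
  have /eqP := col_rel o0 o0 Gg; rewrite (_ : (rev_ord o0 == o0) = false) // mulr0n.
  rewrite addrAC addrC addr_eq0 mulrC => /eqP e; apply: ge4_norm; rewrite e ge4N.
  have h00 := hE o0 o0; rewrite /dg subrr mulr0 oppr0 in h00.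
  apply: ge4D.
    by apply: (ge4_le _ (ge4M (m := 4 + 2 * sK) _ h00)); [lia | rewrite ge4J].
  by apply: (ge4_le _ (ge4M (m := 0) _ h20')); [lia | rewrite ge4J].
have h21 : ge4 (1 + sK) (g o2 o1).
  have /eqP := row_rel o2 o2 Gg; rewrite (_ : (o2 == rev_ord o2) = false) // mulr0n.
  rewrite addrAC addrC addr_eq0 => /eqP e; apply: ge4_norm; rewrite e ge4N.
  have h22 := hE o2 o2; rewrite /dg subrr mulr0 oppr0 in h22.
  apply: ge4D.
    by apply: (ge4_le _ (ge4M (m' := 0) h20' _)); [lia | rewrite ge4J].
  by apply: (ge4_le _ (ge4M (m' := 4 + 2 * sK) h22 _)); [lia | rewrite ge4J].
apply/Pn0; split=> // i j; have := hE i j; move: i j.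
do 2?apply: ord3P; rewrite /dg /= => h.
all: try by apply: ge4_imp h _; lia.
- by apply: ge4_imp h10 _; lia.
- by apply: ge4_imp h20 _; lia.
- by apply: ge4_imp h21 _; lia.
Qed.

(** The pairing of the last column with the first equals 1, and the two products with a factor below
    the diagonal have positive valuation; the third must then be a unit. *)
Lemma Iwahori_diag_unit g : Pn 0 sI g -> g o0 o0 != 0 /\ v (g o0 o0) = 0.
Proof.
move=> /Pn0 [Gg hE].
have := col_rel o2 o0 Gg; rewrite (_ : (rev_ord o2 == o0) = true) // mulr1n.
set x := conj (g o2 o2) * _; set y := conj (g o1 o2) * _; set z := conj _ * _ => e.
have hx : ge4 1 y.
  by apply: ge4_le (ge4M (m := 1 - sI) (m' := sI) _ _); rewrite ?ge4J; [lia| |];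
    apply: ge4_imp (hE _ _) _; rewrite /dg /=; lia.
have hz : ge4 1 z.
  by apply: ge4_le (ge4M (m := 1 - 2 * sI) (m' := 2 * sI) _ _); rewrite ?ge4J; [lia| |];
    apply: ge4_imp (hE _ _) _; rewrite /dg /=; lia.
have x1 : ~~ ge4 1 x.
  apply/negP => hx'; have : ge4 1 1 by rewrite -e; do 2?apply: ge4D.
  by rewrite ge4_eq ?oner_eq0 // val1.
have h0 := hE o0 o0; have h2 := hE o2 o2; rewrite /dg !subrr mulr0 subr0 in h0 h2.
have [g0|g0] := eqVneq (g o0 o0) 0; first by rewrite /x g0 mulr0 ge4_0 in x1.
have [g2|g2] := eqVneq (g o2 o2) 0; first by rewrite /x g2 conj0 mul0r ge4_0 in x1.
split=> //; move: x1 h0 h2; rewrite /x ge4_eq ?mulf_neq0 ?conj_eq0 //.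
rewrite !ge4_eq // (v_mul HE) ?conj_eq0 // (v_conj HE) //.
by move: (v (g o0 o0)) (v (g o2 o2)) => a b; lia.
Qed.

Lemma wl_mull0 (X : 'M[E]_3) k : (wl *m X) o0 k = w ^ (- cz) * X o2 k.
Proof. by rewrite wlE -mulmxA tslE mul_betaE revE sub0r mulrN1. Qed.

Lemma wl_mulr0 (X : 'M[E]_3) k : (X *m wl) k o0 = X k o2 * w ^ cz.
Proof.
rewrite mul3 wlE !tslE !betaE !revE /= !mulr0n !mulr0 !add0r mulr1n mulr1.
by rewrite (_ : _ * _ = cz) //; lia.
Qed.

Lemma trE (X : 'M[E]_3) i j : X^T i j = X j i. Proof. by rewrite mxE. Qed.

Lemma ge4_div m x y : y != 0 -> ge4 m (x / y) = ge4 (m + 4 * v y) x.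
Proof.
move=> y0; rewrite /ge4 mulf_eq0 invr_eq0 (negPf y0) orbF; case: eqVneq => //= x0.
rewrite (v_mul HE) ?invr_eq0 // valV //.
by move: (v x) (v y) => a b; lia.
Qed.

(** The intersection of K with the upper unipotent subgroup, that is, its integral points relative
    to the vertex of K. *)
Definition unipK u := exists a b,
  [/\ u = un a b, inG conj u, ge4 (- sK) a & ge4 (- (2 * sK)) b].

Lemma unipK_I1 u : unipK u -> Pn 1 sI u.
Proof.
move=> [a [b [-> hu ha hb]]]; split=> //.
by apply: un1_Fl; [apply: ge4_le ha; lia | apply: ge4_le hb; lia].
Qed.

Lemma unipK_contract n u : (0 < n)%N -> unipK u -> Pn 1 sK (ts (- n%:Z) *m u *m ts n%:Z).
Proof.
move=> n0 [a [b [-> hu ha hb]]].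
have := @Pn_ts 1 (sK + 4 * n%:Z) (- n%:Z) (un a b).
rewrite mulrN addrK opprK; apply; split=> //.
by apply: un1_Fl; [apply: ge4_le ha; lia | apply: ge4_le hb; lia].
Qed.

Lemma lower_sI_sJ g : Pn 0 sI g -> g o0 o1 = 0 -> g o0 o2 = 0 -> g o1 o2 = 0 -> Pn 0 sJ g.
Proof.
move=> /Pn0 [Gg hg] e1 e2 e3; apply/Pn0; split=> // i j; have := hg i j.
move: i j; do 2?apply: ord3P; rewrite ?e1 ?e2 ?e3 ?ge4_0 // => h.
all: by apply: ge4_imp h _; rewrite /dg /=; lia.
Qed.

(** Row elimination at the unit corner. The lower triangular factor belongs to both opposite Iwahori
    subgroups, which is what allows it to be carried across [wl]. *)
Lemma Iwahori_factor m g : 0 <= m <= 1 -> Pn m sI g -> exists d u,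
  [/\ g = d *m u, Pn m sI d, Pn 0 sJ d & unipK u].
Proof.
move=> /andP [m0 m1] hg; have hg0 := Pn_le m0 hg.
have [g0 vg0] := Iwahori_diag_unit hg0.
have [hu hd e00 [e01 e02 e12]] := row_factor (Pn_inG hg) g0.
set u := un _ _ in hu hd e00 e01 e02 e12; set d := g *m ginv u in hd e00 e01 e02 e12.
have Nu : unipK u.
  exists (g o0 o1 / g o0 o0), (g o0 o2 / g o0 o0).
  have hE := proj2 (proj1 (Pn0 _ _) hg0).
  by split=> //; rewrite ge4_div // vg0 mulr0 addr0; apply: ge4_imp (hE _ _) _;
    rewrite /dg /=; lia.
have hI := Pn_le m1 (unipK_I1 Nu).
have hdI : Pn m sI d by apply: PnM => //; apply: PnV.
exists d, u; split=> //; first by rewrite /d mulgVK.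
by apply: lower_sI_sJ => //; apply: (Pn_le m0 hdI).
Qed.

Lemma Fl_tr m s X : Fl m (- s) X -> Fl m s X^T.
Proof. by move=> h i j; rewrite mxE; apply: ge4_le (h j i); rewrite /dg; lia. Qed.

Lemma Pn_tr m s g : Pn m (- s) g -> Pn m s g^T.
Proof.
move=> [Gg hg]; split; first exact: inG_tr.
by rewrite -[1%:M]trmx1 -linearB /=; apply: Fl_tr.
Qed.

(** The lower left entry decides. If its valuation is the least one allowed in K, then [wl *m g] has
    a unit in its first corner, and column elimination, carried out on the transpose, splits off a
    lower unipotent factor that [wl] turns into an element of [I_1]. *)
Lemma K_cells g : Pn 0 sK g ->
  Pn 0 sI g \/ exists u b, [/\ Pn 1 sI u, Pn 0 sI b & g = u *m wl *m b].
Proof.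
move=> hg; have [h20|h20] := boolP (ge4 (1 + 2 * sK) (g o2 o0)).
  by left; apply: K_corner_Iwahori.
right; pose h := wl *m g.
have hK : Pn 0 sK h by apply: PnM => //; apply: wl_K.
have g20 : g o2 o0 != 0 by apply: contraNneq h20 => ->; apply: ge4_0.
have vg20 : v (g o2 o0) = cz.
  have := K_entry o2 o0 hg; move: h20; rewrite !ge4_eq // /dg /=; lia.
have h00E : h o0 o0 = w ^ (- cz) * g o2 o0.
  by rewrite /h wl_mull0.
have h00 : h o0 o0 != 0 by rewrite h00E mulf_neq0 ?wz_neq0.
have vh00 : v (h o0 o0) = 0.
  by rewrite h00E (v_mul HE) ?wz_neq0 // val_wz vg20 addNr.
have hT := inG_tr (Pn_inG hK).
have := row_factor hT; rewrite !trE => /(_ h00) [].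
set u := un _ _; set d := h^T *m ginv u => hu hd e00 [e01 e02 e12].
have uJ : Pn 1 sJ u^T.
  apply: Pn_tr; split=> //; apply: un1_Fl; rewrite ge4_div // vh00 mulr0 addr0.
    by apply: ge4_imp (K_entry o1 o0 hK) _; rewrite /dg /=; lia.
  by apply: ge4_imp (K_entry o2 o0 hK) _; rewrite /dg /=; lia.
have hE : h = u^T *m d^T by rewrite -trmx_mul mulgVK // trmxK.
have dK : Pn 0 sK d^T.
  have -> : d^T = ginv u^T *m h by rewrite hE mulKg //; apply: inG_tr.
  by apply: PnM => //; apply: PnV => //; apply: sJ_sK uJ.
exists (wl *m u^T *m wl), d^T; split.
- exact: PnJ_wl.
- by apply: K_corner_Iwahori => //; rewrite trE e02 ge4_0.
- by rewrite wlKr -mulmxA -hE /h wlK.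
Qed.

Lemma I1_cells u : Pn 1 sI u -> Pn 1 sK u \/
  exists u1 b, [/\ Pn 1 sI u1, Pn 0 sI b & wl *m u *m wl = u1 *m wl *m b].
Proof.
move=> hu; have hK : Pn 0 sK u by apply: sI_sK hu.
have [h|[u1 [b hb]]] := K_cells (PnK_wl hK); last by right; exists u1, b.
left; apply: sIJ_K1 => //.
have -> : u = wl *m (wl *m u *m wl) *m wl by rewrite -mulmxA wlKr wlK.
exact: PnI_wl.
Qed.

(* On the tree: a vertex at distance n + 1 has at most one neighbour at distance at most n. *)
Lemma parent_unique (n : nat) k : Pn 0 sK k ->
  Fl (- (4 * n%:Z)) sK (ts (- 1) *m k *m ts (n%:Z + 1)) ->
  Pn 0 sK (ts (- 1) *m k *m ts 1).
Proof.
move=> hk hn; have Gk := Pn_inG hk.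
have h20 : ge4 (2 * sK + 8) (k o2 o0).
  by have := hn o2 o0; rewrite ge4_ts => h; apply: ge4_imp h _; rewrite /dg /=; lia.
have h10 : ge4 (sK + 4) (k o1 o0).
  by have := hn o1 o0; rewrite ge4_ts => h; apply: ge4_imp h _; rewrite /dg /=; lia.
have hI : Pn 0 sI k by apply: K_corner_Iwahori => //; apply: ge4_le h20; lia.
have [k0 vk0] := Iwahori_diag_unit hI.
have h21 : ge4 (sK + 4) (k o2 o1).
  have /eqP := col_rel o0 o1 Gk; rewrite (_ : (rev_ord o0 == o1) = false) // mulr0n.
  rewrite addrC addr_eq0 => /eqP e.
  have -> : ge4 (sK + 4) (k o2 o1) = ge4 (sK + 4) (conj (k o0 o0) * k o2 o1).
    rewrite /ge4 mulf_eq0 conj_eq0 (negPf k0) /=; case: eqVneq => //= z.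
    by rewrite (v_mul HE) ?conj_eq0 // (v_conj HE) // vk0 add0r.
  rewrite e ge4N; apply: ge4D.
    apply: (ge4_le _ (ge4M (m := 2 * sK + 8) (m' := - sK) _ _)); first by lia.
      by rewrite ge4J.
    by apply: ge4_imp (K_entry o0 o1 hk) _; rewrite /dg /=; lia.
  apply: (ge4_le _ (ge4M (m := sK + 4) (m' := 0) _ _)); first by lia.
    by rewrite ge4J.
  by apply: ge4_imp (K_entry o1 o1 hk) _; rewrite /dg /=; lia.
apply/Pn0; split; first by apply: inGM; [apply: inGM|]; rewrite ?ts_inG.
move=> i j; rewrite ge4_ts; have := K_entry i j hk; move: i j.
do 2?apply: ord3P; rewrite /dg /= => h.
all: try by apply: ge4_imp h _; lia.
- by apply: ge4_imp h10 _; lia.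
- by apply: ge4_imp h20 _; lia.
- by apply: ge4_imp h21 _; lia.
Qed.

(** * The Cartan decomposition *)

Lemma ts_norm (n m : int) k1 k2 : Pn 0 sK k1 -> Pn 0 sK k2 ->
  Fl (- (4 * m)) sK (k1 *m ts n *m k2) -> n <= m.
Proof.
move=> h1 h2 h.
have G1 := Pn_inG h1; have G2 := Pn_inG h2.
have : Fl (- (4 * m)) sK (ginv k1 *m (k1 *m ts n *m k2) *m ginv k2).
  apply: FlM0; [apply: Fl0M => //|]; apply: Fl_ginv; first exact: (Pn_Fl _ h1).
  exact: (Pn_Fl _ h2).
rewrite !mulmxA ginvVl // mul1mx mulgK // => /(_ o0 o0).
rewrite !mxE eqxx mulr1n -[_ ^ _]mulr1 ge4_wz ge4_eq ?oner_eq0 // val1 /dg /=; lia.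
Qed.

Lemma ts_Fl (n : nat) : Fl (- (4 * n%:Z)) sK (ts n%:Z).
Proof.
rewrite -[ts _]mulmx1 => i j; rewrite tslE mxE; case: eqP => [<-|_]; last first.
  by rewrite mulr0n mulr0 ge4_0.
rewrite ge4_wz; apply: ge4_1; rewrite /dg subrr mulr0 subr0.
by move: i; apply: ord3P => /=; lia.
Qed.

(** The Hermitian relation of a column with itself expresses the norm of its middle entry by its two
    outer entries. Hence a unitary matrix is bounded by its four corners. *)
Lemma col_middle (m : int) g j : 0 <= m -> inG conj g ->
  ge4 (- m - sK * dg o0 j) (g o0 j) -> ge4 (- m - sK * dg o2 j) (g o2 j) ->
  ge4 (- m - sK * dg o1 j) (g o1 j).
Proof.
move=> m0 Gg h0 h2; have := col_rel j j Gg.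
set r := _%:R => e; have hr : (rev_ord j == j) = (j == o1) by move: j {h0 h2 e r}; apply: ord3P.
have {}e : g o1 j * conj (g o1 j) = r - (conj (g o2 j) * g o0 j + conj (g o0 j) * g o2 j).
  by rewrite -e; ring.
apply: ge4_norm; rewrite e; apply: ge4B.
  rewrite /r hr; case: eqP => [->|_]; last exact: ge4_0.
  by apply: ge4_1; rewrite /dg; lia.
apply: ge4D.
  by apply: (ge4_le _ (ge4M (m := - m - sK * dg o2 j) _ h0));
    [rewrite /dg /=; lia | rewrite ge4J].
by apply: (ge4_le _ (ge4M (m := - m - sK * dg o0 j) _ h2));
  [rewrite /dg /=; lia | rewrite ge4J].
Qed.

Lemma row_middle (m : int) g i : 0 <= m -> inG conj g ->
  ge4 (- m - sK * dg i o0) (g i o0) -> ge4 (- m - sK * dg i o2) (g i o2) ->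
  ge4 (- m - sK * dg i o1) (g i o1).
Proof.
move=> m0 Gg h0 h2; have := row_rel i i Gg.
set r := _%:R => e; have hr : (i == rev_ord i) = (i == o1) by move: i {h0 h2 e r}; apply: ord3P.
have {}e : g i o1 * conj (g i o1) = r - (g i o0 * conj (g i o2) + g i o2 * conj (g i o0)).
  by rewrite -e; ring.
apply: ge4_norm; rewrite e; apply: ge4B.
  rewrite /r hr; case: eqP => [->|_]; last exact: ge4_0.
  by apply: ge4_1; rewrite /dg; lia.
apply: ge4D.
  by apply: (ge4_le _ (ge4M (m' := - m - sK * dg i o2) h0 _));
    [rewrite /dg /=; lia | rewrite ge4J].
by apply: (ge4_le _ (ge4M (m' := - m - sK * dg i o0) h2 _));
  [rewrite /dg /=; lia | rewrite ge4J].
Qed.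

Lemma corners_Fl (m : int) g : 0 <= m -> inG conj g ->
  (forall i j, i != o1 -> j != o1 -> ge4 (- m - sK * dg i j) (g i j)) ->
  Fl (- m) sK g.
Proof.
move=> m0 Gg h.
have h01 : ge4 (- m - sK * dg o0 o1) (g o0 o1) by apply: row_middle => //; apply: h.
have h21 : ge4 (- m - sK * dg o2 o1) (g o2 o1) by apply: row_middle => //; apply: h.
have h10 : ge4 (- m - sK * dg o1 o0) (g o1 o0) by apply: col_middle => //; apply: h.
have h12 : ge4 (- m - sK * dg o1 o2) (g o1 o2) by apply: col_middle => //; apply: h.
have h11 : ge4 (- m - sK * dg o1 o1) (g o1 o1) by apply: col_middle.
by do 2?apply: ord3P => //; apply: h.
Qed.

(** With the first corner of least relative valuation, the multipliers of row and column elimination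
    are integral for K. A diagonal matrix remains, and unitarity forces its valuations to be [n], 0,
    [- n]. *)
Lemma Cartan_corner g : inG conj g -> g o0 o0 != 0 -> v (g o0 o0) <= 0 ->
  Fl (4 * v (g o0 o0)) sK g ->
  exists k1 k2, [/\ Pn 0 sK k1, Pn 0 sK k2 & g = k1 *m ts (- v (g o0 o0)) *m k2].
Proof.
move=> Gg g0 v0 hg; set n := v (g o0 o0) in v0 hg *.
have [hu hd d00 [d01 d02 d12]] := row_factor Gg g0.
set u := un _ _ in hu hd d00 d01 d02 d12; set d := g *m ginv u in hd d00 d01 d02 d12.
have uK : Pn 0 sK u.
  apply/Pn0; split=> //; apply: un_Fl => //; rewrite ge4_div // -/n.
    by apply: ge4_imp (hg o0 o1) _; rewrite /dg /=; lia.
  by apply: ge4_imp (hg o0 o2) _; rewrite /dg /=; lia.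
have dF : Fl (4 * n) sK d by apply: FlM0 => //; apply: Fl_ginv; apply: (Pn_Fl _ uK).
have := row_factor (inG_tr hd); rewrite !trE d00 => /(_ g0) [].
set l := un _ _; set e := d^T *m ginv l => hl he e00 [e01 e02 e12].
have lK : Pn 0 sK l^T.
  apply: Pn_tr; apply/Pn0; split=> //; apply: un_Fl => //; rewrite ge4_div // -/n.
    by apply: ge4_imp (dF o1 o0) _; rewrite /dg /=; lia.
  by apply: ge4_imp (dF o2 o0) _; rewrite /dg /=; lia.
have dE : d = l^T *m e^T by rewrite -trmx_mul mulgVK // trmxK.
have l00 : l o0 o0 = 1 by rewrite mxE.
have l10 : l o1 o0 = 0 by rewrite mxE.
have l20 : l o2 o0 = 0 by rewrite mxE.
have e10 : e o1 o0 = 0.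
  have := congr1 (fun X : 'M__ => X o0 o1) dE; rewrite /= d01 mul3 !trE l00 l10 l20.
  by rewrite !mul0r !addr0 mul1r => <-.
have e20 : e o2 o0 = 0.
  have := congr1 (fun X : 'M__ => X o0 o2) dE; rewrite /= d02 mul3 !trE l00 l10 l20.
  by rewrite !mul0r !addr0 mul1r => <-.
have ce0 : conj (e o0 o0) != 0 by rewrite e00 conj_eq0.
have c0 := conj0.
have e21 : e o2 o1 = 0.
  have := col_rel o0 o1 he; rewrite e01 e10 e20 c0 (_ : (_ == _) = false) // mulr0n.
  by rewrite !mul0r !add0r => /eqP; rewrite mulf_eq0 (negPf ce0) => /eqP.
have h02 := col_rel o0 o2 he.
rewrite e10 e20 c0 !mul0r !add0r (_ : (_ == _) = true) // mulr1n in h02.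
have h11 := col_rel o1 o1 he.
rewrite e01 e21 c0 !mul0r add0r addr0 (_ : (_ == _) = true) // mulr1n in h11.
have e11 : e o1 o1 != 0 by apply: contra_eq_neq h11 => ->; rewrite mulr0 eq_sym oner_eq0.
have e22 : e o2 o2 != 0 by apply: contra_eq_neq h02 => ->; rewrite mulr0 eq_sym oner_eq0.
have v11 : v (e o1 o1) = 0.
  have := congr1 v h11; rewrite (v_mul HE) ?conj_eq0 // (v_conj HE) // val1.
  by move: (v (e o1 o1)) => a; clear; lia.
have v22 : v (e o2 o2) = - n.
  have := congr1 v h02; rewrite (v_mul HE) // ?(v_conj HE) ?e00 // val1 -/n.
  by rewrite /n; move: (v (e o2 o2)) (v (g o0 o0)) => a b; clear; lia.
exists l^T, (ts n *m e^T *m u); split=> //.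
- apply: PnM => //; apply/Pn0; split; first by apply: inGM; [apply: ts_inG | apply: inG_tr].
  move=> i j; rewrite tslE trE; move: i j; do 2?apply: ord3P;
    rewrite ?e01 ?e02 ?e10 ?e12 ?e20 ?e21 ?mulr0 ?ge4_0 //.
  + by rewrite ge4_wz ge4_eq ?e00 // /dg /= /n; move: (v _) => a; clear; lia.
  + by rewrite ge4_wz ge4_eq // v11 /dg /=; clear; lia.
  + by rewrite ge4_wz ge4_eq // v22 /dg /= /n; move: (v _) => a; clear; lia.
- rewrite !mulmxA -(mulmxA l^T) tsNl mulmx1 -dE /d mulgVK //.
Qed.

Lemma Cartan g : inG conj g -> exists (n : nat) k1 k2,
  [/\ Pn 0 sK k1, Pn 0 sK k2 & g = k1 *m ts n%:Z *m k2].
Proof.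
move=> Gg.
have bnd : exists m : nat, `[< Fl (- m%:Z) sK g >].
  pose b i j := addn (absz (4 * v (g i j))) (absz (sK * dg i j)).
  exists (\sum_i \sum_j b i j)%N; apply/asboolP => i j.
  have : (b i j <= \sum_i \sum_j b i j)%N.
    by rewrite (bigD1 i) //= (bigD1 j) //= -addnA leq_addr.
  rewrite /ge4 /b; move: (\sum_i _)%N => N hN; apply/orP; right; lia.
have [m /asboolP hm min] := ex_minnP bnd.
case: m hm min => [|m] hm min.
  exists 0%N, g, 1%:M; split; last by rewrite ts0 !mulmx1.
    by apply/Pn0; split=> //; move: hm; rewrite oppr0.
  exact: Pn1.
have [i [j [hi hj hbad]]] : exists i j : 'I_3, [/\ i != o1, j != o1
    & ~~ ge4 (- m%:Z - sK * dg i j) (g i j)].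
  apply: contrapT => hn; have /asboolP /min : Fl (- m%:Z) sK g; last by rewrite ltnn.
  apply: corners_Fl => // i j hi hj; apply: contrapT => /negP hb.
  by apply: hn; exists i, j.
have gij0 : g i j != 0 by apply: contraNneq hbad => ->; apply: ge4_0.
(* Minimality makes the bound sharp at a corner. *)
have hv : 4 * v (g i j) = - (m.+1)%:Z - sK * dg i j.
  by have := hm i j; move: hbad; rewrite !ge4_eq //; lia.
(* [a] and [b] move this corner to the first position; the powers of [w] in [wl] absorb the shift
   [sK * dg i j]. *)
pose a : 'M[E]_3 := if i == o0 then 1%:M else wl.
pose b : 'M[E]_3 := if j == o0 then 1%:M else wl.
have aK : Pn 0 sK a by rewrite /a; case: eqP => _; [apply: Pn1 | apply: wl_K].
have bK : Pn 0 sK b by rewrite /b; case: eqP => _; [apply: Pn1 | apply: wl_K].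
have a2 : a *m a = 1%:M by rewrite /a; case: eqP => _; rewrite ?wl2 ?mulmx1.
have b2 : b *m b = 1%:M by rewrite /b; case: eqP => _; rewrite ?wl2 ?mulmx1.
pose h := a *m g *m b.
have Gh : inG conj h.
  by apply: inGM; [apply: inGM => //; apply: (Pn_inG aK) | apply: (Pn_inG bK)].
have hF : Fl (- (m.+1)%:Z) sK h.
  by apply: FlM0; [apply: Fl0M => //; apply: (Pn_Fl _ aK) | apply: (Pn_Fl _ bK)].
have [h0 vh] : h o0 o0 != 0 /\ 4 * v (h o0 o0) = - (m.+1)%:Z.
  have -> : h o0 o0 = w ^ (cz * (((i != o0)%N : nat)%:Z * -1 + ((j != o0)%N : nat)%:Z)) * g i j.
    rewrite /h /a /b; move: i j hi hj {hbad gij0 hv a b aK bK a2 b2 h Gh hF}.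
    do 2?apply: ord3P; move=> //= _ _; rewrite ?mul1mx ?mulmx1 ?wl_mulr0 ?wl_mull0.
    - by rewrite (_ : cz * _ = 0) ?expr0z ?mul1r //; lia.
    - by rewrite (_ : cz * _ = cz) 1?mulrC //; lia.
    - by rewrite (_ : cz * _ = - cz) //; lia.
    - rewrite (_ : cz * _ = 0); last by lia.
      by rewrite expr0z mul1r mulrAC -expfzDr // addNr mul1r.
  split; first by rewrite mulf_neq0 ?wz_neq0.
  rewrite (v_mul HE) ?wz_neq0 // val_wz mulrDr hv.
  by move: i j hi hj {hbad gij0 hv a b aK bK a2 b2 h Gh hF}; do 2?apply: ord3P; move=> //= _ _;
    rewrite /dg /=; clear; lia.
have v0 : v (h o0 o0) <= 0 by move: vh; move: (v (h o0 o0)) => z; clear; lia.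
have [|k1 [k2 [h1 h2 e]]] := Cartan_corner Gh h0 v0; first by rewrite vh.
exists (absz (v (h o0 o0))), (a *m k1), (k2 *m b); split; try exact: PnM.
have -> : (absz (v (h o0 o0)))%:Z = - v (h o0 o0).
  by move: v0; move: (v (h o0 o0)) => z; clear; lia.
have -> : g = a *m h *m b by rewrite /h -!mulmxA b2 mulmx1 mulmxA a2 mul1mx.
by rewrite {1}e !mulmxA.
Qed.

(** * Particular elements of the root subgroup of the long root *)

Lemma trace_zero_element (n : int) : exists b, [/\ conj b = - b, b != 0 & v b = n].
Proof.
have [x hx] := conj_nontriv HE; pose y := x - conj x.
have y0 : y != 0 by rewrite subr_eq0 eq_sym.
have cy : conj y = - y by rewrite conjB (conj_invol HE) opprB.
exists (w ^ (n - v y) * y); split; first by rewrite conjM wzJ cy mulrN.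
  by rewrite mulf_neq0 ?wz_neq0.
by rewrite (v_mul HE) ?wz_neq0 // val_wz subrK.
Qed.

Lemma un0_inG b : conj b = - b -> inG conj (un 0 b).
Proof. by move=> cb; apply: un_inG; rewrite cb conj0 mulr0 subrr addr0. Qed.

(* An element of [K^1], hence acting trivially on the weights, that moves a vertex of each
   sphere to another one having the same parent. *)
Lemma sibling_element : exists k, [/\ Pn 1 sK k, ~ Pn 0 sK (ts 1 *m k *m ts (- 1))
  & forall n : nat, Pn 0 sK (ts (- n%:Z) *m k *m ts n%:Z)].
Proof.
(* Valuation [1 - cz] is the least that puts [un 0 b] in [K^1]. Conjugation by [ts 1] lowers it by
   2, below the bound [- cz] of K. *)
have [b [cb b0 vb]] := trace_zero_element (1 - cz); have hu := un0_inG cb.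
exists (un 0 b); split.
- by split=> //; apply: un1_Fl; rewrite ?ge4_0 // ge4_eq // vb; lia.
- move=> /Pn0 [_ /(_ o0 o2)]; rewrite ge4_ts mxE /= ge4_eq // vb /dg /=; lia.
- case=> [|n].
    rewrite oppr0 ts0 mul1mx mulmx1; apply/Pn0; split=> //.
    by apply: un_Fl => //; rewrite ?ge4_0 // ge4_eq // vb; lia.
  apply: (@Pn_le _ 1) => //; apply: unipK_contract => //; exists 0, b.
  by split=> //; rewrite ?ge4_0 // ge4_eq // vb; lia.
Qed.

Lemma order_p_element : exists z,
  [/\ Pn 1 sI z, ~ Pn 1 sK z & Pn 1 sK (gpow z p)].
Proof.
have [b [cb b0 vb]] := trace_zero_element (- cz); have hu := un0_inG cb.
(* Depth 2 and not merely 1: the p-th power then has depth 3 at [sI], which is contained in [K^1],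
   whereas depth 2 is not, as this element itself shows. *)
have hz : Pn 2 sI (un 0 b).
  by split=> //; apply: un1_Fl; rewrite ?ge4_0 // ge4_eq // vb; lia.
exists (un 0 b); split; first exact: (Pn_le _ hz).
- by move=> [_ /(_ o0 o2)]; rewrite !mxE /= subr0 ge4_eq // vb /dg /=; lia.
have [//|Gz hz'] := Pn_pow_p _ hz.
split=> //; apply: Fl_imp hz'.
by do 2?apply: ord3P; rewrite /dg /=; lia.
Qed.

(** Since [sI] is odd, [sI * dg i j] is not a multiple of 4 off the diagonal, so depths 0 and 1
    impose the same condition there. *)
Lemma Iwahori_depth1 X : Fl 0 sI X -> (forall i, ge4 1 (X i i)) -> Fl 1 sI X.
Proof.
move=> hX hd i j; have := hX i j; have := hd i; move: i j.
do 2?apply: ord3P; rewrite /dg /= => a b;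
  by [apply: ge4_imp a _; clear; lia | apply: ge4_imp b _; clear; lia].
Qed.

(** The Iwahori subgroup modulo its pro-p radical is diagonal, hence abelian: in a diagonal entry of
    a product, the contributions of off-diagonal entries have positive valuation. *)
Lemma Iwahori_commutator g h : Pn 0 sI g -> Pn 0 sI h ->
  Pn 1 sI (ginv (h *m g) *m (g *m h)).
Proof.
move=> hg hh; have [Gg Fg] := proj1 (Pn0 _ _) hg; have [Gh Fh] := proj1 (Pn0 _ _) hh.
apply: Pn_diff; [exact: PnM | exact: inGM |].
apply: Iwahori_depth1; first by apply: FlB; apply: Fl0M.
have h1 X Y i k : Fl 0 sI X -> Fl 0 sI Y -> i != k -> ge4 1 (X i k * Y k i).
  move=> hX hY; have := hX i k; have := hY k i; move: i k.
  do 2?apply: ord3P; move=> //= a b _; first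
    [ by apply: ge4_le (ge4M (m := 1 - sI) (m' := sI) _ _);
        [lia | apply: ge4_imp b _ | apply: ge4_imp a _]; rewrite /dg /=; lia
    | by apply: ge4_le (ge4M (m := 1 - 2 * sI) (m' := 2 * sI) _ _);
        [lia | apply: ge4_imp b _ | apply: ge4_imp a _]; rewrite /dg /=; lia
    | by apply: ge4_le (ge4M (m := sI) (m' := 1 - sI) _ _);
        [lia | apply: ge4_imp b _ | apply: ge4_imp a _]; rewrite /dg /=; lia
    | by apply: ge4_le (ge4M (m := 2 * sI) (m' := 1 - 2 * sI) _ _);
        [lia | apply: ge4_imp b _ | apply: ge4_imp a _]; rewrite /dg /=; lia ].
move=> i; rewrite mxE [(- (h *m g)) i i]mxE !mul3.
have h2 k : ge4 1 (g i k * h k i - h i k * g k i).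
  have [->|ne] := eqVneq i k; first by rewrite mulrC subrr ge4_0.
  by apply: ge4B; apply: h1.
set L := (X in ge4 1 X).
have -> : L = (g i o0 * h o0 i - h i o0 * g o0 i) +
    (g i o1 * h o1 i - h i o1 * g o1 i) + (g i o2 * h o2 i - h i o2 * g o2 i).
  by rewrite /L; ring.
by apply: ge4D => //; apply: ge4D.
Qed.

Lemma inK_Pn g : inK conj v c g <-> Pn 0 sK g.
Proof.
split=> [/andP [Gg /forallP h]|].
  apply/Pn0; split=> // i j; have /forallP /(_ j) := h i; rewrite inP_ge4.
  rewrite /dg /cz; case: (c) {h}; move: i j; do 2?apply: ord3P;
    by rewrite /Kbound /= => h; apply: (ge4_imp h); lia.
move=> /Pn0 [Gg h]; apply/andP; split=> //; apply/forallP => i; apply/forallP => j.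
have := h i j; rewrite inP_ge4 /dg /cz; case: (c) {h}; move: i j;
  do 2?apply: ord3P; by rewrite /Kbound /= => h; apply: (ge4_imp h); lia.
Qed.

(** * Finiteness of coset spaces *)

Lemma dg_bound (s : int) i j : `|s * dg i j| <= 2 * `|s|.
Proof. by move: i j; do 2?apply: ord3P; rewrite /dg /=; lia. Qed.

Lemma Fl_entry (m s n : int) (X : 'M[E]_3) i j : n + 2 * `|s| <= m -> Fl m s X -> ge4 n (X i j).
Proof. by move=> h hX; apply: ge4_le (hX i j); have := dg_bound s i j; lia. Qed.

Lemma entry_Fl (m s n : int) (X : 'M[E]_3) :
  m + 2 * `|s| <= n -> (forall i j, ge4 n (X i j)) -> Fl m s X.
Proof. by move=> h hX i j; apply: ge4_le (hX i j); have := dg_bound s i j; lia. Qed.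

Lemma Pn_cong1 (s : int) (N : nat) : exists2 m : nat, (0 < m)%N &
  forall g, Pn m%:Z s g -> cong1 v N g.
Proof.
exists (absz (4 * N%:Z + 2 * `|s|)).+1 => // g [_ hg] i j.
by rewrite inP_ge4; apply: Fl_entry hg; lia.
Qed.

(** Expansion to [k] digits in powers of [w], with digits in a finite list representing the residue
    field. *)
Lemma cover_scalar (k : nat) (M : int) : exists Q : seq E,
  forall x, ge4 (4 * M) x -> exists2 q, q \in Q & ge4 (4 * (M + k%:Z)) (x - q).
Proof.
have [r hr] := residue_finite HE.
elim: k M => [|k IH] M.
  by exists [:: 0] => x hx; exists 0; rewrite ?mem_head // [x - 0]subr0; apply: ge4_le hx; lia.
have [Q hQ] := IH (M + 1).
exists [seq w ^ M * y + q | y <- r, q <- Q] => x hx.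
have [|y yr] := hr (w ^ (- M) * x).
  by rewrite inP_ge4 ge4_wz; apply: ge4_le hx; lia.
rewrite inP_ge4 => hy; have [|q qQ hq] := hQ (x - w ^ M * y).
  rewrite -[x]mul1r -(expr0z w) -(subrr M) expfzDr // -mulrA -mulrBr ge4_wz.
  by apply: ge4_le hy; lia.
exists (w ^ M * y + q); first by apply/allpairsP; exists (y, q).
by rewrite opprD addrA; apply: ge4_le hq; lia.
Qed.

Lemma cover_mx (k : nat) (M : int) : exists Q : seq 'M[E]_3,
  forall X : 'M[E]_3, (forall i j, ge4 (4 * M) (X i j)) ->
  exists2 q, q \in Q & forall i j, ge4 (4 * (M + k%:Z)) ((X - q) i j).
Proof.
have [Q hQ] := cover_scalar k M.
pose f (Y : 'M['I_(size Q)]_3) := map_mx (fun i : 'I_(size Q) => Q`_i) Y.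
exists [seq f Y | Y <- enum {: 'M['I_(size Q)]_3}] => X hX.
have h i j : exists l : 'I_(size Q), ge4 (4 * (M + k%:Z)) (X i j - Q`_l).
  have [q qQ hq] := hQ _ (hX i j).
  have hl : (index q Q < size Q)%N by rewrite index_mem.
  by exists (Ordinal hl); rewrite /= nth_index.
exists (f (\matrix_(i, j) xchoose (h i j))); first by apply: map_f; rewrite mem_enum.
by move=> i j; rewrite !mxE; apply: (xchooseP (h i j)).
Qed.

Record subgroupP (H : 'M[E]_3 -> Prop) : Prop := SubgroupP {
  sgp_inG : forall g, H g -> inG conj g;
  sgp1 : H 1%:M;
  sgpM : forall g h, H g -> H h -> H (g *m h);
  sgpV : forall g, H g -> H (ginv g) }.

Lemma Pn_subgroup (m s : int) : 0 <= m -> subgroupP (Pn m s).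
Proof.
move=> m0; split; [exact: Pn_inG | exact: Pn1 | |].
- by move=> g h; apply: PnM.
- by move=> g; apply: PnV.
Qed.

Definition coset_rel (H : 'M[E]_3 -> Prop) x y := H (x *m ginv y).

Section Cosets.
Variable H : 'M[E]_3 -> Prop.
Hypothesis hH : subgroupP H.

Lemma coset_refl x : inG conj x -> coset_rel H x x.
Proof. by move=> Gx; rewrite /coset_rel ginvV //; apply: sgp1. Qed.
Lemma coset_sym x y : coset_rel H x y -> coset_rel H y x.
Proof. by move=> /(sgpV hH); rewrite /coset_rel ginvM ginvK. Qed.
Lemma coset_trans x y z : inG conj y -> coset_rel H x y -> coset_rel H y z ->
  coset_rel H x z.
Proof.
move=> Gy h1 h2; have := sgpM hH h1 h2.
by rewrite /coset_rel mulmxA mulgVK.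
Qed.

Lemma coset_reps_exist (S : 'M[E]_3 -> Prop) (m s M : int) :
  (forall x, S x -> inG conj x /\ Fl (- M) s x) -> 0 <= m ->
  (forall g, Pn m s g -> H g) -> exists R, reps S (coset_rel H) R.
Proof.
(* [B] leaves room for passing between entrywise bounds and [Fl] at [s], and for the loss of [M] on
   multiplying by [ginv y]. *)
move=> hS m0 mH; pose B := absz (`|M| + 2 * `|s| + m).
have [Q hQ] := cover_mx (B + B) (- B%:Z).
apply: (@reps_exist _ _ _ _ _ _ Q (fun X q =>
    forall i j, ge4 (4 * (- B%:Z + (B + B)%N%:Z)) ((X - q) i j))).
- by move=> x /hS [Gx _]; apply: coset_refl.
- by move=> x y _ _; apply: coset_sym.
- by move=> x /hS [_ hx]; apply: hQ => i j; apply: Fl_entry hx; rewrite /B; lia.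
move=> x y q /hS [Gx hx] /hS [Gy hy] hxq hyq; apply: mH; split.
  by apply: inGM => //; apply: inGV.
have -> : x *m ginv y - 1%:M = (x - y) *m ginv y by rewrite mulmxBl ginvV.
have -> : m = (m + M) + - M by rewrite addrK.
apply: FlM; last exact: Fl_ginv.
have -> : x - y = (x - q) - (y - q) by rewrite opprB addrA subrK.
apply: FlB.
  by apply: entry_Fl hxq; rewrite /B; lia.
by apply: entry_Fl hyq; rewrite /B; lia.
Qed.

End Cosets.

Lemma Pn_finite_order (m s : int) g : 0 <= m -> Pn 0 s g ->
  exists2 d, (0 < d)%N & Pn m s (gpow g d).
Proof.
move=> m0 hg; have sg := Pn_subgroup s m0.
have [|R hR] := @coset_reps_exist _ sg (Pn 0 s) m s 0 _ m0 (fun _ h => h).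
  by move=> x hx; rewrite oppr0; apply/Pn0.
have hk k : Pn 0 s (gpow g k) by apply: Pn_pow.
have /(@boolp.choice _ _ _) [f hf] : forall k, exists r,
    r \in R /\ coset_rel (Pn m s) (gpow g k) r.
  by move=> k; have [r rR hr] := reps_cover hR (hk k); exists r.
pose l := map f (iota 0 (size R).+1).
have /uniqPn : ~~ uniq l.
  apply/negP => /uniq_leq_size - /(_ R) h.
  have := h _; rewrite size_map size_iota ltnn => {}h.
  by suff: false by []; apply: h => _ /mapP [k _ ->]; case: (hf k).
move=> /(_ 0) [i [j [ij]]]; rewrite size_map size_iota => jR.
rewrite !(nth_map 0%N) ?size_iota ?(ltn_trans ij) // !nth_iota ?(ltn_trans ij) // !add0n => e.
exists (j - i)%N; first by rewrite subn_gt0.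
have [[rR hi] [_ hj]] := (hf i, hf j).
have Gr := Pn_inG (reps_in hR rR).
have : coset_rel (Pn m s) (gpow g j) (gpow g i).
  by apply: (coset_trans sg Gr); [rewrite e | apply: (coset_sym sg)].
by rewrite /coset_rel -(subnK (ltnW ij)) gpowD mulgK ?addnK //; apply: Pn_inG (hk i).
Qed.

(** * Weights of a maximal compact subgroup *)

Section Weight.
Variables (C : closedFieldType) (W : lmodType C) (sigma : 'M[E]_3 -> W -> W).
Hypothesis charC : p \in [pchar C].
Hypothesis Hs : smooth_irrep conj v c sigma.
Implicit Types (S : W -> Prop) (g h k u : 'M[E]_3) (x y z : W).

Lemma s_lin k : Pn 0 sK k -> linop (sigma k).
Proof. by move=> /inK_Pn hk a x y; case: Hs => h _ _ _ _; apply: h. Qed.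
Lemma s_1 x : sigma 1%:M x = x.
Proof. by case: Hs => _ h _ _ _. Qed.
Lemma s_M k k' x : Pn 0 sK k -> Pn 0 sK k' -> sigma (k *m k') x = sigma k (sigma k' x).
Proof. by move=> /inK_Pn hk /inK_Pn hk'; case: Hs => _ _ h _ _; apply: h. Qed.
Lemma s_smooth (s : int) x :
  exists2 m : nat, (0 < m)%N & forall g, Pn m%:Z s g -> sigma g x = x.
Proof.
case: Hs => _ _ _ /(_ x) [N hN] _; have [m m0 hm] := Pn_cong1 s N.+1.
by exists m => // g hg; apply: hN; [apply: Pn_inG hg | apply: hm].
Qed.
Lemma s_irr S : subsp S -> (forall k y, Pn 0 sK k -> S y -> S (sigma k y)) ->
  (exists2 x, S x & x <> 0) -> forall y, S y.
Proof.
move=> [hS0 hS] Sk [x Sx x0]; case: Hs => _ _ _ _ [_ /(_ S hS0 hS)].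
case; last by move=> h; case: x0; apply: h.
  by move=> k y /inK_Pn hk; apply: Sk.
by [].
Qed.
Lemma s_nontrivial : exists x : W, x <> 0.
Proof. by case: Hs => _ _ _ _ [[x /eqP x0] _]; exists x. Qed.

Lemma s_Vl k x : Pn 0 sK k -> sigma (ginv k) (sigma k x) = x.
Proof. by move=> hk; rewrite -s_M ?ginvVl ?s_1 //; [apply: Pn_inG hk | apply: PnV]. Qed.
Lemma s_Vr k x : Pn 0 sK k -> sigma k (sigma (ginv k) x) = x.
Proof. by move=> hk; rewrite -s_M ?ginvV ?s_1 //; [apply: Pn_inG hk | apply: PnV]. Qed.

Lemma I1K g : Pn 1 sI g -> Pn 0 sK g. Proof. exact: sI_sK. Qed.
Lemma IK g : Pn 0 sI g -> Pn 0 sK g. Proof. exact: sI_sK. Qed.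
Lemma JK g : Pn 0 sJ g -> Pn 0 sK g. Proof. exact: sJ_sK. Qed.
Lemma J1K g : Pn 1 sJ g -> Pn 0 sK g. Proof. exact: sJ_sK. Qed.

Lemma s_gpow k n x : Pn 0 sK k -> sigma (gpow k n) x = iter n (sigma k) x.
Proof.
move=> hk; elim: n => [|n IH]; first exact: s_1.
by rewrite gpowS s_M ?IH //; apply: Pn_pow.
Qed.

Lemma s_comm g h x : Pn 0 sK g -> Pn 0 sK h ->
  sigma g (sigma h x) - sigma h (sigma g x) =
  sigma (h *m g) (sigma (ginv (h *m g) *m (g *m h)) x - x).
Proof.
move=> hg hh; have hhg : Pn 0 sK (h *m g) by apply: PnM.
have hgh : Pn 0 sK (g *m h) by apply: PnM.
have hV : Pn 0 sK (ginv (h *m g)) by apply: PnV.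
by rewrite (linopB _ _ (s_lin hhg)) (s_M _ hV hgh) s_Vr // !s_M.
Qed.

Lemma s_conj g h x : Pn 0 sK g -> Pn 0 sK h ->
  sigma h (sigma g x) = sigma g (sigma (ginv g *m h *m g) x).
Proof.
move=> hg hh; have hh' : Pn 0 sK (ginv g *m h *m g) by apply: PnJV.
rewrite -(s_M _ hh hg) -(s_M _ hg hh') !mulmxA ginvV ?mul1mx //.
exact: Pn_inG hg.
Qed.

Lemma s_M3 g h k x : Pn 0 sK g -> Pn 0 sK h -> Pn 0 sK k ->
  sigma (g *m h *m k) x = sigma g (sigma h (sigma k x)).
Proof.
move=> hg hh hk; have hgh : Pn 0 sK (g *m h) by apply: PnM.
by rewrite (s_M _ hgh hk) (s_M _ hg hh).
Qed.

Lemma s_wl2 x : sigma wl (sigma wl x) = x.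
Proof. by rewrite -(s_M _ wl_K wl_K) wl2 s_1. Qed.

Lemma s_wl k x : Pn 0 sK k -> sigma wl (sigma k x) = sigma (wl *m k *m wl) (sigma wl x).
Proof. by move=> hk; rewrite (s_M3 _ wl_K hk wl_K) s_wl2. Qed.

Lemma s_wlV k x : Pn 0 sK k -> sigma k (sigma wl x) = sigma wl (sigma (wl *m k *m wl) x).
Proof. by move=> hk; rewrite (s_M3 _ wl_K hk wl_K) s_wl2. Qed.

Lemma PnI_K (m : nat) g : Pn m%:Z sI g -> Pn 0 sK g.
Proof. by move=> hg; apply: IK; apply: Pn_le hg. Qed.

(* Descending the filtration of the pro-p group [I_1], whose successive quotients are finite
   abelian groups of exponent p. *)
Lemma I1_fixed_mod S S' : subsp S -> subsp S' ->
  (forall g y, Pn 1 sI g -> S y -> S (sigma g y)) ->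
  (forall g y, Pn 1 sI g -> S' y -> S' (sigma g y)) ->
  (exists2 x, S x & ~ S' x) ->
  exists x, [/\ S x, ~ S' x & forall g, Pn 1 sI g -> S' (sigma g x - x)].
Proof.
move=> hS hS' gS gS' [x0 Sx0 S'x0].
have [m0 m00 hm0] := s_smooth sI x0.
have : exists x, [/\ S x, ~ S' x & forall g, Pn m0%:Z sI g -> S' (sigma g x - x)].
  by exists x0; split=> // g /hm0 ->; rewrite subrr; case: hS'.
case: m0 m00 {hm0} => // m _; elim: m => // m IH [x1 [Sx1 S'x1 hx1]]; apply: IH.
have le1 g : Pn m.+1%:Z sI g -> Pn 1 sI g by apply: Pn_le; lia.
have leS g : Pn m.+2%:Z sI g -> Pn m.+1%:Z sI g by apply: Pn_le; lia.
have mS : (m.+1%:Z + 1 : int) = m.+2%:Z by lia.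
pose S1 y := S y /\ forall g, Pn m.+2%:Z sI g -> S' (sigma g y - y).
have hS1 : subsp S1.
  split.
    split=> [|g hg]; first by case: hS.
    by rewrite (linop0 (s_lin (PnI_K hg))) subrr; case: hS'.
  move=> a y z [Sy hy] [Sz hz]; split=> [|g hg]; first exact: (proj2 hS).
  rewrite (s_lin (PnI_K hg)) opprD addrACA -scalerBr.
  by apply: (proj2 hS'); [apply: hy | apply: hz].
have sg := @Pn_subgroup m.+2%:Z sI isT.
have [|R hR] := @coset_reps_exist _ sg (Pn m.+1%:Z sI) m.+2%:Z sI 0 _ isT (fun _ hg => hg).
  by move=> g hg; rewrite oppr0; apply/Pn0; apply: Pn_le hg.
have gS1 g y : Pn m.+1%:Z sI g -> S1 y -> S1 (sigma g y).
  move=> hg [Sy hy]; split=> [|h hh]; first by apply: gS => //; apply: le1.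
  have Kg := PnI_K hg; have Kh := PnI_K hh.
  have hh' : Pn m.+2%:Z sI (ginv g *m h *m g) by apply: PnJV => //; apply: Pn_le hg.
  rewrite s_conj // -(linopB _ _ (s_lin Kg)).
  by apply: gS'; [apply: le1 | apply: hy].
have [] := @common_eigenvector_mod C W _ (Pn m.+1%:Z sI) sigma S' R S1.
- by move=> g /PnI_K /s_lin.
- exact: hS'.
- by move=> g y /le1; apply: gS'.
- by move=> g /(reps_in hR).
- exact: hS1.
- exact: gS1.
- move=> g h y hg hh [Sy hy].
  rewrite s_comm; [|exact: PnI_K hg|exact: PnI_K hh].
  have hhg : Pn m.+1%:Z sI (h *m g) by apply: PnM.
  apply: gS'; first exact: le1.
  by apply: hy; apply: Pn_le (Pn_commutator _ hg hh); lia.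
- move=> g hg; exists p; first exact: prime_gt0 (p_prime HE).
  move=> y [Sy hy]; rewrite -s_gpow; last exact: PnI_K hg.
  by apply: hy; rewrite -mS; apply: Pn_pow_p => //; lia.
- by exists x1.
move=> x [[Sx hx] S'x hxR]; exists x; split=> // g hg.
have [r rR hgr] := reps_cover hR hg.
have hr := reps_in hR rR; have Kr := PnI_K hr.
have [a ha] := hxR r rR.
have hk n : S' (iter n (sigma r) x - a ^+ n *: x).
  elim: n => [|n IHn]; first by rewrite expr0 scale1r subrr; case: hS'.
  have -> : iter n.+1 (sigma r) x - a ^+ n.+1 *: x =
      sigma r (iter n (sigma r) x - a ^+ n *: x) + a ^+ n *: (sigma r x - a *: x).
    rewrite (linopB _ _ (s_lin Kr)) (linopZ _ _ (s_lin Kr)) scalerBr scalerA -exprSr.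
    by rewrite addrA subrK.
  by apply: subspD => //; [apply: gS' => //; apply: le1 | apply: subspZ].
(* The p-th power of [r] lies one step deeper and fixes [x] modulo [S'], so [a ^+ p = 1]; in
   characteristic p this reads [(a - 1) ^+ p = 0]. *)
have a1 : a = 1.
  have h1 : S' ((a ^+ p - 1) *: x).
    rewrite scalerBl scale1r.
    have -> : a ^+ p *: x - x = (sigma (gpow r p) x - x) - (iter p (sigma r) x - a ^+ p *: x).
      by rewrite (s_gpow _ _ Kr) opprB [RHS]addrC addrA subrK.
    by apply: subspB => //; apply: hx; rewrite -mS; apply: Pn_pow_p => //; lia.
  have e : (a - 1) ^+ p = a ^+ p - 1 by rewrite -!(pFrobenius_autE charC) rmorphB rmorph1.
  apply/eqP; rewrite -subr_eq0; apply: contrapT => /negP a1; apply: S'x.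
  by apply: (subspZ_inv hS' _ h1); rewrite -e expf_neq0.
have -> : sigma g x - x = sigma (g *m ginv r) (sigma r x - x) + (sigma (g *m ginv r) x - x).
  have hz := PnI_K hgr.
  rewrite (linopB _ _ (s_lin hz)) -s_M // mulgVK; last exact: Pn_inG hr.
  by rewrite addrA subrK.
apply: subspD => //; last exact: hx.
by apply: gS'; [apply: le1; apply: leS | move: ha; rewrite a1 scale1r].
Qed.

Lemma s_linI g : Pn 0 sI g -> linop (sigma g). Proof. by move=> /IK /s_lin. Qed.

Definition fixedI1 y := forall g, Pn 1 sI g -> sigma g y = y.

Lemma fixedI1_subsp : subsp fixedI1.
Proof.
split=> [g /I1K /s_lin /linop0 //|a x y hx hy g hg].
by rewrite (s_lin (I1K hg)) hx // hy.
Qed.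

Definition eigenI x := [/\ x <> 0, fixedI1 x
  & forall g, Pn 0 sI g -> exists a, sigma g x = a *: x].

Lemma subsp_zero : subsp (fun y : W => y = 0).
Proof. by split=> // a x y -> ->; rewrite scaler0 addr0. Qed.

(** On the invariants of [I_1] the Iwahori subgroup acts by commuting operators of finite order, so
    finitely many coset representatives have a common eigenvector. *)
Lemma eigenI_exists S : subsp S -> (forall g y, Pn 0 sI g -> S y -> S (sigma g y)) ->
  (exists2 x, S x & x <> 0) -> exists2 x, S x & eigenI x.
Proof.
move=> hS gS S0; have sg := @Pn_subgroup 1 sI isT.
have [||x1 [Sx1 x10 hx1]] := I1_fixed_mod hS subsp_zero _ _ S0.
- by move=> g y hg; apply: gS; apply: Pn_le hg.
- by move=> g y /I1K /s_lin hg ->; apply: linop0.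
have [|R hR] := @coset_reps_exist _ sg (Pn 0 sI) 1 sI 0 _ isT (fun _ hg => hg).
  by move=> g hg; rewrite oppr0; apply/Pn0.
pose S1 y := S y /\ fixedI1 y.
have fixJ g y : Pn 0 sI g -> fixedI1 y -> fixedI1 (sigma g y).
  move=> hg hy h hh; have hh' : Pn 1 sI (ginv g *m h *m g) by apply: PnJV.
  by rewrite (s_conj _ (IK hg) (I1K hh)) (hy _ hh').
have [] := @common_eigenvector_mod C W _ (Pn 0 sI) sigma (fun y => y = 0) R S1.
- by move=> g /s_linI.
- exact: subsp_zero.
- by move=> g y /s_linI hg ->; apply: linop0.
- by move=> g /(reps_in hR).
- by apply: subsp_and => //; apply: fixedI1_subsp.
- by move=> g y hg [Sy hy]; split; [apply: gS | apply: fixJ].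
- move=> g h y hg hh [Sy hy].
  rewrite s_comm; [|exact: IK hg|exact: IK hh].
  rewrite hy ?subrr; last exact: Iwahori_commutator.
  by apply: linop0; apply: s_linI; apply: PnM.
- move=> g hg; have [d d0 hd] := Pn_finite_order (m := 1) isT hg.
  by exists d => // y [Sy hy]; rewrite -s_gpow ?hy ?subrr //; apply: IK.
- by exists x1 => //; split=> // g /hx1 /eqP; rewrite subr_eq0 => /eqP.
move=> x [[Sx hx] x0 hxR]; exists x => //; split=> // g hg.
have [r rR hgr] := reps_cover hR hg; have hr := reps_in hR rR.
have [a /eqP] := hxR r rR; rewrite subr_eq0 => /eqP ha; exists a.
rewrite -[g](mulgVK _ (Pn_inG hr)) s_M; [|exact: I1K|exact: IK].
by rewrite ha (linopZ _ _ (s_lin (I1K hgr))) hx.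
Qed.

(** [K^1] is normal in K, so its invariants form a K-stable subspace; they are nonzero because [K^1]
    lies in [I_1], which fixes a nonzero vector. Irreducibility concludes. *)
Lemma K1_trivial g x : Pn 1 sK g -> sigma g x = x.
Proof.
move=> hg; move: x g hg.
pose S y := forall g, Pn 1 sK g -> sigma g y = y.
have K1K g : Pn 1 sK g -> Pn 0 sK g by apply: Pn_le.
suff h : forall y, S y by move=> y g; apply: h.
apply: s_irr.
- split=> [g /K1K /s_lin /linop0 //|a x y hx hy g hg].
  by rewrite (s_lin (K1K _ hg)) hx // hy.
- move=> k y hk hy g hg; have hg' : Pn 1 sK (ginv k *m g *m k) by apply: PnJV.
  by rewrite (s_conj _ hk (K1K _ hg)) (hy _ hg').
have [x0 hx0] := s_nontrivial.
have [||||x [_ x1 hx]] := @I1_fixed_mod (fun _ => True) _ _ subsp_zero; last first.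
- exists x => // g /sK_sI hg; have /eqP := hx g hg.
  by rewrite subr_eq0 => /eqP.
- by exists x0.
- by move=> g y /I1K /s_lin hg ->; apply: linop0.
- by [].
- by [].
Qed.

Lemma s_K1_diff g h x : Pn 0 sK h -> inG conj g -> Pn 1 sK (g *m ginv h) ->
  sigma g x = sigma h x.
Proof.
move=> hh Gg hgh; have hz : Pn 0 sK (g *m ginv h) by apply: Pn_le hgh.
by rewrite -{1}[g](mulgVK _ (Pn_inG hh)) (s_M _ hz hh) (K1_trivial _ hgh).
Qed.

(** * Big cells *)

Definition bigcell x := spanP (fun z => exists2 u, Pn 1 sI u & z = sigma u (sigma wl x)).

Lemma bigcell_subsp x : subsp (bigcell x). Proof. exact: spanP_subsp. Qed.

Lemma bigcell_gen x u : Pn 1 sI u -> bigcell x (sigma u (sigma wl x)).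
Proof. by move=> hu; apply: spanP_gen; exists u. Qed.

Lemma bigcell_stable x S k y : subsp S -> Pn 0 sK k ->
  (forall u, Pn 1 sI u -> S (sigma k (sigma u (sigma wl x)))) ->
  bigcell x y -> S (sigma k y).
Proof.
move=> hS hk h hy; apply: (hy (fun y => S (sigma k y))).
  exact: (subsp_preim (s_lin hk) hS).
by move=> _ [u hu ->]; apply: h.
Qed.

(** Factoring the inverse of [g *m u] writes [g *m u] with its triangular part on the right. There
    [wl] conjugates that part into the Iwahori subgroup, for which [x] is an eigenvector. *)
Lemma bigcell_I x g y : eigenI x -> Pn 0 sI g -> bigcell x y -> bigcell x (sigma g y).
Proof.
move=> [_ _ ex] hg; apply: bigcell_stable; [exact: bigcell_subsp | exact: IK |].
move=> u hu; have hgu : Pn 0 sI (g *m u) by apply: PnM => //; apply: Pn_le hu.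
have [d [u' [e dI dJ /unipK_I1 hu']]] := Iwahori_factor (m := 0) isT (PnV (m := 0) isT hgu).
have [Kg Ku] := (IK hg, I1K hu).
have [Kd Ku'] := (IK dI, I1K hu').
have e' : g *m u = ginv u' *m ginv d by rewrite -ginvM -e ginvK.
have hd' : Pn 0 sI (wl *m ginv d *m wl) by apply: PnJ_wl; apply: PnV.
have [a ha] := ex _ hd'.
have Ku'V := PnV (m := 0) isT Ku'; have KdV := PnV (m := 0) isT Kd.
rewrite -(s_M _ Kg Ku) e' (s_M _ Ku'V KdV) (s_wlV _ KdV) ha.
rewrite (linopZ _ _ (s_lin wl_K)) (linopZ _ _ (s_lin Ku'V)).
by apply: (subspZ _ (bigcell_subsp _)); apply: bigcell_gen; apply: PnV.
Qed.

Lemma bigcell_I1 x u y : Pn 1 sI u -> bigcell x y -> bigcell x (sigma u y).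
Proof.
move=> hu; apply: bigcell_stable; [exact: bigcell_subsp | exact: I1K |].
move=> u' hu'; rewrite -(s_M _ (I1K hu) (I1K hu')).
by apply: bigcell_gen; apply: PnM.
Qed.

Lemma wl_cell x u : eigenI x -> Pn 1 sI u -> ~ Pn 1 sK u ->
  exists a u1, Pn 1 sI u1 /\ sigma wl (sigma u (sigma wl x)) = a *: sigma u1 (sigma wl x).
Proof.
move=> [_ _ ex] hu nu; case: (I1_cells hu) => // -[u1 [b [hu1 hb e]]].
have [a ha] := ex _ hb; exists a, u1; split=> //.
have [[Ku Ku1] Kb] := (I1K hu, I1K hu1, IK hb).
rewrite -(s_M3 _ wl_K Ku wl_K) e (s_M3 _ Ku1 wl_K Kb) ha.
by rewrite (linopZ _ _ (s_lin wl_K)) (linopZ _ _ (s_lin Ku1)).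
Qed.

Lemma wl_cell_K1 x u : Pn 1 sK u -> sigma wl (sigma u (sigma wl x)) = x.
Proof.
by move=> hu; rewrite (K1_trivial _ hu) s_wl2.
Qed.

Lemma bigcell_wl x S y : subsp S -> eigenI x -> S x -> (forall z, bigcell x z -> S z) ->
  bigcell x y -> S (sigma wl y).
Proof.
move=> hS ex Sx hxS; apply: bigcell_stable => // [|u hu]; first exact: wl_K.
have [hK|hK] := pselect (Pn 1 sK u); first by rewrite wl_cell_K1.
have [a [u1 [hu1 ->]]] := wl_cell ex hu hK.
by apply: subspZ => //; apply: hxS; apply: bigcell_gen.
Qed.

Lemma K_stable S : subsp S -> (forall g y, Pn 0 sI g -> S y -> S (sigma g y)) ->
  (forall y, S y -> S (sigma wl y)) -> forall k y, Pn 0 sK k -> S y -> S (sigma k y).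
Proof.
move=> hS SI Swl k y /K_cells [hk|[u [b [hu hb ->]]]] Sy; first exact: SI.
have uI : Pn 0 sI u by apply: Pn_le hu.
rewrite (s_M3 _ (IK uI) wl_K (IK hb)).
by apply: (SI) => //; apply: Swl; apply: SI.
Qed.

Definition good x := forall y, bigcell x y.

Lemma s_neq0 k x : Pn 0 sK k -> x <> 0 -> sigma k x <> 0.
Proof.
move=> hk x0 e; apply: x0.
by rewrite -(s_Vl x hk) e (linop0 (s_lin (PnV (m := 0) isT hk))).
Qed.

(** Applying [wl] to the big cell can leave it only through multiples of [x]. If [x] is in the cell,
    the Bruhat decomposition makes the cell K-stable. *)
Lemma good_self x : eigenI x -> bigcell x x -> good x.
Proof.
move=> ex hx; apply: s_irr; first exact: bigcell_subsp.
  apply: K_stable; first exact: bigcell_subsp.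
    by move=> g y; apply: bigcell_I.
  by move=> y; apply: bigcell_wl => //; apply: bigcell_subsp.
exists (sigma wl x); last by apply: s_neq0; [apply: wl_K | case: ex].
by rewrite -[sigma wl x]s_1; apply: bigcell_gen; apply: Pn1.
Qed.

(** The quotient of [W] by this subspace is the space of [I_1]-coinvariants. *)
Definition augI1 := spanP (fun z => exists u t, Pn 1 sI u /\ z = sigma u t - t).

Lemma augI1_subsp : subsp augI1. Proof. exact: spanP_subsp. Qed.

Lemma augI1_gen u t : Pn 1 sI u -> augI1 (sigma u t - t).
Proof. by move=> hu; apply: spanP_gen; exists u, t. Qed.

Lemma augI1_I g y : Pn 0 sI g -> augI1 y -> augI1 (sigma g y).
Proof.
move=> hg hy; apply: (hy (fun y => augI1 (sigma g y))).
  exact: (subsp_preim (s_linI hg) augI1_subsp).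
move=> _ [u [t [hu ->]]].
have hu' : Pn 1 sI (g *m u *m ginv g) by apply: PnJ.
have [[Kg Ku] Ku'] := (IK hg, I1K hu, I1K hu').
rewrite (linopB _ _ (s_lin Kg)).
have -> : sigma g (sigma u t) = sigma (g *m u *m ginv g) (sigma g t).
  by rewrite -(s_M _ Kg Ku) -(s_M _ Ku' Kg) (mulgVK _ (Pn_inG Kg)).
exact: augI1_gen.
Qed.

Lemma bigcell_aug x y : bigcell x y -> exists a, augI1 (y - a *: sigma wl x).
Proof.
move=> h; suff [x1 [_ [hx1 [a ->] ->]]] : addsp augI1 (line (sigma wl x)) y.
  by exists a; rewrite addrK.
apply: h; first by apply: addsp_subsp; [apply: augI1_subsp | apply: line_subsp].
move=> _ [u hu ->]; exists (sigma u (sigma wl x) - sigma wl x), (sigma wl x).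
by split; [apply: augI1_gen | exists 1; rewrite scale1r | rewrite subrK].
Qed.

(** * The operator of the double coset of [wl] on the invariants of [I_1] *)

Section Tau.
Variable R : seq 'M[E]_3.
Hypothesis hR : reps (Pn 1 sI) (coset_rel (Pn 1 sK)) R.

Let sK1 := @Pn_subgroup 1 sK isT.

Let rI r : r \in R -> Pn 1 sI r. Proof. exact: (reps_in hR). Qed.

Let F_inv x : forall r u, Pn 1 sI r -> Pn 1 sI u -> coset_rel (Pn 1 sK) r u ->
  sigma r x = sigma u x.
Proof.
move=> r u hr hu e; apply: s_K1_diff => //; first exact: I1K.
exact: Pn_inG hr.
Qed.

Definition tau x := \sum_(r <- R) sigma r (sigma wl x).

Lemma reindexR (f : 'M[E]_3 -> 'M[E]_3) x :
  (forall g, Pn 1 sI g -> Pn 1 sI (f g)) ->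
  (forall g h, Pn 1 sI g -> Pn 1 sI h ->
     (coset_rel (Pn 1 sK) (f g) (f h) <-> coset_rel (Pn 1 sK) g h)) ->
  \sum_(r <- R) sigma (f r) x = \sum_(r <- R) sigma r x.
Proof.
move=> fI fe.
apply: (reps_reindex (S := Pn 1 sI) (e := coset_rel (Pn 1 sK)) _ _ hR
          (f := f) fI fe (F := fun r => sigma r x)).
- by move=> y z _ _; apply: coset_sym.
- by move=> x1 x2 x3 _ h2 _; apply: coset_trans; [exact: sK1 | exact: Pn_inG h2].
- exact: F_inv.
Qed.

Lemma reindexR_conj g x : Pn 0 sK g -> (forall u, Pn 1 sI u -> Pn 1 sI (g *m u *m ginv g)) ->
  \sum_(r <- R) sigma (g *m r *m ginv g) x = \sum_(r <- R) sigma r x.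
Proof.
move=> hg hI; have Gg := Pn_inG hg; apply: reindexR => // u t hu ht; rewrite /coset_rel.
have -> : g *m u *m ginv g *m ginv (g *m t *m ginv g) = g *m (u *m ginv t) *m ginv g.
  by rewrite !ginvM ginvK !mulmxA mulgVK.
split=> h; last exact: PnJ.
have := PnJV (m := 1) isT hg h; rewrite !mulmxA ginvVl // mul1mx mulgVK //.
Qed.

Lemma sum_R_left u x : Pn 1 sI u ->
  sigma u (\sum_(r <- R) sigma r x) = \sum_(r <- R) sigma r x.
Proof.
move=> hu; have Ku := I1K hu; have Gu := Pn_inG hu.
rewrite (linop_sum _ _ (s_lin Ku)) -[RHS](reindexR (f := fun r => u *m r)).
- by rewrite !big_seq; apply: eq_bigr => r /rI hr; rewrite s_M //; apply: I1K.
- by move=> g hg; apply: PnM.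
move=> g h hg hh; rewrite /coset_rel ginvM mulmxA -(mulmxA u).
split=> hgh; last exact: PnJ.
by have := PnJV (m := 1) isT Ku hgh; rewrite !mulmxA ginvVl // mul1mx mulgVK.
Qed.

Lemma sum_R_right u x : Pn 1 sI u ->
  \sum_(r <- R) sigma r (sigma u x) = \sum_(r <- R) sigma r x.
Proof.
move=> hu; have Ku := I1K hu; have Gu := Pn_inG hu.
rewrite -[RHS](reindexR (f := fun r => r *m u)).
- by rewrite !big_seq; apply: eq_bigr => r /rI hr; rewrite s_M //; apply: I1K.
- by move=> g hg; apply: PnM.
by move=> g h hg hh; rewrite /coset_rel ginvM mulmxA mulgK.
Qed.

Lemma tau_eigen x : eigenI x -> tau x <> 0 -> eigenI (tau x).
Proof.
move=> [x0 fx ex] t0; have ft : fixedI1 (tau x) by move=> g; apply: sum_R_left.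
split=> // g /(Iwahori_factor (m := 0) isT) [d [u [-> dI dJ /unipK_I1 hu]]].
have Kd := IK dI; have Gd := Pn_inG Kd.
rewrite (s_M _ Kd (I1K hu)) (ft _ hu).
have [a ha] := ex _ (PnJ_wl dJ); exists a.
rewrite (linop_sum _ _ (s_lin Kd)).
have e r : r \in R -> sigma d (sigma r (sigma wl x)) =
    a *: sigma (d *m r *m ginv d) (sigma wl x).
  move=> /rI hr; have Kr := I1K hr.
  have Kr' : Pn 0 sK (d *m r *m ginv d) by apply: PnJ.
  rewrite -(linopZ _ _ (s_lin Kr')) -(linopZ _ _ (s_lin wl_K)) -ha -(s_wlV _ Kd).
  by rewrite -(s_M _ Kr' Kd) (mulgVK _ Gd) (s_M _ Kd Kr).
rewrite big_seq (eq_bigr _ e) -big_seq -scaler_sumr reindexR_conj // => u' hu'.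
exact: PnJ.
Qed.

Lemma R_K1 : exists r0, [/\ r0 \in R, Pn 1 sK r0
  & forall r, r \in R -> r != r0 -> ~ Pn 1 sK r].
Proof.
have [r0 r0R] := reps_cover hR (Pn1 sI 1).
rewrite /coset_rel mul1mx => /(PnV (m := 1) isT); rewrite ginvK => h0.
exists r0; split=> // r rR ne hr; case/eqP: ne; apply: (reps_inj hR) => //.
by apply: PnM => //; apply: PnV.
Qed.

Lemma wl_tau x r0 : r0 \in R -> Pn 1 sK r0 ->
  sigma wl (tau x) = x + \sum_(r <- R | r != r0) sigma wl (sigma r (sigma wl x)).
Proof.
move=> r0R h0; rewrite (linop_sum _ _ (s_lin wl_K)) (bigD1_seq r0) ?(reps_uniq hR) //=.
by rewrite wl_cell_K1.
Qed.

(** In [sigma wl (tau x)] the coset of [K^1] contributes [x] and the other cosets contribute vectors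
    of the big cell; a vanishing sum puts [x] in its own cell. *)
Lemma tau0_good x : eigenI x -> tau x = 0 -> good x.
Proof.
move=> ex t0; apply: good_self => //; have [r0 [r0R h0 h1]] := R_K1.
have /eqP := wl_tau x r0R h0; rewrite t0 (linop0 (s_lin wl_K)) eq_sym addr_eq0 => /eqP e.
rewrite {2}e.
apply: (subspN (bigcell_subsp _)).
rewrite big_seq_cond; apply: (subsp_sum _ (bigcell_subsp _)).
move=> r /andP [rR ne]; have [a [u1 [hu1 ->]]] := wl_cell ex (rI rR) (h1 _ rR ne).
by apply: (subspZ _ (bigcell_subsp _)); apply: bigcell_gen.
Qed.

(** Left multiplication by an element of order p modulo [K^1] permutes the cosets without fixed
    points. *)
Lemma size_R : (size R)%:R = 0 :> C.
Proof.
have [z [zI zK zp]] := order_p_element.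
apply/eqP; rewrite -(dvdn_pcharf charC).
have Gz := Pn_inG zI; have Kz := I1K zI.
apply: (reps_size_dvd (S := Pn 1 sI) (e := coset_rel (Pn 1 sK)) _ _ _ hR
   (f := fun r => z *m r)).
- by move=> x hx; apply: coset_refl; [exact: sK1 | exact: Pn_inG hx].
- by move=> y t _ _; apply: coset_sym.
- by move=> x1 x2 x3 _ h2 _; apply: coset_trans; [exact: sK1 | exact: Pn_inG h2].
- by move=> x hx; apply: PnM.
- move=> g h hg hh; rewrite /coset_rel ginvM mulmxA -(mulmxA z).
  split=> hgh; last exact: PnJ.
  by have := PnJV (m := 1) isT Kz hgh; rewrite !mulmxA ginvVl // mul1mx mulgVK.
- exact: p_prime HE.
- move=> x hx; rewrite /coset_rel mulgK //; exact: Pn_inG hx.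
- move=> x hx; have -> : iter p (fun r => z *m r) x = gpow z p *m x.
    elim: p {zp} => [|n IH]; first by rewrite mul1mx.
    by rewrite iterS IH gpowS mulmxA.
  by rewrite /coset_rel mulgK //; apply: Pn_inG hx.
Qed.

(* In the expansion of [tau (tau x)] the unit cell contributes [size R] times x, which vanishes
   in characteristic p, and every other cell a multiple of [tau x]. *)
Lemma tau_tau x : eigenI x -> line (tau x) (tau (tau x)).
Proof.
move=> ex; have [r0 [r0R h0 h1]] := R_K1; have [_ fx _] := ex.
have lin r : r \in R -> linop (sigma r) by move=> /rI /I1K /s_lin.
have -> : tau (tau x) = \sum_(r <- R | r != r0) \sum_(u <- R)
    sigma u (sigma wl (sigma r (sigma wl x))).
  rewrite exchange_big /= /tau -/(tau x) (wl_tau x r0R h0).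
  under [LHS]eq_big_seq => u uR.
    rewrite (linopD _ _ (lin _ uR)) (fx _ (rI uR)).
    rewrite -(big_filter R) (linop_sum _ _ (lin _ uR)) big_filter. over.
  rewrite big_split /= big_const_seq count_predT iter_addr_0.
  by rewrite -scaler_nat size_R scale0r add0r.
rewrite big_seq_cond; apply: (subsp_sum _ (line_subsp _)).
move=> r /andP [rR ne]; have [a [u1 [hu1 ->]]] := wl_cell ex (rI rR) (h1 _ rR ne).
exists a; rewrite -[tau x](sum_R_right _ hu1) scaler_sumr big_seq [RHS]big_seq.
by apply: eq_bigr => u uR; rewrite (linopZ _ _ (lin _ uR)).
Qed.

(** If [tau (tau x)] is a nonzero multiple of [tau x], it exhibits [tau x] as a member of its own
    big cell; if it is zero, [tau0_good] applies to [tau x]. *)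
Lemma tau_good x : eigenI x -> tau x <> 0 -> good (tau x).
Proof.
move=> ex t0; have et := tau_eigen ex t0; have [a ha] := tau_tau ex.
have [a0|a0] := eqVneq a 0.
  by apply: tau0_good => //; rewrite ha a0 scale0r.
apply: good_self => //; apply: (subspZ_inv (bigcell_subsp _) a0); rewrite -ha.
by apply: (subsp_sum_in (bigcell_subsp _)) => r /rI hr; apply: bigcell_gen.
Qed.

Lemma bigcell_fin x y : bigcell x y ->
  spanP (fun z => z \in [seq sigma r (sigma wl x) | r <- R]) y.
Proof.
move=> hy; apply: hy; first exact: spanP_subsp.
move=> _ [u hu ->]; have [r rR hur] := reps_cover hR hu.
rewrite (s_K1_diff _ _ _ hur); [|exact: I1K (rI rR)|exact: Pn_inG hu].
by apply: spanP_gen; apply: map_f.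
Qed.

End Tau.

Lemma R_exist : exists R, reps (Pn 1 sI) (coset_rel (Pn 1 sK)) R.
Proof.
apply: (@coset_reps_exist _ (@Pn_subgroup 1 sK isT) _ 1 sK 0) => // x hx.
by rewrite oppr0; apply/Pn0; apply: I1K.
Qed.

(** A pro-p group acting smoothly in characteristic p on a nonzero space with finitely many
    generators has nonzero coinvariants; [K1_trivial] makes the cell such a space. *)
Lemma bigcell_coinvariants x : x <> 0 ->
  exists S, [/\ subsp S, forall y, S y -> bigcell x y, exists2 y, bigcell x y & ~ S y
    & forall u y, Pn 1 sI u -> bigcell x y -> S (sigma u y - y)].
Proof.
move=> x0; have [R hR] := R_exist.
have hx : bigcell x (sigma wl x) by rewrite -[sigma wl x]s_1; apply: bigcell_gen; apply: Pn1.
have [] := @coinvariants_neq0 C W _ (Pn 1 sI) sigma (bigcell x)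
  [seq sigma r (sigma wl x) | r <- R].
- by move=> g /I1K /s_lin.
- exact: bigcell_subsp.
- by move=> g y; apply: bigcell_I1.
- by move=> y; apply: bigcell_fin.
- move=> S' hS' gS' _ ne; apply: I1_fixed_mod => //; first exact: bigcell_subsp.
  by move=> g y; apply: bigcell_I1.
- by exists (sigma wl x) => //; apply: s_neq0 => //; apply: wl_K.
by move=> S [h1 h2 h3 h4]; exists S.
Qed.

Lemma good_exists : exists2 x, eigenI x & good x.
Proof.
have [R hR] := R_exist; have [x0 hx0] := s_nontrivial.
have hT : subsp (fun _ : W => True) by [].
have [x _ ex] := eigenI_exists hT (fun _ _ _ _ => I) (ex_intro2 _ _ x0 I hx0).
have [t0|t0] := pselect (tau R x = 0); first by exists x => //; apply: tau0_good t0.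
by exists (tau R x); [apply: tau_eigen | apply: tau_good].
Qed.

Lemma augI1_proper : exists y, ~ augI1 y.
Proof.
have [x [x0 _ _] gx] := good_exists.
have [S [hS _ [y _ Sy] hu]] := bigcell_coinvariants x0.
exists y; apply: contra_not Sy => hy; apply: hy => // _ [u [t [hu' ->]]].
by apply: hu => //; apply: gx.
Qed.

(* If x is not in its big cell, W is the direct sum of the line of x and of the big cell, so it
   has at least two-dimensional coinvariants; but [tau x] is good, and this forces dimension
   one. *)
Lemma eigenI_good x : eigenI x -> good x.
Proof.
move=> ex; have [R hR] := R_exist.
have [hxx|hxx] := pselect (bigcell x x); first exact: good_self.
have [t0|t0] := pselect (tau R x = 0); first exact: tau0_good hR _ ex t0.
have gt := tau_good hR ex t0.
have [x0 fx exI] := ex.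
have hW y : addsp (line x) (bigcell x) y.
  have hS := addsp_subsp (line_subsp x) (bigcell_subsp x).
  have hl z : line x z -> addsp (line x) (bigcell x) z.
    by move=> hz; exists z, 0; rewrite addr0; split=> //; case: (bigcell_subsp x).
  have hb z : bigcell x z -> addsp (line x) (bigcell x) z.
    by move=> hz; exists 0, z; rewrite add0r; split=> //; case: (line_subsp x).
  have lx : line x x by exists 1; rewrite scale1r.
  apply: s_irr => //; last by exists x => //; apply: hl.
  apply: K_stable => // [g z hg|z] [_ [z2] [[a ->] hz2 ->]].
    rewrite (s_lin (IK hg)); have [b ->] := exI _ hg.
    by apply: (proj2 hS); [apply: hl; exists b | apply: hb; apply: bigcell_I].
  rewrite (s_lin wl_K); apply: (proj2 hS).
    by apply: hb; rewrite -[sigma wl x]s_1; apply: bigcell_gen; apply: Pn1.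
  by apply: bigcell_wl hz2 => //; apply: hl.
have [S [hS Sb [z hz Sz] hu]] := bigcell_coinvariants x0.
have augS y : augI1 y -> S y.
  move=> hy; apply: hy => // _ [u [t [hu' ->]]].
  have [_ [t2 [[a ->] ht2 ->]]] := hW t.
  have linu := s_lin (I1K hu').
  rewrite linu (fx _ hu') opprD addrACA subrr add0r; exact: hu.
(* As [tau x] is good, [y] spans [W] modulo [S]. Since [z] is in the cell but outside [S], and [S]
   is inside the cell, [y] and then [x] are in the cell. *)
pose y := sigma wl (tau R x).
have hmod t : exists a, S (t - a *: y).
  by have [a /augS ha] := bigcell_aug (gt t); exists a.
have [a ha] := hmod x; have [b hb] := hmod z.
have hbS := bigcell_subsp x.
have a0 : a != 0.
  by apply: contra_notN hxx => /eqP a0; apply: Sb; move: ha; rewrite a0 scale0r subr0.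
have b0 : b != 0.
  by apply: contra_notN Sz => /eqP b0; move: hb; rewrite b0 scale0r subr0.
case: hxx; suff : bigcell x (x - a *: y + a *: y) by rewrite subrK.
apply: (subspD hbS); first exact: Sb.
apply: (subspZ _ hbS); apply: (subspZ_inv hbS b0).
suff : bigcell x (z - (z - b *: y)) by rewrite subKr.
by apply: (subspB hbS) => //; apply: Sb.
Qed.

(* The span of the elements [sigma u t - t] for u in [J_1], the Weyl conjugate of [I_1]. *)
Definition augJ1 y := augI1 (sigma wl y).

Lemma augJ1_subsp : subsp augJ1.
Proof. exact: (subsp_preim (s_lin wl_K) augI1_subsp). Qed.

Lemma augJ1_gen u t : Pn 1 sJ u -> augJ1 (sigma u t - t).
Proof.
move=> hu; rewrite /augJ1 (linopB _ _ (s_lin wl_K)) s_wl; last exact: J1K.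
by apply: augI1_gen; apply: PnJ_wl.
Qed.

Lemma augJ1_J d y : Pn 0 sJ d -> augJ1 y -> augJ1 (sigma d y).
Proof.
move=> hd hy; rewrite /augJ1 s_wl; last exact: JK.
by apply: augI1_I => //; apply: PnJ_wl.
Qed.

(** The intersection of the two subspaces is stable under the Iwahori subgroup by Iwahori
    factorization, so if nonzero it contains an eigenvector [x], and [x] is good. But [sigma wl x]
    lies in [augI1], hence so does the whole cell, against [augI1_proper]. *)
Lemma fixed_augJ1 y : fixedI1 y -> augJ1 y -> y = 0.
Proof.
move=> fy ay; apply: contrapT => y0.
have [|||x [fx ax] ex] := @eigenI_exists (fun y => fixedI1 y /\ augJ1 y).
- by apply: subsp_and; [apply: fixedI1_subsp | apply: augJ1_subsp].
- move=> g z hg [fz az]; split=> [h hh|].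
    have hh' : Pn 1 sI (ginv g *m h *m g) by apply: PnJV.
    by rewrite (s_conj _ (IK hg) (I1K hh)) (fz _ hh').
  have [d [u [-> dI dJ /unipK_I1 hu]]] := Iwahori_factor (m := 0) isT hg.
  by rewrite (s_M _ (IK dI) (I1K hu)) (fz _ hu); apply: augJ1_J.
- by exists y.
have [t] := augI1_proper; apply; apply: (eigenI_good ex); first exact: augI1_subsp.
by move=> _ [u hu ->]; apply: augI1_I => //; apply: Pn_le hu.
Qed.

(* v0 spans the [I_1]-invariants, and pr is the one-dimensional quotient of [J_1]-coinvariants,
   normalized at v0. *)
Lemma weight_structure : exists (v0 : W) (pr : W -> C),
  [/\ eigenI v0, forall a x y, pr (a *: x + y) = a * pr x + pr y, pr v0 = 1,
      forall x, augJ1 (x - pr x *: v0) & forall x, augJ1 x -> pr x = 0].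
Proof.
have [v0 ev gv] := good_exists; have [v00 fv _] := ev.
have h x : exists a, augJ1 (x - a *: v0).
  have [a ha] := bigcell_aug (gv (sigma wl x)); exists a.
  by rewrite /augJ1 (linopB _ _ (s_lin wl_K)) (linopZ _ _ (s_lin wl_K)).
have [pr hpr] := @boolp.choice _ _ _ h.
have uniq0 a : augJ1 (a *: v0) -> a = 0.
  move=> ha; apply/eqP; apply: contrapT => /negP a0; apply: v00.
  apply: fixed_augJ1 => //; exact: subspZ_inv augJ1_subsp a0 ha.
have uniq a x : augJ1 (x - a *: v0) -> pr x = a.
  move=> ha; apply/eqP; rewrite -subr_eq0; apply/eqP; apply: uniq0.
  have -> : (pr x - a) *: v0 = (x - a *: v0) - (x - pr x *: v0).
    by rewrite scalerBl opprB [RHS]addrC addrA subrK.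
  exact: subspB augJ1_subsp _ _.
exists v0, pr; split=> //.
- move=> a x y; apply: uniq.
  rewrite scalerDl -scalerA opprD addrACA -scalerBr.
  exact: (proj2 augJ1_subsp).
- by apply: uniq; rewrite scale1r subrr; case: augJ1_subsp.
- by move=> x hx; apply: uniq; rewrite scale0r subr0.
Qed.

(** * The compactly induced representation *)

Section Hecke.
Variables (v0 : W) (pr : W -> C).
Hypothesis ev0 : eigenI v0.
Hypothesis prL : forall a x y, pr (a *: x + y) = a * pr x + pr y.
Hypothesis pr_v0 : pr v0 = 1.
Hypothesis pr_aug : forall x, augJ1 (x - pr x *: v0).
Hypothesis pr_aug0 : forall x, augJ1 x -> pr x = 0.

Lemma pr0 : pr 0 = 0.
Proof. by apply: pr_aug0; case: augJ1_subsp. Qed.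
Lemma prZ a x : pr (a *: x) = a * pr x.
Proof. by rewrite -[_ *: x]addr0 prL pr0 addr0. Qed.

Lemma fixedI1_line x : fixedI1 x -> x = pr x *: v0.
Proof.
move=> fx; apply/eqP; rewrite -subr_eq0; apply/eqP; apply: fixed_augJ1; last exact: pr_aug.
apply: (subspB fixedI1_subsp) => //; apply: (subspZ _ fixedI1_subsp).
by case: ev0.
Qed.

Lemma I1_unip g : Pn 1 sI g -> exists d u, [/\ g = d *m u, Pn 1 sK d & unipK u].
Proof.
move=> hg; have [d [u [e dI dJ hu]]] := Iwahori_factor (m := 1) isT hg.
by exists d, u; split=> //; apply: sIJ_K1.
Qed.

Lemma K1K g : Pn 1 sK g -> Pn 0 sK g. Proof. exact: Pn_le. Qed.
Lemma unipK_K u : unipK u -> Pn 0 sK u. Proof. by move=> /unipK_I1 /I1K. Qed.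

Lemma s_I1_unip g : Pn 1 sI g -> exists2 u, unipK u & forall x, sigma g x = sigma u x.
Proof.
move=> /I1_unip [d [u [-> hd hu]]]; exists u => // x.
by rewrite (s_M _ (K1K hd) (unipK_K hu)) K1_trivial.
Qed.

Lemma s_J1_unip g : Pn 1 sJ g ->
  exists2 u, unipK u & forall x, sigma g x = sigma (wl *m u *m wl) x.
Proof.
move=> hg; have [u hu e] := s_I1_unip (PnJ_wl hg); exists u => // x.
have Kg := J1K hg; have Ku := unipK_K hu.
rewrite (s_M3 _ wl_K Ku wl_K) -e -(s_wl _ Kg) s_wl2 //.
Qed.

Lemma unip_fixed y : (forall u, unipK u -> sigma u y = y) -> fixedI1 y.
Proof. by move=> fy g /s_I1_unip [u hu ->]; apply: fy. Qed.

(** Modulo [K^1], which acts trivially, every element of [J_1] is a [wl]-conjugate of an element of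
    [unipK]; so [L] kills [augJ1]. *)
Lemma coinvariant_factor L : linop L ->
  (forall u x, unipK u -> L (sigma (wl *m u *m wl) x) = L x) ->
  forall x, L x = pr x *: L v0.
Proof.
move=> linL hL x; apply/eqP; rewrite -subr_eq0 -(linopZ _ _ linL) -(linopB _ _ linL).
suff h0 y : augJ1 y -> L y = 0 by rewrite h0.
rewrite /augJ1 => hy; rewrite -[y]s_wl2.
apply: (hy (fun z => L (sigma wl z) = 0)).
  apply: (subsp_preim (s_lin wl_K) (S := fun z => L z = 0)).
  by apply: (subsp_preim linL (S := fun z => z = 0)); apply: subsp_zero.
move=> _ [u [t [hu ->]]].
rewrite (linopB _ _ (s_lin wl_K)) (s_wl _ (I1K hu)) (linopB _ _ linL).
have [u' hu' ->] := s_J1_unip (PnI_wl hu).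
by rewrite hL // subrr.
Qed.

(** The vectors all of whose [I_1]-translates are killed by [pr] form a stable subspace. If nonzero,
    it contains an invariant vector, a multiple of [v0], on which [pr] does not vanish. *)
Lemma unip_separates y : (forall u, unipK u -> pr (sigma u y) = 0) -> y = 0.
Proof.
move=> hy; apply: contrapT => y0.
pose S z := forall g, Pn 1 sI g -> pr (sigma g z) = 0.
have hS : subsp S.
  split=> [g /I1K /s_lin /linop0 ->|a x z hx hz g hg]; first exact: pr0.
  by rewrite (s_lin (I1K hg)) prL hx // hz // mulr0 addr0.
have Sy : S y by move=> g /s_I1_unip [u hu ->]; apply: hy.
have [|||x [Sx x0 fx]] := @I1_fixed_mod S (fun z => z = 0) hS subsp_zero.
- move=> g z hg Sz g' hg'; rewrite -(s_M _ (I1K hg') (I1K hg)); apply: Sz.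
  exact: PnM.
- by move=> g z /I1K /s_lin hg ->; apply: linop0.
- by exists y.
have {}fx : fixedI1 x by move=> g /fx /eqP; rewrite subr_eq0 => /eqP.
apply: x0; rewrite (fixedI1_line fx).
by have := Sx _ (Pn1 sI 1); rewrite s_1 => ->; rewrite scale0r.
Qed.

(* This makes [pr _ *: v0], placed on the double coset of [ts 1], a Hecke kernel. *)
Lemma intertwining k x : Pn 0 sK k -> Pn 0 sK (ts 1 *m k *m ts (- 1)) ->
  pr (sigma k x) *: v0 = sigma (ts 1 *m k *m ts (- 1)) (pr x *: v0).
Proof.
move=> hk hk'; set k' := _ *m _ in hk' *.
have Gk := Pn_inG hk; have Gk' := Pn_inG hk'.
have [Fk Fk'] := (proj2 (proj1 (Pn0 _ _) hk), proj2 (proj1 (Pn0 _ _) hk')).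
have kE : k = ts (- 1) *m k' *m ts 1.
  by rewrite /k' !mulmxA tsNl mul1mx -mulmxA tsNl mulmx1.
have Fk2 : Fl 0 (sK - 4) k by have := Fl_ts (- 1) Fk'; rewrite opprK -kE mulrN1.
have Fk2' : Fl 0 (sK + 4) k' by have := Fl_ts 1 Fk; rewrite mulr1.
(* Bounds at two points of the apartment imply those in between: [sJ] lies between [sK - 4] and
   [sK], and [sI] between [sK] and [sK + 4]. *)
have kJ : Pn 0 sJ k.
  apply/Pn0; split=> // i j; have := Fk i j; have := Fk2 i j; rewrite /ge4.
  by case: eqP => //= _; move: (v _) => z; move: i j; do 2?apply: ord3P; rewrite /dg /=; clear; lia.
have kI : Pn 0 sI k'.
  apply/Pn0; split=> // i j; have := Fk' i j; have := Fk2' i j; rewrite /ge4.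
  by case: eqP => //= _; move: (v _) => z; move: i j; do 2?apply: ord3P; rewrite /dg /=; clear; lia.
have [d' [u [e dI dJ hu]]] := Iwahori_factor (m := 0) isT (PnJ_wl kJ).
pose d := wl *m d' *m wl; pose ub := wl *m u *m wl.
have kdu : k = d *m ub.
  have -> : d *m ub = wl *m (d' *m u) *m wl by rewrite /d /ub !mulmxA wlKr.
  by rewrite -e -mulmxA wlKr wlK.
have hdI : Pn 0 sI d by apply: PnJ_wl.
have hdJ : Pn 0 sJ d by apply: PnI_wl.
have hub : Pn 1 sJ ub by apply: PnI_wl; apply: unipK_I1.
have [_ fv ex] := ev0; have [a ha] := ex _ hdI.
have -> : sigma k' (pr x *: v0) = (pr x * a) *: v0.
  rewrite (linopZ _ _ (s_linI kI)) -scalerA -ha; congr (_ *: _).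
  (* Conjugation by [ts 1] leaves the diagonal unchanged, so [k'] and [d] have the same diagonal
     modulo the maximal ideal and act alike on [v0]. *)
  have hz : Pn 1 sI (ginv d *m k').
    apply: Pn_diff => //; apply: Iwahori_depth1.
      by apply: FlB; [case/Pn0: kI | case/Pn0: hdI].
    move=> i.
    have k'ii : k' i i = k i i.
      by rewrite tsrE tslE mulrAC -expfzDr // mulN1r mul1r subrr expr0z mul1r.
    have -> : (k' - d) i i = (k - d) i i by rewrite mxE [RHS]mxE k'ii.
    have -> : k - d = d *m (ub - 1%:M) by rewrite mulmxBr mulmx1 -kdu.
    have /(_ i i) : Fl 1 sJ (d *m (ub - 1%:M)).
      by apply: Fl0M; [case/Pn0: hdJ | case: hub].
    by rewrite /dg subrr mulr0 subr0.
  rewrite -[k'](mulVKg _ (Pn_inG hdI)) (s_M _ (IK hdI) (I1K hz)) (fv _ hz) //.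
congr (_ *: _); rewrite kdu (s_M _ (IK hdI) (J1K hub)).
have h1 z : pr (sigma d z) = pr z * a.
  have hz := augJ1_J hdJ (pr_aug z).
  have := pr_aug0 hz; have linD := s_lin (IK hdI).
  rewrite (linopB _ _ linD) (linopZ _ _ linD) ha scalerA -scaleNr addrC prL pr_v0 mulr1.
  by rewrite addrC => /eqP; rewrite subr_eq0 => /eqP.
rewrite h1; congr (_ * a).
have := pr_aug0 (augJ1_gen x hub); rewrite -scaleN1r addrC prL mulN1r addrC => /eqP.
by rewrite subr_eq0 => /eqP.
Qed.

(** * Functions supported on balls *)

Notation fspace := ('M[E]_3 -> W).
Implicit Types (f : fspace) (q : 'M[E]_3).

Definition equivariant (f : fspace) :=
  (forall q, ~~ inG conj q -> f q = 0) /\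
  (forall k q, Pn 0 sK k -> inG conj q -> f (k *m q) = sigma k (f q)).

(* Functions supported on the vertices at distance less than n from the base vertex. *)
Definition ball (n : nat) (f : fspace) := equivariant f /\
  forall (m : nat) k, (n <= m)%N -> Pn 0 sK k -> f (ts m%:Z *m k) = 0.

Definition indA (f : fspace) := exists n, ball n f.

Lemma lfunE a f (g : fspace) q : (a *: f + g) q = a *: f q + g q.
Proof. by []. Qed.

Lemma equivariant_subsp : subsp equivariant.
Proof.
split; first by split=> // k q /s_lin /linop0 ->.
move=> a f g [f0 fk] [g0 gk]; split=> [q hx|k q hk hx]; rewrite !lfunE.
  by rewrite f0 // g0 // scaler0 addr0.
by rewrite fk // gk // (s_lin hk).
Qed.

Lemma ball_subsp n : subsp (ball n).
Proof.
split; first by split; [case: equivariant_subsp |].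
move=> a f g [ef vf] [eg vg]; split=> [|m k hm hk]; first exact: (proj2 equivariant_subsp).
by rewrite lfunE vf // vg // scaler0 addr0.
Qed.

Lemma ball_le m n f : (m <= n)%N -> ball m f -> ball n f.
Proof. by move=> hmn [ef vf]; split=> // l k hl hk; apply: vf => //; apply: leq_trans hl. Qed.

Lemma indA_subsp : subsp indA.
Proof.
split; first by exists 0%N; case: (ball_subsp 0).
move=> a f g [m hf] [n hg]; exists (maxn m n); apply: (proj2 (ball_subsp _)).
  by apply: ball_le hf; apply: leq_maxl.
by apply: ball_le hg; apply: leq_maxr.
Qed.

Lemma equivariant_ext f q : equivariant f ->
  (forall (m : nat) k, Pn 0 sK k -> f (ts m%:Z *m k) = 0) -> f q = 0.
Proof.
move=> [f0 fk] h0; have [hx|hx] := boolP (inG conj q); last exact: f0.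
have [m [k1 [k2 [h1 h2 ->]]]] := Cartan hx.
rewrite -mulmxA fk ?h0 //; last by apply: inGM; [apply: ts_inG | apply: Pn_inG h2].
exact: linop0 (s_lin h1).
Qed.

Lemma ball0 f : ball 0 f -> f = 0.
Proof.
move=> [ef vf]; apply/funext => q; rewrite (equivariant_ext q ef) //.
by move=> m k hk; apply: vf.
Qed.

Lemma ball_support n f q : ball n f -> inG conj q -> f q <> 0 ->
  exists2 m, (m < n)%N & Fl (- (4 * m%:Z)) sK q.
Proof.
move=> [[f0 fk] vf] hx; have [m [k1 [k2 [h1 h2 ->]]]] := Cartan hx => hfx.
exists m; last first.
  apply: FlM0; last exact: (Pn_Fl _ h2).
  by apply: Fl0M; [apply: (Pn_Fl _ h1) | apply: ts_Fl].
rewrite ltnNge; apply/negP => hmn; apply: hfx.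
rewrite -mulmxA fk //; last by apply: inGM; [apply: ts_inG | apply: Pn_inG h2].
by rewrite vf // (linop0 (s_lin h1)).
Qed.

Lemma support_ball n f : equivariant f ->
  (forall q, inG conj q -> f q <> 0 -> exists2 m, (m < n)%N & Fl (- (4 * m%:Z)) sK q) ->
  ball n f.
Proof.
move=> ef hf; split=> // m k hm hk; apply: contrapT => nz.
have Gx : inG conj (ts m%:Z *m k) by apply: inGM; [apply: ts_inG | apply: Pn_inG hk].
have [l hl] := hf _ Gx nz.
rewrite -[X in X *m k](mul1mx) => hF.
have := ts_norm (Pn1 sK 0) hk hF; lia.
Qed.

(** By the Cartan decomposition bounded support means support in a ball, and local constancy follows
    from equivariance and the smoothness of [sigma]. *)
Lemma in_ind_indA f : in_ind conj v c sigma f <-> indA f.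
Proof.
split=> [[f0 fk _ [N hN]]|[n hf]].
  have ef : equivariant f by split=> // k q /inK_Pn; apply: fk.
  exists (N + 3)%N; apply: support_ball => // q hx /eqP nz.
  exists (N + 2)%N; first by lia.
  apply: (@entry_Fl _ _ (- (4 * N%:Z))); last first.
    by move=> i j; have := hN q hx nz i j; rewrite inP_ge4 mulrN.
  by rewrite /cz; case: (c); lia.
have [[f0 fk] vf] := hf; split=> //.
- by move=> k g /inK_Pn; apply: fk.
- move=> g hg; have [m m0 hm] := s_smooth sK (f g).
  have [B hB] : exists B : nat, Fl (- B%:Z) sK (ginv g).
    have [l [k1 [k2 [h1 h2 e]]]] := Cartan (inGV hg).
    exists (4 * l)%N; rewrite e PoszM; apply: FlM0; last exact: (Pn_Fl _ h2).
    by apply: Fl0M; [apply: (Pn_Fl _ h1) | apply: ts_Fl].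
  exists (m + B + 4)%N => q hx hxg.
  have hz : Pn m%:Z sK (q *m ginv g).
    split; first by apply: inGM => //; apply: inGV.
    have -> : q *m ginv g - 1%:M = (q - g) *m ginv g by rewrite mulmxBl ginvV.
    have -> : m%:Z = (m%:Z + B%:Z) + - B%:Z by rewrite addrK.
    apply: FlM => //; apply: (@entry_Fl _ _ (4 * (m + B + 4)%N%:Z)).
      by rewrite /cz; case: (c); lia.
    by move=> i j; have := hxg i j; rewrite inP_ge4 !mxE.
  rewrite -[q](mulgVK _ hg) fk //; last by apply: Pn_le hz.
  exact: hm.
- exists (n + 2)%N => q hx /eqP nz i j; have [m hm hF] := ball_support hf hx nz.
  rewrite inP_ge4; apply: Fl_entry hF; rewrite /cz; case: (c); lia.
Qed.

Lemma rtrans_equivariant g f : inG conj g -> equivariant f -> equivariant (rtrans g f).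
Proof.
move=> hg [f0 fk]; split=> [q hx|k q hk hx]; rewrite /rtrans.
  by apply: f0; rewrite inG_mulr.
by rewrite -mulmxA fk // inGM.
Qed.

Lemma rtransK_ball n k f : Pn 0 sK k -> ball n f -> ball n (rtrans k f).
Proof.
move=> hk [ef vf]; split=> [|m k' hm hk'].
  by apply: rtrans_equivariant => //; apply: Pn_inG hk.
by rewrite /rtrans -mulmxA vf //; apply: PnM.
Qed.

(** The copy of [sigma] on functions supported on K through which Frobenius reciprocity is
    applied. *)
Definition bump y : fspace := fun q => if `[< Pn 0 sK q >] then sigma q y else 0.
Definition bumpat g y : fspace := rtrans (ginv g) (bump y).

Lemma bumpE y q : Pn 0 sK q -> bump y q = sigma q y.
Proof. by move=> hx; rewrite /bump; case: asboolP. Qed.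
Lemma bump_out y q : ~ Pn 0 sK q -> bump y q = 0.
Proof. by move=> hx; rewrite /bump; case: asboolP. Qed.

Lemma bump_equivariant y : equivariant (bump y).
Proof.
split=> [q hx|k q hk hx]; first by apply: bump_out => /Pn_inG; apply/negP.
have [hxK|hxK] := pselect (Pn 0 sK q).
  by rewrite !bumpE //; [apply: s_M | apply: PnM].
rewrite !bump_out // ?(linop0 (s_lin hk)) // => hkx; apply: hxK.
by rewrite -(mulKg q (Pn_inG hk)); apply: PnM => //; apply: PnV.
Qed.

Lemma bump_lin a y z : bump (a *: y + z) = a *: bump y + bump z.
Proof.
apply/funext => g; rewrite lfunE /bump; case: asboolP => hg; first exact: s_lin.
by rewrite scaler0 addr0.
Qed.

Lemma bump_rtrans k y : Pn 0 sK k -> bump (sigma k y) = rtrans k (bump y).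
Proof.
move=> hk; apply/funext => q; rewrite /rtrans.
have [hx|hx] := pselect (Pn 0 sK q).
  by rewrite !bumpE //; [rewrite s_M | apply: PnM].
rewrite !bump_out // => hxk; apply: hx.
by rewrite -(mulgK q (Pn_inG hk)); apply: PnM => //; apply: PnV.
Qed.

Lemma bump_ball y : ball 1 (bump y).
Proof.
apply: support_ball; first exact: bump_equivariant.
move=> q hx nz; exists 0%N => //; rewrite mulr0 oppr0.
have : Pn 0 sK q by apply: contrapT => /(bump_out y).
by case/Pn0.
Qed.

Lemma bumpat_lin g a y z : bumpat g (a *: y + z) = a *: bumpat g y + bumpat g z.
Proof. by rewrite /bumpat bump_lin. Qed.

Lemma bumpat_ball (n m : nat) g y : inG conj g -> (m < n)%N -> Fl (- (4 * m%:Z)) sK g ->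
  ball n (bumpat g y).
Proof.
move=> hg hm hF; apply: support_ball.
  by apply: rtrans_equivariant; [apply: inGV | apply: bump_equivariant].
move=> q hx nz; exists m => //.
have hxg : Pn 0 sK (q *m ginv g) by apply: contrapT => /(bump_out y).
by rewrite -[q](mulgVK _ hg); apply: Fl0M => //; apply: (Pn_Fl _ hxg).
Qed.

Lemma weight_fin : exists l : seq W, forall y, spanP (fun z => z \in l) y.
Proof.
have [R hR] := R_exist; exists [seq sigma r (sigma wl v0) | r <- R] => y.
by apply: (bigcell_fin hR); apply: eigenI_good.
Qed.

Lemma ball_fin n : exists l : seq fspace,
  (forall f, f \in l -> ball n f /\ exists g y, inG conj g /\ f = bumpat g y) /\
  forall f, ball n f -> spanP (fun b : fspace => b \in l) f.
Proof.
pose S q := inG conj q /\ exists2 m, (m < n)%N & Fl (- (4 * m%:Z)) sK q.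
have sgK := @Pn_subgroup 0 sK isT.
have [R hR] : exists R, reps S (coset_rel (Pn 0 sK)) R.
  apply: (@coset_reps_exist _ sgK S 0 sK (4 * n%:Z)) => // q [hx [m hm hF]]; split=> //.
  by apply: Fl_le hF; lia.
have [lW hW] := weight_fin.
exists [seq bumpat r y | r <- R, y <- lW]; split=> [f|f hf].
  case/allpairsP => -[r y] /= [rR _ ->].
  have [hr [m hm hF]] := reps_in hR rR.
  by split; [apply: bumpat_ball hm hF | exists r, y].
have -> : f = \sum_(r <- R) bumpat r (f r).
  apply/funext => q; rewrite fct_sumE.
  have [ef vf] := hf; have [f0 fk] := ef.
  have [hx|hx] := pselect (S q).
    rewrite (reps_sum1 (S := S) (e := coset_rel (Pn 0 sK)) _ _ hR hx).
    - by rewrite /bumpat /rtrans ginvV ?bumpE ?s_1 //; [apply: Pn1 | case: hx].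
    - by move=> y z _ _; apply: coset_sym.
    - by move=> x1 x2 x3 _ [h2 _] _; apply: coset_trans.
    - move=> r y [hr _] [hy _] hry; rewrite /bumpat /rtrans.
      have hk : Pn 0 sK (r *m ginv y) by [].
      have fr : f r = sigma (r *m ginv y) (f y) by rewrite -fk // mulgVK.
      rewrite fr (bump_rtrans _ hk) /rtrans; congr (bump _ _).
      by rewrite mulmxA mulgVK.
    - move=> r rR nz; have [hr _] := reps_in hR rR.
      apply: (coset_sym sgK); apply: contrapT => hn; apply: nz.
      by rewrite /bumpat /rtrans bump_out.
  have -> : f q = 0.
    apply: contrapT => nz; apply: hx.
    have [hG|/f0 //] := boolP (inG conj q).
    by split=> //; apply: ball_support hf hG nz.
  rewrite big_seq big1 // => r rR; rewrite /bumpat /rtrans bump_out // => hk; apply: hx.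
  have [hr [m hm hF]] := reps_in hR rR.
  split; first by rewrite -(inG_mulr _ (inGV hr)); apply: Pn_inG hk.
  exists m => //; rewrite -[q](mulgVK _ hr); apply: Fl0M => //; exact: (Pn_Fl _ hk).
apply: subsp_sum_in => [|r rR]; first exact: spanP_subsp.
apply: (hW (f r) (fun y =>
  spanP (fun b : fspace => b \in [seq bumpat r y | r <- R, y <- lW]) (bumpat r y))).
  split; last first.
    by move=> a q y hx hy; rewrite bumpat_lin; apply: (proj2 (spanP_subsp _)).
  have -> : bumpat r 0 = 0.
    by have := bumpat_lin r (-1) 0 0; rewrite scaler0 addr0 scaleN1r addNr.
  by case: (spanP_subsp (fun b : fspace => b \in [seq bumpat r y | r <- R, y <- lW])).
move=> y hy; apply: spanP_gen; apply/allpairsP; exists (r, y); split=> //.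
Qed.

(** The intersection of K with its conjugate by [ts 1]; its cosets in K index the first sphere. *)
Definition edgeK k := Pn 0 sK k /\ Pn 0 sK (ts (- 1) *m k *m ts 1).

Lemma edgeK_subgroup : subgroupP edgeK.
Proof.
have e1 : ginv (ts 1) = ts (- 1) by apply: ginv_ts.
have G1 := ts_inG 1.
split.
- by move=> g [/Pn_inG].
- by split; rewrite ?mulmx1 ?tsNl; apply: Pn1.
- move=> g h [hg hg'] [hh hh']; split; first exact: PnM.
  have -> : ts (- 1) *m (g *m h) *m ts 1 = (ts (- 1) *m g *m ts 1) *m (ts (- 1) *m h *m ts 1).
    by rewrite -e1 !mulmxA mulgK.
  exact: PnM.
- move=> g [hg hg']; split; first exact: PnV.
  have -> : ts (- 1) *m ginv g *m ts 1 = ginv (ts (- 1) *m g *m ts 1).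
    by rewrite !ginvM !ginv_ts opprK mulmxA.
  exact: PnV.
Qed.

Lemma edgeK_reps_exist : exists R, reps (Pn 0 sK) (coset_rel edgeK) R.
Proof.
apply: (@coset_reps_exist _ edgeK_subgroup _ 8 sK 0) => // [g|g [Gg hg]].
  by rewrite oppr0 => /Pn0.
split; first by apply: (@Pn_le _ 8).
have hP : Pn 8 sK g by split.
have := Pn_ts (- 1) hP; rewrite opprK => -[Gg' hg']; split=> //.
apply: Fl_imp hg'.
by do 2?apply: ord3P; rewrite /dg /=; lia.
Qed.

Section HeckeOperator.

(** * The Hecke operator on the filtration by balls *)

Variable Q : seq 'M[E]_3.
Hypothesis hQ : reps (Pn 0 sK) (coset_rel edgeK) Q.

Definition heckeT (f : fspace) : fspace :=
  fun q => \sum_(k <- Q) sigma (ginv k) (pr (f (ts (- 1) *m k *m q)) *: v0).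

Lemma heckeT_term (f : fspace) q : equivariant f -> forall k k', Pn 0 sK k -> Pn 0 sK k' ->
  coset_rel edgeK k k' ->
  sigma (ginv k) (pr (f (ts (- 1) *m k *m q)) *: v0) =
  sigma (ginv k') (pr (f (ts (- 1) *m k' *m q)) *: v0).
Proof.
move=> [f0 fk] k k' hk hk' [hm hm']; set m := k *m ginv k' in hm hm'.
have Gk := Pn_inG hk; have Gk' := Pn_inG hk'; have Gt := ts_inG (- 1).
have [hq|hq] := boolP (inG conj q); last first.
  have o l : inG conj l -> f (ts (- 1) *m l *m q) = 0.
    by move=> hl; apply: f0; rewrite inG_mull //; apply: inGM.
  by rewrite !o // pr0 !scale0r !(linop0 (s_lin (PnV (m := 0) isT _))).
have kE : k = m *m k' by rewrite /m mulgVK.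
set m' := ts (- 1) *m m *m ts 1 in hm'.
have e : ts (- 1) *m k *m q = m' *m (ts (- 1) *m k' *m q).
  by rewrite kE /m' !mulmxA -[in RHS](mulmxA _ (ts 1)) tsNr mulmx1.
have Gx : inG conj (ts (- 1) *m k' *m q) by apply: inGM => //; apply: inGM.
have em : ts 1 *m m' *m ts (- 1) = m.
  by rewrite /m' !mulmxA tsNr mul1mx -mulmxA tsNr mulmx1.
rewrite e (fk _ _ hm' Gx) intertwining ?em //.
rewrite {1}kE ginvM (s_M _ (PnV (m := 0) isT hk') (PnV (m := 0) isT hm)).
by rewrite (s_Vl _ hm).
Qed.

Let sgE := edgeK_subgroup.

Lemma heckeT_equivariant (f : fspace) : equivariant f -> equivariant (heckeT f).
Proof.
move=> ef; have [f0 fk] := ef; split=> [q hq|k0 q hk0 hq].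
  rewrite /heckeT big_seq big1 // => k /(reps_in hQ) hk.
  rewrite f0 ?pr0 ?scale0r ?(linop0 (s_lin (PnV (m := 0) isT hk))) //.
  by rewrite inG_mull //; apply: inGM; [apply: ts_inG | apply: Pn_inG hk].
rewrite /heckeT (linop_sum _ _ (s_lin hk0)).
pose F k := sigma (ginv k) (pr (f (ts (- 1) *m k *m q)) *: v0).
have -> : \sum_(k <- Q) sigma k0 (F k) = \sum_(k <- Q) sigma k0 (F (k *m k0)).
  symmetry; apply: (reps_reindex (S := Pn 0 sK) (e := coset_rel edgeK) _ _ hQ
    (f := fun k => k *m k0) _ _ (F := fun k => sigma k0 (F k))).
  - by move=> y z _ _; apply: coset_sym.
  - by move=> q1 q2 q3 _ h2 _; apply: coset_trans; [exact: sgE | exact: Pn_inG h2].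
  - by move=> g hg; apply: PnM.
  - by move=> g h hg hh; rewrite /coset_rel ginvM mulmxA mulgK //; apply: Pn_inG hk0.
  - by move=> r k hr hk hrk; congr (sigma k0 _); apply: heckeT_term.
rewrite big_seq [RHS]big_seq; apply: eq_bigr => k /(reps_in hQ) hk.
rewrite /F ginvM (s_M _ (PnV (m := 0) isT hk0) (PnV (m := 0) isT hk)) (s_Vr _ hk0).
by rewrite !mulmxA.
Qed.

Lemma heckeT_lin a (f g : fspace) : heckeT (a *: f + g) = a *: heckeT f + heckeT g.
Proof.
apply/funext => q; rewrite lfunE /heckeT scaler_sumr -big_split /= big_seq [RHS]big_seq.
apply: eq_bigr => k /(reps_in hQ) hk; rewrite lfunE prL scalerDl -scalerA.
exact: (s_lin (PnV (m := 0) isT hk)).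
Qed.

Lemma heckeT_rtrans g (f : fspace) : heckeT (rtrans g f) = rtrans g (heckeT f).
Proof.
by apply/funext => q; apply: eq_bigr => k _; rewrite /rtrans mulmxA.
Qed.

Lemma heckeT_ball n (f : fspace) : ball n f -> ball n.+1 (heckeT f).
Proof.
move=> hf; have [ef vf] := hf; apply: support_ball; first exact: heckeT_equivariant.
move=> q hq nz.
have [k hkQ hfk] : exists2 k, k \in Q & f (ts (- 1) *m k *m q) <> 0.
  apply: contrapT => hn; apply: nz; rewrite /heckeT big_seq big1 // => k hkQ.
  have -> : f (ts (- 1) *m k *m q) = 0 by apply: contrapT => h'; apply: hn; exists k.
  by rewrite pr0 scale0r (linop0 (s_lin (PnV (m := 0) isT (reps_in hQ hkQ)))).
have hk := reps_in hQ hkQ; have Gk := Pn_inG hk.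
have Gx : inG conj (ts (- 1) *m k *m q).
  by apply: inGM => //; apply: inGM => //; apply: ts_inG.
have [m hm hF] := ball_support hf Gx hfk; exists m.+1 => //.
have -> : q = ginv k *m (ts 1 *m (ts (- 1) *m k *m q)).
  by rewrite !mulmxA -(mulmxA (ginv k) (ts 1)) tsNr mulmx1 ginvVl ?mul1mx.
apply: Fl0M; first by apply: Fl_ginv; apply: (Pn_Fl _ hk).
have -> : - (4 * m.+1%:Z) = - (4 * 1%N%:Z) + - (4 * m%:Z) by lia.
by apply: FlM => //; apply: (ts_Fl 1).
Qed.

(* On the outer sphere only the parent vertex contributes. *)
Lemma heckeT_sphere (n : nat) (f : fspace) k : ball n.+1 f -> Pn 0 sK k ->
  heckeT f (ts n.+1%:Z *m k) = pr (f (ts n%:Z *m k)) *: v0.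
Proof.
move=> hf hk; have [ef vf] := hf; have Gk := Pn_inG hk.
have tS : ts n.+1%:Z = ts (n%:Z + 1) by congr ts; lia.
rewrite /heckeT (reps_sum1 (S := Pn 0 sK) (e := coset_rel edgeK) _ _ hQ (x := 1%:M)).
- rewrite ginv1 s_1 mulmx1 mulmxA -tsD; congr (pr (f (ts _ *m k)) *: v0); lia.
- by move=> y z _ _; apply: coset_sym.
- by move=> q1 q2 q3 _ h2 _; apply: coset_trans; [exact: sgE | exact: Pn_inG h2].
- exact: Pn1.
- by move=> r l hr hl; apply: heckeT_term.
move=> r rQ nz; have hr := reps_in hQ rQ; rewrite /coset_rel ginv1 mulmx1; split=> //.
have Gx : inG conj (ts (- 1) *m r *m (ts n.+1%:Z *m k)).
  apply: inGM; first by apply: inGM; [apply: ts_inG | apply: Pn_inG hr].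
  by apply: inGM; [apply: ts_inG | apply: Gk].
have nz' : f (ts (- 1) *m r *m (ts n.+1%:Z *m k)) <> 0.
  move=> h0; apply: nz; rewrite h0 pr0 scale0r.
  exact: linop0 (s_lin (PnV (m := 0) isT hr)).
have [m hm hF] := ball_support hf Gx nz'.
apply: (@parent_unique n) => //; rewrite -tS.
have -> : ts (- 1) *m r *m ts n.+1%:Z = ts (- 1) *m r *m (ts n.+1%:Z *m k) *m ginv k.
  by rewrite -!mulmxA ginvV // mulmx1.
apply: FlM0; last by apply: Fl_ginv; apply: (Pn_Fl _ hk).
by apply: Fl_le hF; lia.
Qed.

(** By [heckeT_sphere], [pr] vanishes on all values of [f] on its outermost sphere. A unipotent
    translate of such a value is again such a value, since [ts (- n)] conjugates [unipK] into K;
    [unip_separates] then kills the value. *)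
Lemma heckeT_inj_step n (f : fspace) : ball n.+1 f -> ball n.+1 (heckeT f) -> ball n f.
Proof.
move=> hf [_ vT]; have [ef vf] := hf; split=> // m k.
rewrite leq_eqVlt => /orP [/eqP <- hk|]; last exact: vf.
have h0 l : Pn 0 sK l -> pr (f (ts n%:Z *m l)) = 0.
  move=> hl; have := heckeT_sphere hf hl; rewrite vT // => /esym /eqP.
  rewrite scaler_eq0 => /orP [/eqP //|/eqP e]; by case: ev0.
apply: unip_separates => u hu.
have Gx : inG conj (ts n%:Z *m k) by apply: inGM; [apply: ts_inG | apply: Pn_inG hk].
have [_ fk] := ef; rewrite -fk //; last exact: unipK_K.
have hu' : Pn 0 sK (ts (- n%:Z) *m u *m ts n%:Z).
  case: (n) => [|n']; last by apply: K1K; apply: unipK_contract.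
  by rewrite oppr0 ts0 mul1mx mulmx1; apply: unipK_K.
have -> : u *m (ts n%:Z *m k) = ts n%:Z *m ((ts (- n%:Z) *m u *m ts n%:Z) *m k).
  by rewrite !mulmxA tsNr mul1mx.
by apply: h0; apply: PnM.
Qed.

Lemma heckeT_inj n (f : fspace) : indA f -> ball n.+1 (heckeT f) -> ball n f.
Proof.
move=> [N hf] hT; elim: N hf => [|N IH] hf; first exact: ball_le hf.
have [hN|hN] := leqP N.+1 n; first exact: ball_le hf.
apply: IH; apply: heckeT_inj_step => //.
by apply: ball_le hT.
Qed.

Lemma heckeT_nonsurj n : (0 < n)%N -> exists2 f, ball n.+1 f &
  forall b d : fspace, ball n b -> ball n d -> f <> b + heckeT d.
Proof.
case: n => // n _; exists (bumpat (ts n.+1%:Z) v0).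
  by apply: (bumpat_ball (m := n.+1)) => //; [apply: ts_inG | apply: ts_Fl].
move=> g b [eg vg] hb e.
have [k [hk1 hk2 hk3]] := sibling_element.
(* [ts n *m l] equals [k *m ts n], where [b] has the same value as at [ts n] because [k] acts
   trivially; yet [ts n.+1 *m l] and [ts n.+1] are distinct vertices. *)
pose l := ts (- n%:Z) *m k *m ts n%:Z; have hl : Pn 0 sK l by apply: hk3.
have tS : ts n.+1%:Z = ts 1 *m ts n%:Z by rewrite -tsD; congr ts; lia.
have val0 j : Pn 0 sK j ->
    bumpat (ts n.+1%:Z) v0 (ts n.+1%:Z *m j) = pr (b (ts n%:Z *m j)) *: v0.
  move=> hj; rewrite e -(heckeT_sphere hb hj).
  by rewrite -[g]scale1r lfunE vg // scaler0 add0r.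
have := val0 _ (Pn1 sK 0); have := val0 _ hl.
have -> : ts n%:Z *m l = k *m ts n%:Z by rewrite /l !mulmxA tsNr mul1mx.
have [[_ bk] _] := hb; rewrite bk ?ts_inG //; last exact: K1K.
rewrite (K1_trivial _ hk1) !mulmx1 => <-.
have -> : bumpat (ts n.+1%:Z) v0 (ts n.+1%:Z) = v0.
  by rewrite /bumpat /rtrans ginvV ?ts_inG // bumpE ?s_1 //; apply: Pn1.
have -> : bumpat (ts n.+1%:Z) v0 (ts n.+1%:Z *m l) = 0.
  rewrite /bumpat /rtrans bump_out // => h; apply: hk2; move: h; rewrite ginv_ts.
  suff -> : ts n.+1%:Z *m l *m ts (- n.+1%:Z) = ts 1 *m k *m ts (- 1) by [].
  rewrite tS /l !mulmxA -(mulmxA (ts 1)) tsNr mulmx1 -!mulmxA -tsD.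
  by congr (_ *m (_ *m ts _)); lia.
by case: ev0.
Qed.

(** * Endomorphisms as polynomials in the Hecke operator *)

Lemma heckeT_indA f : indA f -> indA (heckeT f).
Proof. by move=> [n /heckeT_ball h]; exists n.+1. Qed.

Notation hecke := (in_hecke conj v c sigma).

Lemma hecke_indA phi f : hecke phi -> indA f -> indA (phi f).
Proof. by move=> [h _ _] /in_ind_indA /h /in_ind_indA. Qed.

Lemma hecke_lin phi a f (f' : fspace) : hecke phi -> indA f -> indA f' ->
  phi (a *: f + f') = a *: phi f + phi f'.
Proof.
move=> [_ h _] /in_ind_indA hf /in_ind_indA hf'; apply/funext => q.
exact: (h a f f' hf hf' q).
Qed.

Lemma hecke_rtrans phi g f : hecke phi -> inG conj g -> indA f ->
  phi (rtrans g f) = rtrans g (phi f).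
Proof. by move=> [_ _ h] hg /in_ind_indA hf; apply/funext => q; apply: h. Qed.

Let Tlin a f (f' : fspace) (_ : indA f) (_ : indA f') := heckeT_lin a f f'.

Lemma iter_rtrans n g f : iter n heckeT (rtrans g f) = rtrans g (iter n heckeT f).
Proof. by elim: n => //= n ->; rewrite heckeT_rtrans. Qed.

Lemma pact_hecke r : hecke (pact heckeT r).
Proof.
split.
- move=> f /in_ind_indA hf; apply/in_ind_indA.
  exact: (pactA indA_subsp heckeT_indA).
- move=> a f f' /in_ind_indA hf /in_ind_indA hf' q.
  have := pact_lin heckeT_indA Tlin r a hf hf'.
  by move=> /(congr1 (fun F : fspace => F q)).
- move=> g f hg _ q; rewrite /pact /rtrans !fct_sumE; apply: eq_bigr => i _.
  by rewrite iter_rtrans.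
Qed.

Lemma bump_indA y : indA (bump y). Proof. by exists 1%N; apply: bump_ball. Qed.

Lemma iter_bump_ball n y : ball n.+1 (iter n heckeT (bump y)).
Proof. by elim: n => [|n IH]; [apply: bump_ball | apply: heckeT_ball]. Qed.

(** As [pr v0 = 1], the value [pr y *: v0] reproduces itself from sphere to sphere; so the powers of
    the operator realize the leading term in every radius. *)
Lemma iter_bump n y : iter n.+1 heckeT (bump y) (ts n.+1%:Z) = pr y *: v0.
Proof.
have -> : ts n.+1%:Z = ts n.+1%:Z *m 1%:M by rewrite mulmx1.
elim: n => [|n IH].
  rewrite /= heckeT_sphere; [|exact: bump_ball|exact: Pn1].
  by rewrite ts0 mulmx1 bumpE ?s_1 //; apply: Pn1.
rewrite iterS heckeT_sphere; [|exact: iter_bump_ball|exact: Pn1].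
by rewrite IH prZ pr_v0 mulr1.
Qed.

Lemma hecke_bump_K phi k y : hecke phi -> Pn 0 sK k ->
  phi (bump (sigma k y)) = rtrans k (phi (bump y)).
Proof.
by move=> hphi hk; rewrite bump_rtrans // hecke_rtrans //; [apply: Pn_inG hk | apply: bump_indA].
Qed.

Lemma hecke_bump_lin phi a y z : hecke phi ->
  phi (bump (a *: y + z)) = a *: phi (bump y) + phi (bump z).
Proof. by move=> hphi; rewrite bump_lin hecke_lin //; apply: bump_indA. Qed.

(** The vectors whose image has a given radius form a K-stable subspace, so a bound valid at [v0] is
    uniform by irreducibility. *)
Lemma hecke_bound phi : hecke phi -> exists n, forall y, ball n (phi (bump y)).
Proof.
move=> hphi; have [n hn] := hecke_indA hphi (bump_indA v0); exists n.
apply: s_irr; last by exists v0 => //; case: ev0.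
  split; last by move=> a y z hy hz; rewrite hecke_bump_lin //; apply: (proj2 (ball_subsp n)).
  have -> : phi (bump 0) = 0.
    by have := hecke_bump_lin (-1) 0 0 hphi; rewrite scaler0 addr0 scaleN1r addNr.
  by case: (ball_subsp n).
by move=> k y hk hy; rewrite hecke_bump_K //; apply: rtransK_ball.
Qed.

(* Frobenius reciprocity on one double coset: the multiplicity is one. *)
Lemma hecke_leading n phi : hecke phi -> (forall y, ball n.+1 (phi (bump y))) ->
  exists a, forall y, phi (bump y) (ts n%:Z) = a *: iter n heckeT (bump y) (ts n%:Z).
Proof.
move=> hphi hn; pose L y := phi (bump y) (ts n%:Z).
have linL : linop L by move=> a y z; rewrite /L hecke_bump_lin.
have Lk k y : Pn 0 sK k -> Pn 0 sK (ts n%:Z *m k *m ts (- n%:Z)) ->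
    L (sigma k y) = sigma (ts n%:Z *m k *m ts (- n%:Z)) (L y).
  move=> hk hk'; rewrite /L hecke_bump_K // /rtrans.
  have [[_ fk] _] := hn y; rewrite -fk ?ts_inG //.
  by rewrite -[in RHS]mulmxA tsNl mulmx1.
have [_ fv _] := ev0.
case: n hn @L linL Lk => [|n] hn L linL Lk.
  have e (k : 'M[E]_3) : ts 0 *m k *m ts (- 0) = k by rewrite oppr0 ts0 mul1mx mulmx1.
  have LK k y : Pn 0 sK k -> L (sigma k y) = sigma k (L y).
    by move=> hk; rewrite Lk ?e.
  (* Schur's lemma: [L] commutes with K and maps [v0] into the line of invariants, which supplies
     the scalar. *)
  exists (pr (L v0)) => y /=; rewrite -/(L y) ts0 bumpE ?s_1; last exact: Pn1.
  move: y; apply: s_irr; last 1 first.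
  - exists v0; last by case: ev0.
    by apply: fixedI1_line => g hg; rewrite -LK ?fv //; apply: I1K.
  - split; first by rewrite (linop0 linL) scaler0.
    by move=> a y z hy hz; rewrite linL hy hz scalerDr !scalerA mulrC.
  - by move=> k y hk hy; rewrite LK // hy (linopZ _ _ (s_lin hk)).
exists (pr (L v0)) => y; rewrite iter_bump -/(L y) scalerA mulrC -scalerA.
(* Upper unipotents on the target side come from [K^1] on the source side, so [L v0] is invariant;
   the opposite ones land in [K^1] on the target side, so [L] factors through [pr]. *)
have hL : fixedI1 (L v0).
  apply: unip_fixed => u hu; have hk := unipK_contract (ltn0Sn n) hu.
  have e : ts n.+1%:Z *m (ts (- n.+1%:Z) *m u *m ts n.+1%:Z) *m ts (- n.+1%:Z) = u.
    by rewrite !mulmxA tsNr mul1mx -mulmxA tsNr mulmx1.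
  have := Lk _ v0 (K1K hk); rewrite e => /(_ (unipK_K hu)) <-.
  by rewrite (K1_trivial _ hk).
rewrite -(fixedI1_line hL); apply: coinvariant_factor => // u z hu.
have Ku := PnK_wl (unipK_K hu).
have hk := PnK_wl (unipK_contract (ltn0Sn n) hu).
have e : ts n.+1%:Z *m (wl *m u *m wl) *m ts (- n.+1%:Z) =
    wl *m (ts (- n.+1%:Z) *m u *m ts n.+1%:Z) *m wl.
  have e1 (a : int) : ts a *m wl = wl *m ts (- a) by rewrite -[in RHS]wl_ts !mulmxA wl2 mul1mx.
  have e2 (a : int) : wl *m ts a = ts (- a) *m wl by rewrite e1 opprK.
  by rewrite !mulmxA e1 -!mulmxA e2 opprK.
by rewrite Lk // e; [rewrite (K1_trivial _ hk) | apply: K1K].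
Qed.

(** Induction on the radius, subtracting the multiple of the n-th power found by [hecke_leading].
    Agreement at [ts n] for every [y] is agreement on the whole sphere, because translating by [k]
    replaces [y] by [sigma k y]. *)
Lemma hecke_poly_bump n phi : hecke phi -> (forall y, ball n (phi (bump y))) ->
  exists r, forall y, phi (bump y) = pact heckeT r (bump y).
Proof.
elim: n phi => [|n IH] phi hphi hn.
  by exists 0 => y; rewrite pact0; apply: ball0.
have [a ha] := hecke_leading hphi hn.
pose psi (f : fspace) : fspace := - a *: iter n heckeT f + phi f.
have hiter : hecke (iter n heckeT).
  have := pact_hecke 'X^n; congr (in_hecke _ _ _ _ _).
  by apply/funext => f; rewrite pactXn.
have hpsi : hecke psi.
  split.
  - move=> f /in_ind_indA hf; apply/in_ind_indA.
    by apply: (proj2 indA_subsp); apply: hecke_indA.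
  - move=> b f f' /in_ind_indA hf /in_ind_indA hf' q.
    have h1 : psi (b *: f + f') = b *: psi f + psi f'.
      rewrite /psi (hecke_lin b hphi hf hf') (hecke_lin b hiter hf hf').
      rewrite !scalerDr !scalerA [- a * b]mulrC.
      by rewrite addrACA.
    exact: (congr1 (fun F : fspace => F q) h1).
  - move=> g f hg /in_ind_indA hf q.
    by rewrite /psi (hecke_rtrans hphi hg hf) (hecke_rtrans hiter hg hf).
have hb y : ball n (psi (bump y)).
  split.
    apply: (proj2 equivariant_subsp); first by case: (iter_bump_ball n y).
    by case: (hn y).
  move=> m k; rewrite leq_eqVlt => /orP [/eqP <-|hm] hk.
    have -> : psi (bump y) (ts n%:Z *m k) = psi (bump (sigma k y)) (ts n%:Z).
      by rewrite hecke_bump_K.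
    by rewrite /psi lfunE ha scaleNr addNr.
  rewrite /psi lfunE; have [_ -> //] := iter_bump_ball n y; have [_ -> //] := hn y.
  by rewrite scaler0 addr0.
have [r hr] := IH psi hpsi hb; exists (r + a *: 'X^n) => y.
rewrite pactD pactZ pactXn -hr /psi scaleNr addrC addrA subrr add0r //.
Qed.

(** The translates of the functions [bump y] span each ball, so equality on them extends to all of
    the induced representation. *)
Lemma hecke_poly phi : hecke phi ->
  exists r, forall f, indA f -> phi f = pact heckeT r f.
Proof.
move=> hphi; have [n hn] := hecke_bound hphi.
have [r hr] := hecke_poly_bump hphi hn; exists r => f [m hf].
have hpact := pact_hecke r.
have [l [hl hspan]] := ball_fin m.
suff [] : indA f /\ phi f = pact heckeT r f by [].
apply: (hspan f hf (fun f => indA f /\ phi f = pact heckeT r f)).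
  split.
    have A0 : indA 0 by case: indA_subsp.
    split=> //; have := hecke_lin (-1) hphi A0 A0; have := hecke_lin (-1) hpact A0 A0.
    by rewrite !scaler0 !addr0 !scaleN1r !addNr => -> ->.
  move=> a f1 f2 [h1 e1] [h2 e2]; split; first exact: (proj2 indA_subsp).
  by rewrite (hecke_lin a hphi h1 h2) (hecke_lin a hpact h1 h2) e1 e2.
move=> b /hl [hb [g [y [hg e]]]]; split; first by exists m.
have hy := bump_indA y.
by rewrite e /bumpat (hecke_rtrans hphi (inGV hg) hy) (hecke_rtrans hpact (inGV hg) hy) hr.
Qed.

Lemma hecke_free : free_infinite_rank conj v c sigma.
Proof.
have [|I [b [hI hb hspan hfree]]] := @graded_free C fspace indA heckeT ball indA_subsp
  ball_subsp ball0 (fun n f => ball_le (leqnSn n)) (fun n f hf => ex_intro _ n hf)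
  (fun f hf => hf) _ Tlin heckeT_ball heckeT_inj heckeT_nonsurj.
  move=> n; have [l [h1 h2]] := ball_fin n.
  by exists l; split=> // f /h1 [].
exists I, b; split=> //.
- by move=> i; apply/in_ind_indA.
- move=> f /in_ind_indA /hspan [l [r ->]].
  exists l, (fun i => pact heckeT (r i)); split=> [i|q]; first exact: pact_hecke.
  by rewrite fct_sumE.
- move=> l phi ul hphi e i il f /in_ind_indA hf q.
  have [r hr] := @boolp.choice _ _ _ (fun i => hecke_poly (hphi i)).
  rewrite hr // (hfree l r ul _ i il) ?pact0 //.
  apply/funext => x; rewrite fct_sumE -[RHS](e x).
  by apply: eq_bigr => j _; rewrite hr //; apply: hb.
Qed.

End HeckeOperator.

End Hecke.

Lemma weight_free : free_infinite_rank conj v c sigma.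
Proof.
have [v0 [pr [ev0 prL pr_v0 pr_aug pr_aug0]]] := weight_structure.
have [Q hQ] := edgeK_reps_exist.
exact: (hecke_free ev0 prL pr_v0 pr_aug pr_aug0 hQ).
Qed.

End Weight.
End Uniformizer.
End LocalField.

Theorem theorem4p1 (E : fieldType) (conj : E -> E) (v : E -> int) (p : nat)
  (HE : unram_quad_local conj v p)
  (C : closedFieldType) (HC : is_Fpbar p C)
  (c : maxcpt) (W : lmodType C) (sigma : 'M[E]_3 -> W -> W)
  (Hsigma : smooth_irrep conj v c sigma) :
  free_infinite_rank conj v c sigma.
Proof.
have [w [wJ w0 w1]] := unif_in_F HE.
exact: (weight_free HE wJ w0 w1 (proj1 HC) Hsigma).
Qed.
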